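(* Let $p$ be a prime. Define the following orbits of $G=\mathrm{GL}_2(p)$ on the $3$-dimensional subspaces of $Z(F_p)$. For every $p$, let $O_2=G(V\oplus\langle(x,x,y)\rangle)$. If $p\ne3$, let $$O_3=G(\langle x^p,\ y^p+(x,y,y),\ (x,x,y)\rangle),\qquad O_4=G(\langle y^p,\ x^p+(x,y,y),\ (x,x,y)\rangle),$$ and if $p>3$ let in addition $$O_5=G(\langle y^p,\ \lambda x^p+(x,y,y),\ (x,x,y)\rangle),$$ where $\lambda$ is not a square in $\mathbb Z_p$. If $p=3$, let $$\begin{aligned}O_3&=G(\langle x^p+(x,y,y),\ y^p,\ (x,x,y)\rangle),\\ O_4&=G(\langle x^p-(x,y,y),\ y^p,\ (x,x,y)\rangle),\\ O_5&=G(\langle x^p-(x,y,y),\ y^p+(x,y,y),\ (x,x,y)\rangle).\end{aligned}$$ For every $i$ (that is, $i\in\{2,3,4\}$ if $p=2$ and $i\in\{2,3,4,5\}$ if $p$ is odd), let $N_i\in O_i$ and $Q_i=F_p/N_i$. There are precisely $7$ commutative automorphic loops of order $p^3$ up to isomorphism, including the three abelian groups $(\mathbb Z_p)^3$, $\mathbb Z_p\times\mathbb Z_{p^2}$, $\mathbb Z_{p^3}$. If $p$ is odd, the nonassociative commutative automorphic loops of order $p^3$ are (up to isomorphism) precisely the loops $Q_2,\dots,Q_5$. If $p=2$, the nonassociative commutative automorphic loops of order $p^3$ are (up to isomorphism) precisely the loops $Q_2,\dots,Q_4$, and the loop with multiplication table $$\begin{array}{c|cccccccc} &1&2&3&4&5&6&7&8\\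 \hline 1&1&2&3&4&5&6&7&8\\ 2&2&1&4&3&6&5&8&7\\ 3&3&4&1&2&7&8&5&6\\ 4&4&3&2&1&8&7&6&5\\ 5&5&6&7&8&1&4&2&3\\ 6&6&5&8&7&4&1&3&2\\ 7&7&8&5&6&2&3&1&4\\ 8&8&7&6&5&3&2&4&1 \end{array}$$
   Context: A loop is automorphic if all its inner mappings (the group generated by $L_{yx}^{-1}L_yL_x$, $R_{xy}^{-1}R_yR_x$, $L_x^{-1}R_x$, with $L_x(y)=xy$, $R_x(y)=yx$) are automorphisms. Elements of $\mathbb Z_p$ are identified with the integers $0,\dots,p-1$. For $0\le a,b<p$ let $(a,b)_p=0$ if $a+b<p$ and $(a,b)_p=1$ otherwise. $F_p$ is the commutative automorphic loop on $(\mathbb Z_p)^6$ with multiplication $$(a_1,\dots,a_6)(b_1,\dots,b_6)=(a_1+b_1,\ a_2+b_2,\ a_3+b_3+(a_1,b_1)_p,\ a_4+b_4+(a_2,b_2)_p,\ a_5+b_5-a_1b_1(a_2+b_2),\ a_6+b_6+a_2b_2(a_1+b_1)).$$ It is generated by $x=(1,0,0,0,0,0)$ and $y=(0,1,0,0,0,0)$. The associator is defined by $(ab)c=(a(bc))(a,b,c)$. The center $Z(F_p)=0\times0\times(\mathbb Z_p)^4$ is written additively as a $4$-dimensional vector space over $\mathbb Z_p$ with basis $x^p=(0,0,1,0,0,0)$, $y^p=(0,0,0,1,0,0)$, $(x,x,y)=(0,0,0,0,1,0)$, $(x,y,y)=(0,0,0,0,0,1)$. Let $V=\langle x^p\rangle\oplus\langle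 y^p\rangle$, where $\langle\cdot\rangle$ denotes linear span. The group $G=\mathrm{GL}_2(p)$ acts on $Z(F_p)$: $\rho=\begin{pmatrix}\alpha_1&\alpha_2\\ \beta_1&\beta_2\end{pmatrix}$ acts as the restriction to $Z(F_p)$ of the automorphism $\widehat\rho$ of $F_p$ determined by $\widehat\rho(x)=x^{\alpha_1}y^{\alpha_2}=(\alpha_1,\alpha_2,0,0,0,0)$, $\widehat\rho(y)=x^{\beta_1}y^{\beta_2}=(\beta_1,\beta_2,0,0,0,0)$. For a subspace $N$ of $Z(F_p)$, $G(N)=\{\widehat\rho(N):\rho\in G\}$ denotes its orbit. *)

(* Defs.v *)
From HB Require Import structures.
From mathcomp Require Import all_boot all_order all_algebra all_fingroup.
From mathcomp Require Import ring.

Set Implicit Arguments.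
Unset Strict Implicit.
Unset Printing Implicit Defensive.

Import GRing.Theory.

(* MathComp's magma hierarchy has no join with finType below its finite
   groups, so loops are a separate hierarchy, with notations in loop_scope. *)
Declare Scope loop_scope.
Delimit Scope loop_scope with L.

HB.mixin Record isLoop T := {
  lmul : T -> T -> T;
  lone : T;
  lmul1l : left_id lone lmul;
  lmull1 : right_id lone lmul;
  lmul_bijl : forall x, bijective (lmul x);
  lmul_bijr : forall x, bijective (lmul^~ x)
}.

#[short(type="loopType")]
HB.structure Definition Loop := {T of isLoop T}.

#[short(type="finLoopType")]
HB.structure Definition FinLoop := {T of Loop T & Finite T}.

Notation "x * y" := (lmul x y) : loop_scope.
Notation "1" := lone : loop_scope.
Local Open Scope loop_scope.

Definition loop_isom (L M : loopType) (f : L -> M) : Prop :=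
  bijective f /\ {morph f : x y / x * y}.

Definition isomorphic (L M : loopType) : Prop :=
  exists f : L -> M, loop_isom f.

Section InnerMappings.

Variable L : finLoopType.

Definition Ltrans (x : L) : {perm L} := perm (bij_inj (lmul_bijl x)).
Definition Rtrans (x : L) : {perm L} := perm (bij_inj (lmul_bijr x)).

(* Products of permutations apply the left factor first, so that, e.g.,
   Ltrans x * Ltrans y * (Ltrans (y * x))^-1 is z |-> (y x) \ (y (x z)). *)
Definition inner_mappings : {group {perm L}} :=
  <<[set (Ltrans x * Ltrans y * (Ltrans (y * x)%L)^-1)%g | x : L, y : L]
    :|: [set (Rtrans x * Rtrans y * (Rtrans (x * y)%L)^-1)%g | x : L, y : L]
    :|: [set (Rtrans x * (Ltrans x)^-1)%g | x : L]>>%G.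

Definition automorphic : Prop :=
  forall f : {perm L}, f \in inner_mappings -> {morph f : x y / x * y}.

End InnerMappings.

Definition comm_automorphic_of_order (n : nat) (L : finLoopType) : Prop :=
  [/\ commutative (@lmul L), automorphic L & #|{: L}| = n].

Definition nonassoc_comm_automorphic_of_order (n : nat) (L : finLoopType) :
    Prop :=
  comm_automorphic_of_order n L /\ ~ associative (@lmul L).

(* s lists the loops with property P without repetition, up to isomorphism.
   (Tuples of loops are excluded by universe constraints.) *)
Definition classifies (P : finLoopType -> Prop) (s : seq finLoopType) : Prop :=
  [/\ forall i L, onth s i = Some L -> P L,
      forall i j L M, onth s i = Some L -> onth s j = Some M ->
        isomorphic L M -> i = j
    & forall L, P L -> exists i M, onth s i = Some M /\ isomorphic L M].

Section NormalSubloops.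

Variable L : finLoopType.
Implicit Types (N : {set L}) (x y : L).

Definition lset x N := [set x * n | n in N].
Definition rset N x := [set n * x | n in N].

(* The two equalities say that N is closed under products and under both
   divisions. *)
Definition subloop N : Prop :=
  1 \in N /\
  forall a b, a \in N -> (a * b \in N) = (b \in N) /\ (b * a \in N) = (b \in N).

Definition normal_subloop N : Prop :=
  [/\ subloop N,
      forall x, lset x N = rset N x,
      forall x y, lset x (lset y N) = lset (x * y) N
    & forall x y, rset (rset N x) y = rset N (x * y)].

Definition cosets N : {set {set L}} := [set lset x N | x : L].

Lemma mem_cosets N x : lset x N \in cosets N.
Proof. exact: imset_f. Qed.

Lemma lset_mem N x : subloop N -> x \in N -> lset x N = N.
Proof.
move=> [N1 cN] xN; apply/eqP; rewrite eqEcard; apply/andP; split.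
  by apply/subsetP => _ /imsetP[n nN ->]; rewrite (cN _ _ xN).1.
by rewrite card_imset //; exact: bij_inj (lmul_bijl x).
Qed.

Lemma mul_cosets N x y : normal_subloop N ->
  [set c * d | c in lset x N, d in lset y N] = lset (x * y) N.
Proof.
move=> [sN comN lN rN].
have E d : d \in lset y N -> [set c * d | c in lset x N] = lset (x * y) N.
  move=> dy; rewrite (comN x) -/(rset (rset N x) d) rN -comN.
  have : x * d \in lset x (lset y N) by exact: imset_f.
  by rewrite lN => /imsetP[n nN ->]; rewrite -lN (lset_mem sN nN).
apply/setP => z; apply/imset2P/idP => [[c d cx dy ->]|zxy].
  by rewrite -(E _ dy); apply/imsetP; exists c.
have dy : y * 1 \in lset y N by apply/imset_f/sN.1.
by move: zxy; rewrite -(E _ dy) => /imsetP[c cx ->]; exists c (y * 1).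
Qed.

End NormalSubloops.

Definition quotient_loop (L : finLoopType) (N : {set L})
  (_ : normal_subloop N) : Type := {C : {set L} | C \in cosets N}.

Section QuotientLoop.

Variables (L : finLoopType) (N : {set L}) (nN : normal_subloop N).
Local Notation Q := (quotient_loop nN).

HB.instance Definition _ := Finite.on Q.

Lemma mul_quotient_subproof (C D : Q) :
  [set c * d | c in val C, d in val D] \in cosets N.
Proof.
case: C D => [_ /= /imsetP[x _ ->]] [_ /= /imsetP[y _ ->]].
by rewrite mul_cosets // mem_cosets.
Qed.

Definition mul_quotient (C D : Q) : Q :=
  exist (fun C => C \in cosets N) _ (mul_quotient_subproof C D).
Definition one_quotient : Q :=
  exist (fun C => C \in cosets N) _ (mem_cosets N 1).

Lemma quotientP (C : Q) : exists x, val C = lset x N.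
Proof. by case: C => [_ /= /imsetP[x _ ->]]; exists x. Qed.

Lemma val_mul_quotient (C D : Q) x y :
  val C = lset x N -> val D = lset y N ->
  val (mul_quotient C D) = lset (x * y) N.
Proof. by move=> /= -> ->; rewrite mul_cosets. Qed.

Lemma mul1_quotient : left_id one_quotient mul_quotient.
Proof.
move=> C; have [x Cx] := quotientP C; apply/val_inj.
by rewrite (val_mul_quotient (x := 1) (y := x)) // lmul1l.
Qed.

Lemma mulq1_quotient : right_id one_quotient mul_quotient.
Proof.
move=> C; have [x Cx] := quotientP C; apply/val_inj.
by rewrite (val_mul_quotient (x := x) (y := 1)) // lmull1.
Qed.

Lemma mul_quotient_bijl C : bijective (mul_quotient C).
Proof.
apply: injF_bij => D E DE; apply/val_inj; have [nNs _ lN _] := nN.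
have [[x Cx] [[y Dy] [z Ez]]] := (quotientP C, (quotientP D, quotientP E)).
rewrite Dy Ez; apply: (imset_inj (bij_inj (lmul_bijl x))).
rewrite -/(lset x _) -/(lset x (lset z N)) !lN.
by rewrite -(val_mul_quotient Cx Dy) DE (val_mul_quotient Cx Ez).
Qed.

Lemma mul_quotient_bijr C : bijective (mul_quotient^~ C).
Proof.
apply: injF_bij => D E DE; apply/val_inj; have [nNs comN _ rN] := nN.
have [[x Cx] [[y Dy] [z Ez]]] := (quotientP C, (quotientP D, quotientP E)).
rewrite Dy Ez !comN; apply: (imset_inj (bij_inj (lmul_bijr x))).
rewrite -/(rset _ x) -/(rset (rset N z) x) !rN -!comN.
by rewrite -(val_mul_quotient Dy Cx) DE (val_mul_quotient Ez Cx).
Qed.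

HB.instance Definition _ :=
  isLoop.Build Q mul1_quotient mulq1_quotient
    mul_quotient_bijl mul_quotient_bijr.

End QuotientLoop.

(* For the groups 'Z_n and their products the group law is the addition. *)
Definition group_loop (gT : finGroupType) : Type := gT.

Section GroupLoop.

Variable gT : finGroupType.
Local Notation G := (group_loop gT).
Local Open Scope group_scope.

Lemma group_bijl (x : gT) : bijective (mulg x).
Proof. by exists (mulg x^-1) => y; rewrite ?mulKg ?mulKVg. Qed.

Lemma group_bijr (x : gT) : bijective (mulg^~ x).
Proof. by exists (mulg^~ x^-1) => y; rewrite ?mulgK ?mulgKV. Qed.

HB.instance Definition _ := Finite.on G.
HB.instance Definition _ :=
  isLoop.Build G (@mul1g gT) (@mulg1 gT) group_bijl group_bijr.

End GroupLoop.

Section LoopF.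

Local Open Scope ring_scope.

Variables (p : nat) (p_pr : prime p).

Definition carry (a b : 'F_p) : 'F_p := if (a + b < p)%N then 0 else 1.

Lemma carryC : commutative carry.
Proof. by move=> a b; rewrite /carry addnC. Qed.

Lemma ltn_Fp (a : 'F_p) : (a < p)%N.
Proof. by rewrite -[X in (_ < X)%N](Fp_cast p_pr). Qed.

Lemma carry0 a : carry 0 a = 0.
Proof. by rewrite /carry add0n ltn_Fp. Qed.

(* The coordinates a_1, ..., a_6 are a`_0, ..., a`_5. *)
Definition loopF (_ : prime p) : Type := 6.-tuple 'F_p.

Definition mulF (a b : loopF p_pr) : loopF p_pr :=
  [tuple a`_0 + b`_0;
         a`_1 + b`_1;
         a`_2 + b`_2 + carry a`_0 b`_0;
         a`_3 + b`_3 + carry a`_1 b`_1;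
         a`_4 + b`_4 - a`_0 * b`_0 * (a`_1 + b`_1);
         a`_5 + b`_5 + a`_1 * b`_1 * (a`_0 + b`_0)].

Definition oneF : loopF p_pr := [tuple 0; 0; 0; 0; 0; 0].

Lemma loopF_eta (a : loopF p_pr) :
  a = [tuple a`_0; a`_1; a`_2; a`_3; a`_4; a`_5].
Proof.
apply/val_inj/(@eq_from_nth _ 0) => [|i]; rewrite (size_tuple a) //.
by case: i => [|[|[|[|[|[|i]]]]]].
Qed.

Lemma mulFC : commutative mulF.
Proof.
move=> a b; apply/val_inj => /=.
by congr [:: _; _; _; _; _; _]; rewrite ?[carry a`__ _]carryC; ring.
Qed.

Lemma mul1F : left_id oneF mulF.
Proof.
move=> a; rewrite [RHS]loopF_eta; apply/val_inj => /=.
by rewrite !carry0 !mul0r !add0r !addr0 subr0.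
Qed.

Lemma mulF1 : right_id oneF mulF.
Proof. by move=> a; rewrite mulFC mul1F. Qed.

Lemma mulF_bijl a : bijective (mulF a).
Proof.
apply: injF_bij => b c abc.
have E i : (mulF a b)`_i = (mulF a c)`_i by rewrite abc.
have /addrI e0 := E 0%N; have /addrI e1 := E 1%N.
have := E 2; have := E 3; have := E 4; have := E 5.
rewrite /= e0 e1 => /addIr/addrI e5 /addIr/addrI e4 /addIr/addrI e3.
by move=> /addIr/addrI e2; rewrite [b]loopF_eta [c]loopF_eta e0 e1 e2 e3 e4 e5.
Qed.

Lemma mulF_bijr a : bijective (mulF^~ a).
Proof. by apply: eq_bij (mulF_bijl a) _ _ => b; rewrite mulFC. Qed.

HB.instance Definition _ := Finite.on (loopF p_pr).
HB.instance Definition _ :=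
  isLoop.Build (loopF p_pr) mul1F mulF1 mulF_bijl mulF_bijr.

Definition Fx : loopF p_pr := [tuple 1; 0; 0; 0; 0; 0].
Definition Fy : loopF p_pr := [tuple 0; 1; 0; 0; 0; 0].

(* The center of F_p, written additively. *)
Definition centerF (v : 'rV['F_p]_4) : loopF p_pr :=
  [tuple 0; 0; v 0 0; v 0 1; v 0 2; v 0 3].

Definition xp : 'rV['F_p]_4 := delta_mx 0 0.
Definition yp : 'rV['F_p]_4 := delta_mx 0 1.
Definition xxy : 'rV['F_p]_4 := delta_mx 0 2.
Definition xyy : 'rV['F_p]_4 := delta_mx 0 3.

Lemma mulF_center a v :
  (a * centerF v)%L =
  [tuple a`_0; a`_1; a`_2 + v 0 0; a`_3 + v 0 1; a`_4 + v 0 2; a`_5 + v 0 3].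
Proof.
apply/val_inj => /=.
by rewrite !(carryC _ 0) !carry0 !mulr0 !mul0r !addr0 subr0.
Qed.

Lemma mulFA_center a b v : (a * (b * centerF v) = a * b * centerF v)%L.
Proof.
rewrite !mulF_center; apply/val_inj => /=.
congr [:: _; _; _; _; _; _]; rewrite !addrA //.
- by rewrite [LHS]addrAC.
- by rewrite [LHS]addrAC.
- by rewrite [LHS]addrAC.
- by rewrite [LHS]addrAC.
Qed.

Lemma centerFD u v : (centerF u * centerF v)%L = centerF (u + v).
Proof. by rewrite mulF_center; apply/val_inj => /=; rewrite !mxE. Qed.

Lemma carry1 n : (n < p)%N -> carry 1 n%:R = (n.+1 == p)%:R.
Proof.
move=> ltnp; rewrite /carry val_Fp_nat // modn_small //.
have -> : (1 : 'F_p) = 1%N :> nat.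
  by rewrite /= Fp_cast // modn_small ?prime_gt1.
by rewrite add1n ltn_neqAle ltnp andbT; case: eqP.
Qed.

Lemma exprFx : iter p (lmul Fx) 1%L = centerF xp.
Proof.
have E n : (n < p)%N ->
    iter n (lmul Fx) 1%L = [tuple n%:R; 0; 0; 0; 0; 0] :> loopF p_pr.
  elim: n => [|n IHn] ltnp //=; rewrite IHn ?(ltnW ltnp) //.
  apply/val_inj => /=.
  rewrite carry1 ?(ltnW ltnp) // (ltn_eqF ltnp) carry0 -[n.+1]add1n natrD.
  by rewrite !(addr0, mulr0, mul0r, subr0).
have pn : p = p.-1.+1 by rewrite prednK ?prime_gt0.
have ltnp : (p.-1 < p)%N by rewrite {2}pn.
rewrite {1}pn iterS (E _ ltnp); apply/val_inj => /=.
rewrite carry1 // -pn eqxx carry0 !mxE /=.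
have -> : 1 + p.-1%:R = 0 :> 'F_p by rewrite addrC natr1 -pn pchar_Fp_0.
by rewrite !(addr0, add0r, mulr0, mul0r, oppr0).
Qed.

Lemma exprFy : iter p (lmul Fy) 1%L = centerF yp.
Proof.
have E n : (n < p)%N ->
    iter n (lmul Fy) 1%L = [tuple 0; n%:R; 0; 0; 0; 0] :> loopF p_pr.
  elim: n => [|n IHn] ltnp //=; rewrite IHn ?(ltnW ltnp) //.
  apply/val_inj => /=.
  rewrite carry1 ?(ltnW ltnp) // (ltn_eqF ltnp) carry0 -[n.+1]add1n natrD.
  by rewrite !(addr0, mulr0, mul0r, subr0).
have pn : p = p.-1.+1 by rewrite prednK ?prime_gt0.
have ltnp : (p.-1 < p)%N by rewrite {2}pn.
rewrite {1}pn iterS (E _ ltnp); apply/val_inj => /=.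
rewrite carry1 // -pn eqxx carry0 !mxE /=.
have -> : 1 + p.-1%:R = 0 :> 'F_p by rewrite addrC natr1 -pn pchar_Fp_0.
by rewrite !(addr0, add0r, mulr0, mul0r, oppr0).
Qed.

Lemma assoc_xxy : (Fx * Fx * Fy = Fx * (Fx * Fy) * centerF xxy)%L.
Proof.
rewrite mulF_center; apply/val_inj; rewrite /= !mxE /= !(add0r, addr0).
rewrite !(carryC _ 0) !carry0; congr [:: _; _; _; _; _; _]; ring.
Qed.

Lemma assoc_xyy : (Fx * Fy * Fy = Fx * (Fy * Fy) * centerF xyy)%L.
Proof.
rewrite mulF_center; apply/val_inj; rewrite /= !mxE /= !(add0r, addr0).
rewrite !(carryC _ 0) !carry0; congr [:: _; _; _; _; _; _]; ring.
Qed.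

Definition center_set (N : {vspace 'rV['F_p]_4}) : {set loopF p_pr} :=
  [set centerF v | v in N].

Lemma center_subloop N : subloop (center_set N).
Proof.
split=> [|_ b /imsetP[v vN ->]].
  apply/imsetP; exists 0; rewrite ?mem0v //.
  by apply/val_inj; rewrite /= !mxE.
have E : (centerF v * b \in center_set N)%L = (b \in center_set N).
  apply/imsetP/imsetP => [[u uN vb]|[w wN ->]]; last first.
    by exists (v + w); rewrite ?memvD ?centerFD.
  exists (u - v); first by rewrite memvB.
  apply: (bij_inj (lmul_bijl (centerF v))).
  by rewrite centerFD vb (addrC v) subrK.
have C : (b * centerF v = centerF v * b)%L by apply: mulFC.
by rewrite C E.
Qed.

Lemma center_normal N : normal_subloop (center_set N).
Proof.
have lN a b : lset a (lset b (center_set N)) = lset (a * b)%L (center_set N).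
  apply/setP => z; apply/imsetP/imsetP.
    move=> [_ /imsetP[_ /imsetP[v vN ->] ->] ->].
    by exists (centerF v); rewrite ?imset_f ?mulFA_center.
  move=> [_ /imsetP[v vN ->] ->]; exists (b * centerF v)%L; last first.
    by rewrite mulFA_center.
  by do 2!apply: imset_f.
have cN (a : loopF p_pr) M : lset a M = rset M a.
  by apply: eq_imset => z; apply: mulFC.
split=> [|a|//|a b]; [exact: center_subloop|exact: cN|].
have C : (b * a = a * b)%L by apply: mulFC.
by rewrite -!cN lN C.
Qed.

Definition quotientF (N : {vspace 'rV['F_p]_4}) : finLoopType :=
  quotient_loop (center_normal N).

(* As F_p is generated by Fx and Fy, such an f is determined by rho. *)
Definition induced_automorphism (rho : {'GL_2(p)})
    (f : loopF p_pr -> loopF p_pr) : Prop :=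
  [/\ loop_isom f,
      f Fx = [tuple rho 0 0; rho 0 1; 0; 0; 0; 0]
    & f Fy = [tuple rho 1 0; rho 1 1; 0; 0; 0; 0]].

Definition orbitG (N N' : {vspace 'rV['F_p]_4}) : Prop :=
  exists (rho : {'GL_2(p)}) (f : loopF p_pr -> loopF p_pr),
    induced_automorphism rho f /\ center_set N' = f @: center_set N.

Lemma orbitG_refl N : orbitG N N.
Proof.
exists 1%g, id; rewrite imset_id; split=> //; split.
- by split=> //; exists id.
- by apply/val_inj; rewrite /= !mxE.
- by apply/val_inj; rewrite /= !mxE.
Qed.

Definition O2 := orbitG ((<[xp]> + <[yp]>) + <[xxy]>)%VS.

Definition O3 :=
  orbitG (if p == 3%N then <<[:: (xp + xyy)%R; yp; xxy]>>%VS
          else <<[:: xp; (yp + xyy)%R; xxy]>>%VS).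

Definition O4 :=
  orbitG (if p == 3%N then <<[:: (xp - xyy)%R; yp; xxy]>>%VS
          else <<[:: yp; (xp + xyy)%R; xxy]>>%VS).

(* For p = 3 the parameter lam is not used. *)
Definition O5 (lam : 'F_p) :=
  orbitG (if p == 3%N then <<[:: (xp - xyy)%R; (yp + xyy)%R; xxy]>>%VS
          else <<[:: yp; (lam *: xp + xyy)%R; xxy]>>%VS).

End LoopF.

Definition mult_table : seq (seq nat) :=
  [:: [:: 1; 2; 3; 4; 5; 6; 7; 8];
      [:: 2; 1; 4; 3; 6; 5; 8; 7];
      [:: 3; 4; 1; 2; 7; 8; 5; 6];
      [:: 4; 3; 2; 1; 8; 7; 6; 5];
      [:: 5; 6; 7; 8; 1; 4; 2; 3];
      [:: 6; 5; 8; 7; 4; 1; 3; 2];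
      [:: 7; 8; 5; 6; 2; 3; 1; 4];
      [:: 8; 7; 6; 5; 3; 2; 4; 1]]%N.

(* The element k of the table is the element k.-1 of 'I_8. *)
Definition table_loop : Type := 'I_8.

Definition mul_table (i j : table_loop) : table_loop :=
  inord (nth 0%N (nth [::] mult_table i) j).-1.

Definition one_table : table_loop := inord 0.

Lemma val_mul_table i j :
  val (mul_table i j) = (nth 0%N (nth [::] mult_table i) j).-1.
Proof.
rewrite /= inordK //.
by case: i j => [[|[|[|[|[|[|[|[|i]]]]]]]] lti] //;
   case=> [[|[|[|[|[|[|[|[|j]]]]]]]] ltj].
Qed.

Lemma mul1_table : left_id one_table mul_table.
Proof.
move=> i; apply/val_inj; rewrite val_mul_table /one_table inordK //.
by case: i => [[|[|[|[|[|[|[|[|i]]]]]]]] lti].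
Qed.

Lemma mul_tableC : commutative mul_table.
Proof.
move=> i j; apply/val_inj; rewrite !val_mul_table.
by case: i j => [[|[|[|[|[|[|[|[|i]]]]]]]] lti] //;
   case=> [[|[|[|[|[|[|[|[|j]]]]]]]] ltj].
Qed.

Lemma mul_table1 : right_id one_table mul_table.
Proof. by move=> i; rewrite mul_tableC mul1_table. Qed.

Lemma mul_table_bijl i : bijective (mul_table i).
Proof.
apply: injF_bij => j k /(congr1 val); rewrite !val_mul_table.
move=> ijk; apply/val_inj; move: ijk.
by case: i j k => [[|[|[|[|[|[|[|[|i]]]]]]]] lti] //;
   case=> [[|[|[|[|[|[|[|[|j]]]]]]]] ltj] //;
   case=> [[|[|[|[|[|[|[|[|k]]]]]]]] ltk].
Qed.

Lemma mul_table_bijr i : bijective (mul_table^~ i).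
Proof. by apply: eq_bij (mul_table_bijl i) _ _ => j; rewrite mul_tableC. Qed.

HB.instance Definition _ := Finite.on table_loop.
HB.instance Definition _ :=
  isLoop.Build table_loop mul1_table mul_table1 mul_table_bijl mul_table_bijr.

(* Main.v *)
Require Import Defs.
From HB Require Import structures.
From mathcomp Require Import all_boot all_order all_algebra all_fingroup.
From mathcomp Require Import all_solvable finfield.
From mathcomp Require Import ring.

Set Implicit Arguments.
Unset Strict Implicit.
Unset Printing Implicit Defensive.

Import GRing.Theory.

(** Let L be a commutative automorphic loop of order p ^ 3, p a prime. If L is
    associative it is an abelian group, and these are distinguished by their
    exponents. So suppose that it is not.

    L has a nontrivial centre, with one exception. For odd p let J be the
    inversion, which is an automorphism, and T x the translation by x. The
    permutations P x = [J, T x] generate a p-group, because they lie in a Sylow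
    subgroup of the multiplication group normalised by J; the centre of that
    p-group centralises all translations and moves 1 to a central element
    ([exists_central]). For p = 2 the elements of order 2 and the squares are
    sets invariant under inner mappings, and if the exponent is not 2 one of
    them yields an invariant singleton ([exponent2_or_central]); the loops of
    exponent 2 and order 8 are found by enumerating multiplication tables, and
    the only nonassociative one without centre is the given table
    ([exponent2_order8]).

    If the centre is nontrivial, it has order p and L is a central extension of
    the plane over F_p: in this class, loops of order at most p ^ 2 are groups, and
    a loop that is cyclic over its centre is a group ([central_structure]). The
    automorphic law makes the associator trilinear, and commutativity then
    leaves for it only a linear form (s, t) in the middle argument times the
    determinant of the outer two ([associator_form]). A standard cocycle has
    this associator; removing it turns L into an abelian group, which is
    determined by the p-th powers of two generators. So L is one of explicit
    extensions with parameters c1, c2, s, t ([extension_model],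
    [central_isomorphic_model]).

    If N is the kernel of a functional on the centre of F that does not vanish
    on both associators, the quotient by N is the extension whose parameters are
    the coefficients of the functional ([quotientF_model]), so the orbits of the
    theorem correspond to parameter tuples. A change of basis brings every tuple
    to one of the listed ones ([model_normal_form], [model_normal_form3]): the
    p-th power map is a linear form on the plane, with an extra cubic term if
    p = 3, and the cases are given by its position relative to (s, t). The resulting loops are told apart by the
    p-th powers of the elements inside and outside the middle nucleus and, for
    the two that differ by a scale factor, by whether that factor is a square. *)

(** * Isomorphisms, quotients and the automorphic law *)

Section LoopBasics.

Variable L : loopType.

Lemma lmulI (x : L) : injective (lmul x).
Proof. exact: bij_inj (lmul_bijl x). Qed.

Lemma lmul_eq1l (x y : L) : (x * y = x)%L -> y = 1%L.
Proof. by rewrite -{2}[x]lmull1 => /lmulI. Qed.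

End LoopBasics.

Section LoopIsom.

Lemma loop_morph1 (L M : loopType) (f : L -> M) :
  {morph f : x y / (x * y)%L} -> f 1%L = 1%L.
Proof. by move=> fM; apply: (@lmul_eq1l M (f 1%L)); rewrite -fM lmul1l. Qed.

Lemma isomorphic_refl (L : loopType) : isomorphic L L.
Proof. by exists id; split=> //; exists id. Qed.

Lemma isomorphic_sym (L M : loopType) : isomorphic L M -> isomorphic M L.
Proof.
case=> f [[g fK gK] fM]; exists g; split; first by exists f.
by move=> x y; apply: (can_inj fK); rewrite fM !gK.
Qed.

Lemma isomorphic_trans (L M K : loopType) :
  isomorphic L M -> isomorphic M K -> isomorphic L K.
Proof.
case=> f [fB fM] [g [gB gM]]; exists (g \o f); split; first exact: bij_comp.
by move=> x y /=; rewrite fM gM.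
Qed.

End LoopIsom.

(** The condition that z |-> (x y) \ (x (y z)) be multiplicative, written
    without division, so that it passes to homomorphic images. *)
Definition auto_law (L : loopType) : Prop :=
  forall x y a b a' b' : L,
    (x * y * a' = x * (y * a) -> x * y * b' = x * (y * b) ->
     x * y * (a' * b') = x * (y * (a * b)))%L.

Section AutoLaw.

Variable L : finLoopType.
Hypothesis mulC : commutative (@lmul L).

Definition automorphisms : {set {perm L}} :=
  [set f : {perm L} | [forall x, forall y, f (x * y)%L == (f x * f y)%L]].

Lemma automorphismsP (f : {perm L}) :
  reflect {morph f : x y / (x * y)%L} (f \in automorphisms).
Proof.
rewrite inE; apply: (iffP forallP) => [fM x y | fM x].
  by have /forallP/(_ y)/eqP := fM x.
by apply/forallP=> y; apply/eqP.
Qed.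

Lemma automorphisms_group_set : group_set automorphisms.
Proof.
apply/group_setP; split=> [|f g /automorphismsP fM /automorphismsP gM].
  by apply/automorphismsP=> x y; rewrite !perm1.
by apply/automorphismsP=> x y; rewrite !permM fM gM.
Qed.

Canonical automorphisms_group := Group automorphisms_group_set.

Lemma LtransE (x y : L) : Ltrans x y = (x * y)%L.
Proof. by rewrite permE. Qed.

Lemma RtransE (x : L) : Rtrans x = Ltrans x.
Proof. by apply/permP=> y; rewrite !permE mulC. Qed.

(** Automorphisms form a group, so the generators of the inner mapping group
    suffice; by commutativity the right ones are left ones and those of the
    third kind are trivial. *)
Lemma automorphicP : automorphic L <-> auto_law L.
Proof.
split=> [aut x y a b a' b' ea eb | law f].
  pose h : {perm L} := (Ltrans y * Ltrans x * (Ltrans (x * y)%L)^-1)%g.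
  have hM : {morph h : u v / (u * v)%L}.
    apply: aut; rewrite mem_gen // inE; apply/orP; left; rewrite inE.
    by apply/orP; left; apply/imset2P; exists y x.
  have hE u : Ltrans (x * y)%L (h u) = (x * (y * u))%L.
    by rewrite /h !permM permKV !LtransE.
  have -> : a' = h a by apply: (lmulI (x := (x * y)%L)); rewrite ea -hE LtransE.
  have -> : b' = h b by apply: (lmulI (x := (x * y)%L)); rewrite eb -hE LtransE.
  by rewrite -hM -hE LtransE.
suff sub : inner_mappings L \subset automorphisms_group.
  by move/(subsetP sub)/automorphismsP.
have hL x y : (Ltrans x * Ltrans y * (Ltrans (y * x)%L)^-1)%g \in automorphisms.
  apply/automorphismsP=> a b; apply: (lmulI (x := (y * x)%L)).
  set h : {perm L} := (_ * _ * _)%g.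
  have hE u : (y * x * h u = y * (x * u))%L.
    by rewrite -[LHS]LtransE /h !permM permKV !LtransE.
  by rewrite hE (law y x a b (h a) (h b)) // hE.
rewrite gen_subG !subUset -andbA; apply/and3P; split.
- by apply/subsetP=> _ /imset2P[x y _ _ ->]; exact: hL.
- by apply/subsetP=> _ /imset2P[x y _ _ ->]; rewrite !RtransE (mulC x); exact: hL.
- by apply/subsetP=> _ /imsetP[x _ ->]; rewrite RtransE mulgV group1.
Qed.

End AutoLaw.

Section Transport.

Lemma mulC_image (L M : loopType) (f : L -> M) :
  (forall y, exists x, f x = y) -> {morph f : x y / (x * y)%L} ->
  commutative (@lmul L) -> commutative (@lmul M).
Proof.
by move=> fS fM mulC y y'; have [[x <-] [x' <-]] := (fS y, fS y'); rewrite -!fM mulC.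
Qed.

Lemma mulA_image (L M : loopType) (f : L -> M) :
  (forall y, exists x, f x = y) -> {morph f : x y / (x * y)%L} ->
  associative (@lmul L) -> associative (@lmul M).
Proof.
move=> fS fM mulA u v w; have [[x <-] [[y <-] [z <-]]] := (fS u, (fS v, fS w)).
by rewrite -!fM mulA.
Qed.

Lemma auto_law_image (L M : loopType) (f : L -> M) :
  (forall y, exists x, f x = y) -> {morph f : x y / (x * y)%L} ->
  auto_law L -> auto_law M.
Proof.
move=> fS fM law x y a b a' b' ea eb.
have [[x0 x0E] [[y0 y0E] [[a0 a0E] [b0 b0E]]]] := (fS x, (fS y, (fS a, fS b))).
have [g _ gK] := lmul_bijl (x0 * y0)%L.
have a'E : f (g (x0 * (y0 * a0))%L) = a'.
  by apply: (lmulI (x := (x * y)%L)); rewrite ea -x0E -y0E -a0E -!fM gK.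
have b'E : f (g (x0 * (y0 * b0))%L) = b'.
  by apply: (lmulI (x := (x * y)%L)); rewrite eb -x0E -y0E -b0E -!fM gK.
rewrite -a'E -b'E -x0E -y0E -a0E -b0E -!fM.
by rewrite (law x0 y0 a0 b0) ?gK.
Qed.

Lemma bij_onto (T U : Type) (f : T -> U) : bijective f -> forall y, exists x, f x = y.
Proof. by case=> g _ gK y; exists (g y). Qed.

Lemma comm_automorphic_isom n (L M : finLoopType) :
  isomorphic L M -> comm_automorphic_of_order n L -> comm_automorphic_of_order n M.
Proof.
case=> f [fB fM] [mulC aut cardL]; have fS := bij_onto fB.
have mulCM := mulC_image fS fM mulC.
split=> //; last by rewrite -cardL (bij_eq_card fB).
by apply/(automorphicP mulCM)/(auto_law_image fS fM)/(automorphicP mulC).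
Qed.

Lemma nonassoc_isom n (L M : finLoopType) :
  isomorphic L M -> nonassoc_comm_automorphic_of_order n L ->
  nonassoc_comm_automorphic_of_order n M.
Proof.
move=> LM [caL nA]; split; first exact: comm_automorphic_isom caL.
move=> mulA; case: nA; have [f [fB fM]] := isomorphic_sym LM.
exact: mulA_image (bij_onto fB) fM mulA.
Qed.

Lemma classifies_isom (P : finLoopType -> Prop) (s t : seq finLoopType) :
  (forall L M : finLoopType, isomorphic L M -> P L -> P M) ->
  (forall i M, onth t i = Some M ->
     exists2 L, onth s i = Some L & isomorphic L M) ->
  size s = size t -> classifies P s -> classifies P t.
Proof.
move=> PI st eqsz [sP sU sC]; split.
- by move=> i M /st[L /sP PL LM]; apply: PI PL.
- move=> i j M M' /st[L sL LM] /st[L' sL' LM'] MM'.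
  apply: (sU i j L L') => //.
  exact: isomorphic_trans LM (isomorphic_trans MM' (isomorphic_sym LM')).
- move=> K /sC[i [L [sL KL]]].
  have : (i < size t)%N by rewrite -eqsz -onthTE sL.
  rewrite -onthTE; case tM: (onth t i) => [M|] // _.
  exists i, M; split=> //; apply: isomorphic_trans KL _.
  by have [L' sL' LM'] := st _ _ tM; move: sL'; rewrite sL => -[->].
Qed.

End Transport.

Lemma inj_onto_bij (T : choiceType) (U : eqType) (f : T -> U) :
  injective f -> (forall y, exists x, f x = y) -> bijective f.
Proof.
move=> fI fS; have fS' y : exists x, f x == y by have [x <-] := fS y; exists x.
have fK y : f (xchoose (fS' y)) = y by apply/eqP/(xchooseP (fS' y)).
by exists (fun y => xchoose (fS' y)) => [x | y]; rewrite ?fK //; apply: fI.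
Qed.

Section FirstIsomorphism.

Variables (L : finLoopType) (N : {set L}) (nN : normal_subloop N).

Lemma lset_refl (x : L) : x \in lset x N.
Proof.
by apply/imsetP; exists 1%L; rewrite ?lmull1 //; case: nN => -[].
Qed.

Lemma lset_eq (x y : L) : (lset x N == lset y N) = (y \in lset x N).
Proof.
case: (nN) => sN _ lN _; apply/eqP/idP=> [xy|]; first by rewrite xy lset_refl.
by case/imsetP=> n nN' ->; rewrite -[RHS]lN (lset_mem sN nN').
Qed.

Lemma card_lset (x : L) : #|lset x N| = #|N|.
Proof. by rewrite card_imset //; exact: lmulI. Qed.

Definition quotient_map (x : L) : quotient_loop nN :=
  exist (fun C => C \in cosets N) _ (mem_cosets N x).

Lemma quotient_mapM : {morph quotient_map : x y / (x * y)%L}.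
Proof. by move=> x y; apply/val_inj; rewrite (val_mul_quotient (x := x) (y := y)). Qed.

Lemma quotient_map_onto (C : quotient_loop nN) : exists x, quotient_map x = C.
Proof. by have [x Cx] := quotientP C; exists x; apply/val_inj. Qed.

Lemma quotient_map_eq (x y : L) :
  (quotient_map x == quotient_map y) = (y \in lset x N).
Proof. by rewrite -lset_eq -val_eqE. Qed.

Lemma cosets_partition : partition (cosets N) [set: L].
Proof.
apply/and3P; split.
- rewrite eqEsubset subsetT /=; apply/subsetP=> x _; apply/bigcupP.
  by exists (lset x N); rewrite ?mem_cosets ?lset_refl.
- apply/trivIsetP=> _ _ /imsetP[x _ ->] /imsetP[y _ ->].
  apply: contraR => /pred0Pn[z /= /andP[]]; rewrite -!lset_eq => /eqP-> /eqP->.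
  by rewrite eqxx.
- by apply/imsetP=> -[x _ /setP/(_ x)]; rewrite lset_refl inE.
Qed.

Lemma card_quotient_loop : (#|{: quotient_loop nN}| * #|N|)%N = #|{: L}|.
Proof.
have -> : #|{: quotient_loop nN}| = #|cosets N|.
  by rewrite card_sig; apply: eq_card.
rewrite -[RHS]cardsT; apply/esym/card_uniform_partition/cosets_partition.
by move=> _ /imsetP[x _ ->]; exact: card_lset.
Qed.

Lemma first_isomorphism (M : finLoopType) (f : L -> M) :
  (forall y, exists x, f x = y) -> {morph f : x y / (x * y)%L} ->
  (forall x y, f x = f y <-> y \in lset x N) ->
  isomorphic (quotient_loop nN) M.
Proof.
move=> fS fM fN.
have qS (C : quotient_loop nN) : exists x, quotient_map x == C.
  by have [x <-] := quotient_map_onto C; exists x.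
pose g C := f (xchoose (qS C)).
have gE x : g (quotient_map x) = f x.
  apply/fN; rewrite -quotient_map_eq; exact/(xchooseP (qS (quotient_map x))).
exists g; split.
  have fS' y : exists x, f x == y by have [x <-] := fS y; exists x.
  pose h y := xchoose (fS' y).
  have hE y : f (h y) = y by apply/eqP/(xchooseP (fS' y)).
  exists (quotient_map \o h) => [C | y] /=; last by rewrite gE.
  have [x <-] := quotient_map_onto C; rewrite gE; apply/eqP.
  by rewrite quotient_map_eq; apply/fN.
move=> C D; have [x <-] := quotient_map_onto C; have [y <-] := quotient_map_onto D.
by rewrite -quotient_mapM !gE fM.
Qed.

End FirstIsomorphism.

(** * Inner mappings, inverses and the centre *)

Section CommAutomorphic.

Variable L : finLoopType.
Hypotheses (mulC : commutative (@lmul L)) (law : auto_law L).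
Implicit Types (x y z : L) (f h : {perm L}).

Lemma innerM f : f \in inner_mappings L -> {morph f : x y / (x * y)%L}.
Proof. by move: f; apply/(automorphicP mulC). Qed.

Definition inner x y : {perm L} :=
  (Ltrans y * Ltrans x * (Ltrans (x * y)%L)^-1)%g.

Lemma mem_inner x y : inner x y \in inner_mappings L.
Proof.
rewrite mem_gen // inE; apply/orP; left; rewrite inE; apply/orP; left.
by apply/imset2P; exists y x.
Qed.

Lemma innerE x y z : (x * y * inner x y z = x * (y * z))%L.
Proof. by rewrite -[LHS]LtransE !permM permKV !LtransE. Qed.

Lemma Ltrans_inner x y : (Ltrans y * Ltrans x = inner x y * Ltrans (x * y)%L)%g.
Proof. by rewrite mulgKV. Qed.

Lemma inner_fix x y : inner x y x = x.
Proof. by apply: (lmulI (x := (x * y)%L)); rewrite innerE mulC [(y * x)%L]mulC. Qed.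

Lemma Ltrans1 : Ltrans (1%L : L) = 1%g.
Proof. by apply/permP=> x; rewrite LtransE lmul1l perm1. Qed.

Lemma Ltrans_at1 x : Ltrans x 1%L = x.
Proof. by rewrite LtransE lmull1. Qed.

Lemma Ltrans_inj : injective (@Ltrans L).
Proof. by move=> x y e; rewrite -(Ltrans_at1 x) e Ltrans_at1. Qed.

Lemma morph_perm1 f : {morph f : x y / (x * y)%L} -> f 1%L = 1%L.
Proof. exact: loop_morph1. Qed.

Lemma Ltrans_conj f x : {morph f : x y / (x * y)%L} ->
  (Ltrans x ^ f = Ltrans (f x))%g.
Proof.
by move=> fM; apply/permP=> y; rewrite conjgE !permM !LtransE fM permKV.
Qed.

Definition linv x : L := (Ltrans x)^-1%g 1%L.

Lemma mulV x : (x * linv x = 1)%L.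
Proof. by rewrite -LtransE permKV. Qed.

Lemma mulV_uniq x y : (x * y = 1)%L -> y = linv x.
Proof. by move=> xy; apply: (lmulI (x := x)); rewrite mulV. Qed.

Lemma linvK : involutive linv.
Proof. by move=> x; apply/esym/mulV_uniq; rewrite mulC mulV. Qed.

Lemma linv_inj : injective linv.
Proof. exact: inv_inj linvK. Qed.

Lemma linv1 : linv 1%L = 1%L.
Proof. by apply/esym/mulV_uniq; rewrite lmull1. Qed.

Lemma linv_morph f x : {morph f : x y / (x * y)%L} -> f (linv x) = linv (f x).
Proof. by move=> fM; apply: mulV_uniq; rewrite -fM mulV (morph_perm1 fM). Qed.

(** The inner mapping of x and its inverse is the product of their
    translations; being an automorphism that fixes x, it commutes with the
    translation by x. *)
Lemma mul_linvC x z : (linv x * (x * z) = x * (linv x * z))%L.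
Proof.
have hE w : inner x (linv x) w = (x * (linv x * w))%L.
  by rewrite -[LHS]lmul1l -(mulV x) innerE.
apply: (lmulI (x := x)).
by rewrite -hE (innerM (mem_inner _ _)) inner_fix hE.
Qed.

(** The automorphic inverse property. With h the inner mapping of x and y, the
    equation h (y^-1 c) = h (y^-1) h c at y c = x^-1 reads
    x (x^-1 y^-1) = u (s u^-1), where u = x y and u s = x; the right-hand side
    is x u^-1 by the preceding lemma. *)
Lemma linvM : {morph linv : x y / (x * y)%L}.
Proof.
move=> x y; apply/esym; set u := (x * y)%L; pose h := inner x y.
have hM := innerM (mem_inner x y).
have us : (u * h (linv y) = x)%L by rewrite innerE mulV lmull1.
have [g _ gK] := lmul_bijl y; pose c := g (linv x).
have hc : h c = linv u by apply: mulV_uniq; rewrite innerE gK mulV.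
have := innerE x y (linv y * c)%L; rewrite -/u hM hc -(mul_linvC y) gK => e.
apply: (lmulI (x := x)); rewrite [(linv x * _)%L]mulC -e.
by rewrite [(inner x y _ * _)%L]mulC -mul_linvC us mulC.
Qed.

Definition central z := [forall x, forall y, (x * y * z == x * (y * z))%L].

Lemma centralP z : reflect (forall x y, x * y * z = x * (y * z))%L (central z).
Proof.
apply: (iffP forallP) => [zc x y | zc x]; first by have /forallP/(_ y)/eqP := zc x.
by apply/forallP=> y; apply/eqP.
Qed.

Lemma central_fix z :
  (forall f, f \in inner_mappings L -> f z = z) -> central z.
Proof. by move=> fz; apply/centralP=> x y; rewrite -innerE fz // mem_inner. Qed.

Definition centre : {set L} := [set z | central z].

Lemma fix_subloop f : {morph f : x y / (x * y)%L} -> subloop [set x | f x == x].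
Proof.
move=> fM; split; first by rewrite inE (morph_perm1 fM).
move=> a b; rewrite !inE !fM => /eqP->.
by rewrite ![(_ * a)%L]mulC !(inj_eq (@lmulI _ _)).
Qed.

Lemma central_inner z x y : central z -> inner x y z = z.
Proof. by move/centralP=> zc; apply: (lmulI (x := (x * y)%L)); rewrite innerE zc. Qed.

Lemma centre_normal : normal_subloop centre.
Proof.
have comm x M : lset x M = rset M x by apply: eq_imset => z; exact: mulC.
have lN x y : lset x (lset y centre) = lset (x * y)%L centre.
  rewrite /lset -imset_comp; apply: eq_in_imset => z /=.
  by rewrite inE => /centralP->.
split=> // [|x y]; last by rewrite -!comm lN [(x * y)%L]mulC.
split; first by rewrite inE; apply/centralP=> x y; rewrite !lmull1.
have sub a b : a \in centre -> ((a * b)%L \in centre) = (b \in centre).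
  rewrite !inE => ac; have fix_ab x y : (inner x y (a * b)%L == (a * b)%L) = (inner x y b == b).
    by rewrite (innerM (mem_inner x y)) (central_inner _ _ ac) (inj_eq (@lmulI _ _)).
  apply/centralP/centralP=> bc x y; rewrite -innerE; congr (_ * _)%L; apply/esym/eqP.
    by rewrite -fix_ab central_inner //; apply/centralP.
  by rewrite fix_ab central_inner //; apply/centralP.
by move=> a b ac; rewrite [(b * a)%L]mulC sub.
Qed.

(** A commutative automorphic loop generated by one element over its centre is
    a group: every inner mapping of x and a fixes x, hence everything, so x
    associates with all pairs; then every inner mapping fixes x. *)
Lemma cyclic_over_centre x :
  (forall W : {set L}, x \in W -> centre \subset W ->
     (forall a b, a \in W -> b \in W -> (a * b)%L \in W) -> W = [set: L]) ->
  associative (@lmul L).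
Proof.
move=> gen.
have fix_all a b : inner a b x = x -> forall c, (a * b * c = a * (b * c))%L.
  move=> abx c; rewrite -innerE; congr (_ * _)%L; apply/esym/eqP.
  suff /setP/(_ c) : [set c | inner a b c == c] = [set: L] by rewrite !inE.
  apply: gen; first by rewrite inE abx.
    by apply/subsetP=> z; rewrite !inE => zc; rewrite central_inner.
  move=> c1 c2; rewrite !inE (innerM (mem_inner a b)) => /eqP-> /eqP->.
  exact: eqxx.
have xA a := fix_all x a (inner_fix x a).
move=> a b c; rewrite fix_all //; apply: (lmulI (x := (a * b)%L)).
by rewrite innerE mulC [(b * x)%L]mulC xA [(b * a)%L]mulC mulC.
Qed.

End CommAutomorphic.

(** * Isomorphism invariants *)

Section Invariants.

Implicit Types (L M : loopType).

Definition mid_nuclear L (x : L) : Prop := forall u w, (u * x * w = u * (x * w))%L.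

Definition lpow L (n : nat) (x : L) : L := iter n (lmul x) 1%L.

Lemma isom_lpow L M (f : L -> M) n x : {morph f : x y / (x * y)%L} ->
  lpow n (f x) = f (lpow n x).
Proof.
move=> fM; elim: n => [|n IHn]; first by rewrite (loop_morph1 fM).
by rewrite /lpow !iterS fM -IHn.
Qed.

Lemma isom_mid L M (f : L -> M) x : loop_isom f -> mid_nuclear (f x) <-> mid_nuclear x.
Proof.
case=> fB fM; have fI := bij_inj fB; split=> mx u w.
  by apply: fI; rewrite !fM mx.
have [u' <-] := bij_onto fB u; have [w' <-] := bij_onto fB w.
by rewrite -!fM mx.
Qed.

(** The first three record where the n-th power map is trivial, inside and
    outside the middle nucleus. The last one asks for an x in the middle nucleus
    and a y of trivial n-th power whose associator (x, y, y) is the inverse of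
    the n-th power of x; this compares the scales of the associator and of the
    power map. *)
Definition inv_nuclear n L := exists x : L, mid_nuclear x /\ lpow n x <> 1%L.
Definition inv_outer n L := exists x : L, ~ mid_nuclear x /\ lpow n x <> 1%L.
Definition inv_outer1 n L := exists x : L, ~ mid_nuclear x /\ lpow n x = 1%L.
Definition inv_square n L := exists x y : L,
  [/\ mid_nuclear x, lpow n x <> 1%L, lpow n y = 1%L
    & (x * y * y * lpow n x = x * (y * y))%L].

Definition invariant (P : loopType -> Prop) :=
  forall L M, isomorphic L M -> P L -> P M.

Lemma isom_lpow1 L M (f : L -> M) n x : loop_isom f ->
  lpow n (f x) = 1%L <-> lpow n x = 1%L.
Proof.
case=> fB fM; rewrite (isom_lpow n x fM) -(loop_morph1 fM).
by split=> [/(bij_inj fB)|->].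
Qed.

Lemma inv_nuclearP n : invariant (inv_nuclear n).
Proof.
move=> L M [f fiso] [x [mx px]]; exists (f x); split; first exact/isom_mid.
by move/isom_lpow1 => /(_ fiso).
Qed.

Lemma inv_outerP n : invariant (inv_outer n).
Proof.
move=> L M [f fiso] [x [mx px]]; exists (f x); split; first by move/(isom_mid _ fiso).
by move/isom_lpow1 => /(_ fiso).
Qed.

Lemma inv_outer1P n : invariant (inv_outer1 n).
Proof.
move=> L M [f fiso] [x [mx px]]; exists (f x); split; first by move/(isom_mid _ fiso).
exact/isom_lpow1.
Qed.

Lemma inv_squareP n : invariant (inv_square n).
Proof.
move=> L M [f fiso] [x [y [mx px py e]]]; have [fB fM] := fiso.
exists (f x), (f y); split; [exact/isom_mid | | exact/isom_lpow1 |].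
  by move/isom_lpow1 => /(_ fiso).
by rewrite (isom_lpow n x fM) -!fM e.
Qed.

Definition inv_central L := exists z : L, z <> 1%L /\ forall x y, (x * y * z = x * (y * z))%L.

Lemma inv_centralP : invariant inv_central.
Proof.
move=> L M [f [fB fM]] [z [nz1 zc]]; exists (f z); split.
  by rewrite -(loop_morph1 fM) => /(bij_inj fB).
move=> u w; have [u' <-] := bij_onto fB u; have [w' <-] := bij_onto fB w.
by rewrite -!fM zc.
Qed.

Lemma noniso (P : loopType -> Prop) L M : invariant P -> P L -> ~ P M -> ~ isomorphic L M.
Proof. by move=> iP pL nM /iP/(_ pL). Qed.

Lemma noniso' (P : loopType -> Prop) L M : invariant P -> ~ P L -> P M -> ~ isomorphic L M.
Proof. by move=> iP nL pM /isomorphic_sym/iP/(_ pM). Qed.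

End Invariants.

(** * The centre of a commutative automorphic loop of odd prime power order *)

Section InvolutionSylow.

Local Open Scope group_scope.

Lemma commg_involutionV (gT : finGroupType) (J g : gT) :
  J * J = 1 -> [~ J, g] ^ J = [~ J, g]^-1.
Proof.
move=> JJ; have JV : J^-1 = J by apply/eqP; rewrite eq_invg_mul JJ.
by rewrite !commgEl !conjgE !invMg !invgK JV !mulgA JJ mul1g.
Qed.

(** Take a maximal p-subgroup D of G normalised by J. If D is trivial, J
    centralises G: it inverts each commutator with g, so it normalises the
    p-group that this commutator generates. Otherwise induction in 'N_G(D) / D
    shows that D is a Sylow subgroup of its normaliser, hence of G. *)
Lemma invol_norm_Sylow (p : nat) (gT : finGroupType) (G : {group gT}) (J : gT) :
    J \in 'N(G) -> J * J = 1 -> (forall g, g \in G -> p.-elt [~ J, g]) ->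
  exists2 S : {group gT}, p.-Sylow(G) S & J \in 'N(S).
Proof.
have [m] := ubnP #|G|; elim: m => // m IHm in gT G J * => /ltnSE leGm nGJ JJ pJ.
pose good (D : {group gT}) := [&& D \subset G, p.-group D & J \in 'N(D)].
have [|D /maxgroupP[/and3P[sDG pD nDJ] maxD]] := @ex_maxgroup _ good.
  by exists 1%G; rewrite /good sub1G pgroup1 norm1 inE.
have commG g : g \in G -> [~ J, g] \in G.
  by move=> gG; rewrite commgEr groupM // memJ_norm ?groupV.
have [D1 | ntD] := eqVneq (D : {set gT}) 1.
  have cJ g : g \in G -> [~ J, g] = 1.
    move=> gG; apply/eqP; rewrite -cycle_eq1 -D1; apply/eqP.
    apply: (maxD <[[~ J, g]]>%G); last by rewrite D1 sub1G.
    rewrite /good cycle_subG commG //= [p.-group _](pJ g gG) /=.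
    apply/normP/eqP; rewrite eqEcard cardJg leqnn andbT -cycleJ cycle_subG.
    by rewrite commg_involutionV // groupV cycle_id.
  have [S sylS] := Sylow_exists p G; exists S => //.
  have /subsetP : 'C(S) \subset 'N(S) by exact: cent_sub.
  apply; apply/centP=> g gS; apply/commgP/eqP/cJ.
  exact: (subsetP (pHall_sub sylS)).
have nDN : D <| 'N_G(D) by rewrite normalSG.
have nNJ : J \in 'N('N_G(D)).
  apply/normP; rewrite conjIg (normP nGJ) -normJ; congr (_ :&: 'N(_)).
  exact/normP.
have cosetN g : g \in 'N_G(D) -> g \in 'N(D) by case/setIP.
have ltND : #|'N_G(D) / D| < m.
  apply: leq_trans leGm; apply: leq_trans (subset_leq_card (subsetIl G 'N(D))).
  exact: ltn_quotient (normal_sub nDN).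
have nNDJ : coset D J \in 'N('N_G(D) / D).
  exact: (subsetP (quotient_norm D 'N_G(D))) (mem_quotient D nNJ).
have JJD : coset D J * coset D J = 1.
  by rewrite -coset_morphM // JJ coset_id ?group1.
have pJD g : g \in 'N_G(D) / D -> p.-elt [~ coset D J, g].
  case/morphimP=> x xD /setIP[xG _] ->; rewrite -morphR //.
  by apply: morph_p_elt (pJ x xG); rewrite groupR.
have [Sb sylSb nSbJ] := IHm _ ('N_G(D) / D)%G (coset D J) ltND nNDJ JJD pJD.
have [S defS sDS sSN] := inv_quotientS nDN (pHall_sub sylSb).
have nDS : D <| S by apply: normalS sDS sSN nDN.
have sylS : p.-Sylow('N_G(D)) S by rewrite -(pquotient_pHall pD) // -defS.
have nSJ : J \in 'N(S).
  apply/normP; have nDSJ : D <| (S :^ J)%G.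
    by rewrite -(normP nDJ) normalJ.
  apply: (quotient_inj nDSJ nDS).
  by rewrite quotientJ // -defS (normP nSbJ).
have eqSD : S = D :> {set gT}.
  apply: maxD => //; rewrite /good nSJ (pHall_pgroup sylS) !andbT.
  by apply: subset_trans sSN (subsetIl _ _).
have [Q sylQ sDQ] := Sylow_superset sDG pD; exists D => //.
suff eqDQ : D = Q :> {set gT} by rewrite pHallE sDG eqDQ (card_Hall sylQ) /=.
apply/eqP; rewrite eqEproper sDQ /=; apply/negP=> ltDQ.
have := nilpotent_proper_norm (pgroup_nil (pHall_pgroup sylQ)) ltDQ.
rewrite eqSD in sylS; suff -> : 'N_Q(D) = D by rewrite properxx.
apply: (sub_pHall sylS).
- exact: pgroupS (subsetIl _ _) (pHall_pgroup sylQ).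
- by rewrite subsetI sDQ normG.
- by rewrite setSI ?(pHall_sub sylQ).
Qed.

End InvolutionSylow.

Section Squares.

Variable L : finLoopType.
Hypotheses (mulC : commutative (@lmul L)).
Implicit Types (x y z : L).
Local Open Scope group_scope.

(** The solutions (y, z) of y z = x are swapped by commutativity, so the number
    of square roots of x has the parity of the order. *)
Lemma card_sqrt_mod2 x : #|[set y | (y * y)%L == x]| = #|{: L}| %[mod 2].
Proof.
pose q y := (Ltrans y)^-1 x.
have qE y : (y * q y)%L = x by rewrite -LtransE permKV.
have qK : involutive q.
  by move=> y; apply: (lmulI (x := q y)); rewrite qE mulC qE.
pose s := perm (inv_inj qK); have s2 : s ^+ 2 = 1.
  by apply/permP=> y; rewrite expgS expg1 permM !permE qK.
have p2 : 2.-group <[s]>.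
  by apply: pnat_dvd (pnat_id (isT : prime 2)); rewrite order_dvdn s2.
have acts_s : [acts <[s]>, on [set: L] | 'P].
  by apply/actsP=> f _ y; rewrite !inE.
rewrite -cardsT (pgroup_fix_mod p2 acts_s); congr (_ %% _)%N.
apply: eq_card => y.
rewrite setTI afix_cycle inE; apply/eqP/afix1P => [yy | ].
  by rewrite /= apermE permE; apply: (lmulI (x := y)); rewrite qE.
by rewrite /= apermE permE => qy; rewrite -{2}qy qE.
Qed.

End Squares.

Section OddCentre.

Variable L : finLoopType.
Hypotheses (mulC : commutative (@lmul L)) (law : auto_law L).
Implicit Types (x y z a b : L) (f g h : {perm L}).
Local Open Scope group_scope.
Local Notation T := (@Ltrans L).
Local Notation I := (inner_mappings L).

Definition mlt : {group {perm L}} := <<[set T x | x : L]>>%G.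

Lemma mem_mlt x : T x \in mlt.
Proof. by rewrite mem_gen // imset_f. Qed.

Lemma inner_sub_mlt : I \subset mlt.
Proof.
rewrite gen_subG !subUset -andbA; apply/and3P; split.
- by apply/subsetP=> _ /imset2P[x y _ _ ->]; rewrite !groupM ?groupV ?mem_mlt.
- apply/subsetP=> _ /imset2P[x y _ _ ->].
  by rewrite !RtransE // !groupM ?groupV ?mem_mlt.
- apply/subsetP=> _ /imsetP[x _ ->].
  by rewrite RtransE // !groupM ?groupV ?mem_mlt.
Qed.

(** The translations are a transversal of the inner mapping group. *)
Lemma mltP g : g \in mlt -> exists2 h, h \in I & g = h * T (g 1%L).
Proof.
pose R := [set h * T x | h in I, x in [set: L]].
have gR : group_set R.
  apply/group_setP; split=> [|_ _ /imset2P[h x hI _ ->] /imset2P[k y kI _ ->]].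
    by apply/imset2P; exists 1 1%L; rewrite ?group1 ?inE // mul1g Ltrans1.
  have -> : h * T x * (k * T y) = h * k * inner y (k x) * T (y * k x)%L.
    rewrite -[RHS]mulgA -Ltrans_inner -(Ltrans_conj _ (innerM mulC law kI)).
    by rewrite conjgE !mulgA mulgK.
  apply/imset2P; exists (h * k * inner y (k x)) (y * k x)%L => //.
  by rewrite groupM ?mem_inner ?groupM.
have /subsetP sub : mlt \subset Group gR.
  rewrite gen_subG; apply/subsetP=> _ /imsetP[x _ ->].
  by apply/imset2P; exists 1 x; rewrite ?group1 ?in_setT ?mul1g.
move=> /sub/imset2P[h x hI _ ->]; exists h => //.
by rewrite permM (morph_perm1 (innerM mulC law hI)) Ltrans_at1.
Qed.

Lemma inner_mltE g : g \in mlt -> (g \in I) = (g 1%L == 1%L).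
Proof.
move=> gG; apply/idP/eqP=> [/(innerM mulC law)/morph_perm1 // | g1].
by have [h hI ->] := mltP gG; rewrite g1 Ltrans1 mulg1.
Qed.

Lemma index_inner : #|mlt : I| = #|{: L}|.
Proof.
have -> : (I : {set _}) = 'C_mlt[1%L | 'P].
  apply/setP=> g; rewrite in_setI; have [gG | gG] := boolP (g \in mlt); last first.
    by rewrite (contraNF (subsetP inner_sub_mlt g)).
  by rewrite inner_mltE //=; apply/eqP/astab1P.
rewrite -card_orbit -[RHS]cardsT; apply: eq_card => x; rewrite inE.
by apply/orbitP; exists (T x); rewrite ?mem_mlt //= apermE Ltrans_at1.
Qed.

Definition Jinv : {perm L} := perm (linv_inj mulC).
Local Notation J := Jinv.

Lemma JinvM : {morph J : x y / (x * y)%L}.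
Proof. by move=> x y; rewrite !permE linvM. Qed.

Lemma JinvE x : J x = linv x. Proof. exact: permE. Qed.

Lemma Jinv2 : J * J = 1.
Proof. by apply/permP=> x; rewrite permM !JinvE linvK // perm1. Qed.

Lemma Jinv_norm : J \in 'N(mlt).
Proof.
rewrite inE -genJ gen_subG; apply/subsetP=> _ /imsetP[_ /imsetP[x _ ->] ->].
by rewrite (Ltrans_conj _ JinvM) mem_mlt.
Qed.

Lemma Jinv_inner h : h \in I -> [~ J, h] = 1.
Proof.
move=> hI; apply/eqP/commgP/permP=> x.
by rewrite !permM !JinvE (linv_morph _ (innerM mulC law hI)).
Qed.

(** The quotient of the translations by x and by its inverse; in an abelian
    group this is the translation by x ^ 2. *)
Definition ptrans x := [~ J, T x].
Local Notation P := ptrans.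

Lemma ptransE x : P x = (T (linv x))^-1 * T x.
Proof. by rewrite /P commgEr conjVg (Ltrans_conj _ JinvM) JinvE. Qed.

Lemma ptrans_at1 x : P x 1%L = (x * x)%L.
Proof.
by rewrite ptransE permM -/(linv (linv x)) linvK // LtransE.
Qed.

Lemma Ltrans_linvC x : commute (T x) (T (linv x)).
Proof. by apply/permP=> z; rewrite !permM !LtransE mul_linvC. Qed.

Lemma ptransV x : P (linv x) = (P x)^-1.
Proof. by rewrite !ptransE linvK // invMg invgK. Qed.

Lemma comm_Jinv_mlt g : g \in mlt -> [~ J, g] = P (g 1%L).
Proof. by case/mltP=> h hI {1}->; rewrite commgMJ (Jinv_inner hI) conj1g mulg1. Qed.

Lemma ptransM x b : P (x * b)%L = P x * P b ^ T x.
Proof.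
rewrite -commgMJ comm_Jinv_mlt ?groupM ?mem_mlt //.
by rewrite permM Ltrans_at1 LtransE.
Qed.

Lemma ptrans_sqr x : P (x * x)%L = P x ^+ 2.
Proof.
rewrite ptransM expgS expg1; congr (_ * _); apply/conjg_fixP/commgP.
rewrite ptransE; apply/commute_sym/commuteM => //.
by apply/commuteV/Ltrans_linvC.
Qed.

Section OddOrder.

Hypothesis oddL : odd #|{: L}|.

Lemma sqr_onto x : exists y, (y * y)%L = x.
Proof.
have : 0 < #|[set y : L | (y * y)%L == x]|.
  by have := card_sqrt_mod2 mulC x; rewrite !modn2 oddL; case: #|_|.
by case/card_gt0P=> y; rewrite inE => /eqP yx; exists y.
Qed.

Lemma sqr_inj : injective (fun x => x * x)%L.
Proof.
apply/injectiveP/card_uniqP => /=; rewrite size_map -cardE.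
by apply: eq_card => x; apply/codomP; have [y <-] := sqr_onto x; exists y.
Qed.

Lemma linv_fixed x : linv x = x -> x = 1%L.
Proof. by move=> Vx; apply: sqr_inj; rewrite lmul1l -{2}Vx mulV. Qed.

(** Squaring permutes the loop, so x is x ^ (2 ^ n) for some n > 0; then P x is
    its own power of exponent 2 ^ n, and its order divides 2 ^ n - 1. *)
Lemma ptrans_odd x : odd #[P x].
Proof.
pose s := perm sqr_inj.
have sE n : P ((s ^+ n) x) = P x ^+ (2 ^ n).
  elim: n => [|n IHn]; first by rewrite expg0 perm1.
  by rewrite expgSr permM permE ptrans_sqr IHn -expgM -expnSr.
have := sE #[s]; rewrite expg_order perm1 => /eqP; rewrite eq_sym.
rewrite -(prednK (order_gt0 s)) expnS.
have : 0 < 2 * 2 ^ #[s].-1 by rewrite muln_gt0 expn_gt0.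
move=> /prednK {1}<-; rewrite expgS -{3}[P x]mulg1 (inj_eq (mulgI _)) -order_dvdn.
move/dvdn_odd; apply; rewrite -subn1 oddB ?muln_gt0 ?expn_gt0 //.
by rewrite oddM.
Qed.

Variable p : nat.
Hypotheses (p_pr : prime p) (pL : p.-nat #|{: L}|).

Lemma ptrans_mlt x : P x \in mlt.
Proof. by rewrite /P commgEr groupM ?mem_mlt // memJ_norm ?Jinv_norm ?groupV ?mem_mlt. Qed.

(** Let k be a power of P x of prime order q different from p. It fixes some c,
    as q does not divide the order of the loop, so the conjugate of k by the
    inverse of T c is an inner mapping and commutes with J. Hence k commutes
    with J ^ T c while J inverts it, and P c = J * J ^ T c inverts k. As P c has
    odd order, k is an involution, but q is odd. *)
Lemma p_elt_ptrans x : p.-elt (P x).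
Proof.
apply/(pnatP _ (order_gt0 _)) => q q_pr qP; rewrite inE /=.
apply: contraT => neq_qp; have oddq : odd q := dvdn_odd qP (ptrans_odd x).
have [k /cycleP[m def_k] ok] := Cauchy q_pr qP.
have qk : q.-group <[k]> by rewrite [_.-group _](_ : _ = q.-nat #[k]) // ok pnat_id.
have acts_k : [acts <[k]>, on [set: L] | 'P] by apply/actsP=> f _ y; rewrite !inE.
have [c kc] : exists c, k c = c.
  have := pgroup_fix_mod qk acts_k; rewrite setTI cardsT afix_cycle.
  have [->|[c /afix1P kc _]] := set_0Vmem 'Fix_'P[k]; last by exists c.
  rewrite cards0 mod0n => /eqP qL; have := pnat_dvd qL pL.
  by rewrite pnatE // inE /= (negPf neq_qp).
have kG : k \in mlt by rewrite def_k groupX ?ptrans_mlt.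
have k1 : k ^ (T c)^-1 \in I.
  rewrite inner_mltE ?groupJ ?groupV ?mem_mlt // conjgE invgK !permM Ltrans_at1 kc.
  by apply/eqP/(perm_inj (s := T c)); rewrite permKV Ltrans_at1.
have kJ : k ^ J = k^-1 by rewrite def_k conjXg commg_involutionV ?Jinv2 // expVgn.
have kJT : k ^ (J ^ T c) = k.
  apply/conjg_fixP; rewrite -{1}[k](conjgKV (T c)) -conjRg.
  suff /commgP/eqP-> : commute (k ^ (T c)^-1) J by rewrite conj1g.
  by apply/commute_sym/commgP/eqP/Jinv_inner.
have kP : k ^ P c = k^-1.
  by apply: invg_inj; rewrite invgK -conjVg -kJ -conjgM /P commgEl mulKVg.
have kPn n : k ^ (P c ^+ n) = if odd n then k^-1 else k.
  elim: n => [|n IHn]; first by rewrite expg0 conjg1.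
  by rewrite expgSr conjgM IHn oddS; case: (odd n); rewrite ?conjVg kP ?invgK.
have := kPn #[P c]; rewrite expg_order conjg1 ptrans_odd => kV.
have : #[k] %| 2 by rewrite order_dvdn expgS expg1 {2}kV mulgV.
by rewrite ok dvdn_prime2 // => /eqP q2; rewrite q2 in oddq.
Qed.

Definition ptrans_group : {group {perm L}} := <<[set P x | x : L]>>%G.
Local Notation M := ptrans_group.

Lemma mem_ptrans_group x : P x \in M.
Proof. by rewrite mem_gen // imset_f. Qed.

(** A Sylow subgroup S normalised by J is transversal to the inner mappings, so
    T x = h s with h inner and s in S; since J commutes with h, the commutator
    P x = [J, T x] = [J, s] lies in S. *)
Lemma ptrans_group_p : p.-group M.
Proof.
have pJ g : g \in mlt -> p.-elt [~ J, g].
  by move=> gG; rewrite comm_Jinv_mlt // p_elt_ptrans.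
have [S sylS nSJ] := invol_norm_Sylow Jinv_norm Jinv2 pJ.
have defG : I * S = mlt.
  apply: coprime_index_mulG inner_sub_mlt (pHall_sub sylS) _.
  rewrite index_inner; apply: pnat_coprime pL _.
  by have /and3P[_ _ ->] := sylS.
apply: pgroupS (pHall_pgroup sylS); rewrite gen_subG.
apply/subsetP=> _ /imsetP[x _ ->].
have : T x \in I * S by rewrite defG mem_mlt.
case/mulsgP=> h s hI sS def_x; rewrite /P def_x commgMJ (Jinv_inner hI).
by rewrite conj1g mulg1 commgEr groupM // memJ_norm ?groupV.
Qed.

Lemma ptrans_conj_Ltrans x b : P b ^ T x = (P x)^-1 * P (x * b)%L.
Proof. by rewrite ptransM mulKg. Qed.

Lemma ptrans_group_normal : M <| mlt.
Proof.
rewrite /normal gen_subG; apply/andP; split.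
  by apply/subsetP=> _ /imsetP[x _ ->]; exact: ptrans_mlt.
rewrite gen_subG; apply/subsetP=> _ /imsetP[x _ ->]; rewrite inE -genJ gen_subG.
apply/subsetP=> _ /imsetP[_ /imsetP[b _ ->] ->].
by rewrite ptrans_conj_Ltrans groupM ?groupV ?mem_ptrans_group.
Qed.

Lemma Jinv_ptrans x : P x ^ J = (P x)^-1.
Proof. exact: commg_involutionV Jinv2. Qed.

Lemma Jinv_norm_ptrans : J \in 'N(M).
Proof.
rewrite inE -genJ gen_subG; apply/subsetP=> _ /imsetP[_ /imsetP[b _ ->] ->].
by rewrite Jinv_ptrans groupV mem_ptrans_group.
Qed.

Local Notation A := 'Z(M).

(** The group generated by the P x is transitive, so its centre is
    semiregular. *)
Lemma ptrans_centre_semireg (z : {perm L}) : z \in A -> z 1%L = 1%L -> z = 1.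
Proof.
case/centerP=> _ cz z1; apply/permP=> y; rewrite perm1.
have [x <-] := sqr_onto y; rewrite -ptrans_at1 -permM.
by rewrite -(cz _ (mem_ptrans_group x)) permM z1.
Qed.

(** The product of z and its conjugate by J commutes with J, so it sends 1 to a
    self-inverse element, that is to 1; it is trivial by semiregularity. *)
Lemma ptrans_centreV (z : {perm L}) : z \in A -> z ^ J = z^-1.
Proof.
move=> zA; have zJA : z ^ J \in A.
  by rewrite memJ_norm // (subsetP (char_norms (center_char M))) ?Jinv_norm_ptrans.
have cA : commute z (z ^ J) := centP (subsetP (center_abelian M) _ zA) _ zJA.
apply/eqP; rewrite eq_sym eq_invg_mul; apply/eqP/ptrans_centre_semireg.
  exact: groupM.
apply: linv_fixed; rewrite -JinvE -permM.
have -> : z * z ^ J * J = J * (z * z ^ J).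
  by rewrite conjgC conjMg -conjgM Jinv2 conjg1 cA.
by rewrite permM JinvE linv1.
Qed.

Hypothesis oddp : odd p.

Lemma ptrans_group_odd (g : {perm L}) : g \in M -> odd #[g].
Proof.
by case/(mem_p_elt ptrans_group_p)/p_natP=> k ->; rewrite oddX oddp orbT.
Qed.

(** If w is the square root of z, then J inverts w, so z = [J, w] = P (w 1). *)
Lemma ptrans_centreP (z : {perm L}) : z \in A -> exists a, z = P a.
Proof.
move=> zA; have zM : z \in M by case/centerP: zA.
pose w := z ^+ #[z].+1./2; have wA : w \in A by rewrite groupX.
have ww : w * w = z.
  rewrite -expgD addnn halfK /= ptrans_group_odd // subn0.
  by rewrite expgS expg_order mulg1.
exists (w 1%L); rewrite -comm_Jinv_mlt.
  by rewrite commgEr conjVg ptrans_centreV // invgK.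
by apply: (subsetP (normal_sub ptrans_group_normal)); case/centerP: wA.
Qed.

(** Expanding P (x a) = P (a x) for a central P a gives
    P x ^ T a = P x * c with c = [P a, T x]. The same commutator c occurs for
    the inverse of x, because the translations by x and its inverse agree modulo
    P x; comparing the two gives c * c = 1. *)
Lemma ptrans_centre_mlt : A \subset 'C(mlt).
Proof.
apply/subsetP=> z zA; rewrite cent_gen; apply/centP=> _ /imsetP[x _ ->].
apply/commgP; have [a def_z] := ptrans_centreP zA.
have nA y : T y \in 'N(A).
  have := char_normal_trans (center_char M) ptrans_group_normal.
  by case/andP=> _ /subsetP/(_ _ (mem_mlt y)).
have cA g : g \in M -> commute z g by case/centerP: zA => _; exact.
pose c := [~ z, T x]; have cxA : c \in A.
  by rewrite /c commgEl groupM ?groupV // memJ_norm.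
have cM g : g \in M -> commute c g by case/centerP: cxA => _; exact.
have key y : [~ z, T y] = c -> P y ^ T a = P y * c.
  move=> def_c; rewrite ptrans_conj_Ltrans mulC ptransM -def_z.
  rewrite -[z ^ T y](mulKVg z) -commgEl def_c [P y * (z * c)]mulgA.
  by rewrite -(cA _ (mem_ptrans_group y)) -[z * P y * c]mulgA mulKg.
have keyV : [~ z, T (linv x)] = c.
  have -> : T (linv x) = T x * (P x)^-1 by rewrite ptransE invMg invgK mulKVg.
  have /centerP[_ czx] : z ^ T x \in A by rewrite memJ_norm.
  rewrite /c !commgEl conjgM; congr (_ * _); apply/conjg_fixP/commgP/commuteV.
  exact: czx (mem_ptrans_group x).
have := key _ keyV; rewrite ptransV conjVg (key x (erefl _)) invMg.
rewrite -(cM _ (groupVr (mem_ptrans_group x))) => /mulIg cV.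
have c2 : #[c] %| 2 by rewrite order_dvdn expgS expg1 -{1}cV mulVg.
have := ptrans_group_odd (subsetP (center_sub M) _ cxA).
by move: c2; rewrite dvdn_divisors // !inE order_eq1 => /orP[//|/eqP->].
Qed.

(** A nontrivial element z of the centre of the p-group generated by the P x
    commutes with all inner mappings, so they fix z 1. *)
Lemma exists_central : 1 < #|{: L}| -> exists2 z : L, central z & z <> 1%L.
Proof.
move=> ltL; have [z zA nz1] : exists2 z, z \in A & z != 1.
  apply/trivgPn/eqP=> A1; have M1 := trivg_center_pgroup ptrans_group_p A1.
  have sq1 x : (x * x)%L = 1%L.
    have : P x \in M := mem_ptrans_group x.
    by rewrite -ptrans_at1 M1 => /set1P->; rewrite perm1.
  have all1 x : x = 1%L by apply: sqr_inj; rewrite sq1 lmul1l.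
  have : #|{: L}| <= 1 by apply/fintype_le1P=> x y; rewrite (all1 x) (all1 y).
  by rewrite leqNgt ltL.
exists (z 1%L); last by move/(ptrans_centre_semireg zA)/eqP; rewrite (negPf nz1).
apply: central_fix => f fI; have fG := subsetP inner_sub_mlt _ fI.
have /centP/(_ _ fG) cfz := subsetP ptrans_centre_mlt _ zA.
by rewrite -permM cfz permM (morph_perm1 (innerM mulC law fI)).
Qed.

End OddOrder.

End OddCentre.

(** * Loops of order 2, 4 and 8 *)

Section EvenOrder.

Variable L : finLoopType.
Hypotheses (mulC : commutative (@lmul L)) (law : auto_law L).
Implicit Types (x y z : L) (f : {perm L}).
Local Notation I := (inner_mappings L).

Lemma subloop_half (N : {set L}) : subloop N -> N != [set: L] -> #|N|.*2 <= #|{: L}|.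
Proof.
move=> [N1 cN]; rewrite -subTset => /subsetPn[x _ xN].
rewrite -(cardsC N) -addnn leq_add2l -(card_imset _ (@lmulI L x)).
apply/subset_leq_card/subsetP=> _ /imsetP[n nN ->].
by rewrite inE (cN _ _ nN).2.
Qed.

(** Inner mappings fix the element of an invariant singleton, and the elements
    fixed by all of them are central. *)
Lemma invariant1_central (S : {set L}) : #|S| = 1%N -> 1%L \notin S ->
  (forall f x, f \in I -> x \in S -> f x \in S) ->
  exists2 z : L, central z & z <> 1%L.
Proof.
move/eqP/cards1P=> [z ->]; rewrite in_set1 eq_sym => /eqP z1 inv.
exists z => //; apply: central_fix => f fI.
by apply/set1P/inv; rewrite ?set11.
Qed.

Definition involutions : {set L} := [set x | (x * x)%L == 1%L].
Local Notation B := involutions.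

Lemma involutions_subloop : subloop B.
Proof.
have -> : B = [set x | Jinv mulC x == x].
  apply/setP=> x; rewrite !inE JinvE; apply/eqP/eqP=> [xx | Vx].
    by apply/esym/mulV_uniq.
  by rewrite -{2}Vx mulV.
exact/(fix_subloop mulC)/JinvM.
Qed.

Lemma involutions_inv f x : f \in I -> (f x \in B) = (x \in B).
Proof.
move=> fI; have fM := innerM mulC law fI.
by rewrite !inE -fM -[in LHS](morph_perm1 fM) (inj_eq perm_inj).
Qed.

Lemma card_sqrt_even x : ~~ odd #|{: L}| -> ~~ odd #|[set y : L | (y * y)%L == x]|.
Proof. by move=> evL; have := card_sqrt_mod2 mulC x; rewrite !modn2 (negPf evL); case: odd. Qed.

(** The involutions together with 1 are the fixed points of the inversion, which
    is an automorphism; so they form a subloop B, invariant under the inner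
    mappings. If B is proper, its order is 2 or 4. In the first case B minus 1 is
    an invariant singleton. In the second the squares of the elements outside B
    are at most two of the three involutions, each having an even number of
    roots, and either they or the remaining involutions form a singleton. *)
Lemma exponent2_or_central :
  #|{: L}| \in [:: 2; 4; 8]%N ->
  (forall x, (x * x)%L = 1%L) \/ exists2 z : L, central z & z <> 1%L.
Proof.
move=> cardL; have evL : ~~ odd #|{: L}|.
  by move: cardL; rewrite !inE => /or3P[] /eqP->.
have [BT | ntB] := eqVneq B [set: L].
  by left=> x; apply/eqP; have /setP/(_ x) := BT; rewrite !inE.
right; have leB := subloop_half involutions_subloop ntB.
have evB : ~~ odd #|B| := card_sqrt_even 1%L evL.
have B1 : 1%L \in B by rewrite inE lmul1l.
have gtB : (0 < #|B|)%N by apply/card_gt0P; exists 1%L.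
have leB4 : (#|B| <= 4)%N.
  by rewrite -leq_double (leq_trans leB) //; move: cardL; rewrite !inE => /or3P[] /eqP->.
have cardB1 : #|B :\ 1%L| = #|B|.-1 by rewrite (cardsD1 1%L B) B1.
have inv1 f x : f \in I -> x \in B :\ 1%L -> f x \in B :\ 1%L.
  move=> fI /setD1P[x1 xB]; rewrite in_setD1 involutions_inv // xB andbT.
  by rewrite -(morph_perm1 (innerM mulC law fI)) (inj_eq perm_inj).
have [B2 | B4] : #|B| = 2%N \/ #|B| = 4%N.
  by case: #|B| leB4 evB gtB => [|[|[|[|[|n]]]]] //; [left | right].
  apply: (invariant1_central (S := B :\ 1%L)) => //; first by rewrite cardB1 B2.
  by rewrite !inE eqxx.
have L8 : #|{: L}| = 8%N.
  by move: cardL leB; rewrite B4 !inE => /or3P[] /eqP->.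
have sqB x : x \notin B -> (x * x)%L \in B.
  move=> xB; apply: contraT => xxB; have [_ cB] := involutions_subloop.
  have : (x * x)%L \in lset x B.
    have -> : lset x B = ~: B.
      apply/eqP; rewrite eqEcard cardsCs setCK B4 card_imset ?L8 ?B4; last exact: lmulI.
      rewrite andbT; apply/subsetP=> _ /imsetP[n nB ->].
      by rewrite inE (cB _ _ nB).2.
    by rewrite inE.
  by case/imsetP=> b bB /lmulI xb; rewrite xb bB in xB.
pose S := [set (x * x)%L | x in ~: B].
have SB : S \subset B :\ 1%L.
  apply/subsetP=> _ /imsetP[x xB ->]; rewrite inE in xB.
  by rewrite in_setD1 sqB // andbT; move: xB; rewrite inE.
have invS f x : f \in I -> x \in S -> f x \in S.
  move=> fI /imsetP[y yB ->]; apply/imsetP; exists (f y).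
    by move: yB; rewrite !in_setC involutions_inv.
  exact: (innerM mulC law fI).
have cardC : #|~: B| = 4%N by rewrite cardsCs setCK L8 B4.
have leS : (#|S| <= 2)%N.
  rewrite -leq_double -[X in (_ <= X)%N]cardC -muln2 -sum_nat_const -sum1_card.
  rewrite [X in (_ <= X)%N](partition_big_imset (fun x => x * x)%L) /=.
  apply: leq_sum => b bS; rewrite sum1dep_card.
  have := card_sqrt_even b evL.
  have -> : [set x in ~: B | (x * x)%L == b] = [set y : L | (y * y)%L == b].
    apply/setP=> x; rewrite !inE; case: eqP => //= ->; apply/esym/negP=> /eqP b1.
    by have := subsetP SB _ bS; rewrite -b1 in_setD1 eqxx.
  have : (0 < #|[set y : L | (y * y)%L == b]|)%N.
    by case/imsetP: bS => x _ ->; apply/card_gt0P; exists x; rewrite inE.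
  by case: #|_| => [|[]].
have gtS : (0 < #|S|)%N.
  have /card_gt0P[x xB] : (0 < #|~: B|)%N by rewrite cardC.
  by apply/card_gt0P; exists (x * x)%L; apply: imset_f.
have S1 : 1%L \notin S by apply/negP=> /(subsetP SB); rewrite !inE eqxx.
have [cS | cS] : #|S| = 1%N \/ #|S| = 2%N.
  by case: #|S| leS gtS => [|[|[|n]]] //; [left | right].
  exact: invariant1_central cS S1 invS.
apply: (invariant1_central (S := (B :\ 1%L) :\: S)).
- by rewrite cardsD (setIidPr SB) cardB1 B4 cS.
- by rewrite !inE eqxx andbF.
- move=> f x fI /setDP[xB xS]; apply/setDP; split; first exact: inv1.
  apply: contra xS => /(invS (f^-1)%g); rewrite permK; apply.
  by rewrite groupV.
Qed.

(** If x, y and 1 are distinct, the fourth element is x y, which determines the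
    table as that of the Klein group. *)
Lemma exponent2_order4 : #|{: L}| = 4%N -> (forall x, x * x = 1)%L ->
  associative (@lmul L).
Proof.
move=> L4 sq.
have all4 x y z : x != 1%L -> y != 1%L -> x != y ->
    z \in [:: 1%L; x; y; (x * y)%L].
  move=> x1 y1 xy; suff eqL : #|[:: 1%L; x; y; (x * y)%L]| = #|{: L}|.
    by rewrite (subset_cardP eqL (subset_predT _)).
  have xy1 : (x * y)%L != 1%L.
    by apply: contra xy => /eqP; rewrite -(sq x) => /lmulI->.
  have xyx : (x * y)%L != x by apply: contra y1 => /eqP/lmul_eq1l->.
  have xyy : (x * y)%L != y by apply: contra x1; rewrite mulC => /eqP/lmul_eq1l->.
  rewrite L4; apply/card_uniqP; rewrite /= !inE !negb_or ![1%L == _]eq_sym.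
  by rewrite ![_ == (x * y)%L]eq_sym x1 y1 xy1 xy xyx xyy.
have lip x y : (x * (x * y) = y)%L.
  have [->|x1] := eqVneq x 1%L; first by rewrite !lmul1l.
  have [->|y1] := eqVneq y 1%L; first by rewrite lmull1.
  have [->|xy] := eqVneq x y; first by rewrite sq lmull1.
  have := all4 x y (x * (x * y))%L x1 y1 xy; rewrite !inE => /or4P[]/eqP // e.
  - by move: xy; rewrite -(sq x) in e; move/lmulI: e => /lmul_eq1l e; rewrite e eqxx in y1.
  - by move/lmul_eq1l: e => e; rewrite -(sq x) in e; move/lmulI: e => e; rewrite e eqxx in xy.
  - by rewrite mulC in e; move/lmul_eq1l: e => e; rewrite e eqxx in x1.
move=> x y z.
have [->|x1] := eqVneq x 1%L; first by rewrite !lmul1l.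
have [->|y1] := eqVneq y 1%L; first by rewrite lmul1l lmull1.
have [->|xy] := eqVneq x y; first by rewrite sq lmul1l lip.
have := all4 x y z x1 y1 xy; rewrite !inE => /or4P[]/eqP ->.
- by rewrite !lmull1.
- by rewrite [(y * x)%L]mulC lip mulC lip.
- by rewrite sq lmull1 mulC [(x * y)%L]mulC lip.
- by rewrite [(y * _)%L]mulC [(x * y * y)%L]mulC [(x * y)%L]mulC lip !sq.
Qed.

Lemma exists_central_le4 : #|{: L}| \in [:: 2; 4]%N ->
  associative (@lmul L) \/ exists2 z : L, central z & z <> 1%L.
Proof.
move=> cardL; have [|sq|] := exponent2_or_central; last by right.
  by move: cardL; rewrite !inE => /orP[]->; rewrite ?orbT.
have /orP[/eqP L2 | /eqP L4] : (#|{: L}| == 2%N) || (#|{: L}| == 4%N) by rewrite !inE in cardL.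
  right; apply: (invariant1_central (S := [set~ 1%L])); rewrite ?cardsC1 ?L2 ?inE ?eqxx //.
  move=> f x fI; rewrite !inE => x1.
  by rewrite -(morph_perm1 (innerM mulC law fI)) (inj_eq perm_inj).
by left; apply: exponent2_order4.
Qed.

End EvenOrder.

(** * Loops of exponent 2 and order 8 *)

(** [all] with a conditional in place of the conjunction, so that evaluation by
    value stops at the first failure. *)
Fixpoint lazy_all (T : Type) (a : pred T) (s : seq T) : bool :=
  if s is x :: s' then if a x then lazy_all a s' else false else true.

Lemma lazy_allE (T : Type) (a : pred T) s : lazy_all a s = all a s.
Proof. by elim: s => //= x s ->; case: (a x). Qed.

(** A commutative loop of exponent 2 on 0, ..., 7 with unit 0 is given by its
    products of 0 < i < j; they are enumerated in lexicographic order, row by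
    row. *)
Definition upper_pairs : seq (nat * nat) :=
  [seq (i, j) | i <- iota 1 7, j <- iota i.+1 (7 - i)].

Definition entry (e : seq nat) (i j : nat) : nat :=
  if i == 0 then j else if j == 0 then i else if i == j then 0
  else nth 0 e (index (minn i j, maxn i j) upper_pairs).

Definition table_of (e : seq nat) : seq (seq nat) :=
  [seq [seq entry e i j | j <- iota 0 8] | i <- iota 0 8].

Definition tmul (t : seq (seq nat)) (i j : nat) : nat := nth 0 (nth [::] t i) j.

(** The candidate v for the product of the next pair is compared with the
    earlier entries of the same rows; [lip] adds the law i (i j) = j. *)
Definition compatible (lip : bool) (c v : nat * nat * nat) : bool :=
  let: ((a, b), w) := c in let: ((i, j), v) := v in
  [&& [|| v != w | ~~ [|| a == i, a == j, b == i | b == j]]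
    & ~~ lip || [&& ((a, b) != (minn i v, maxn i v)) || (w == j)
                  & ((a, b) != (minn j v, maxn j v)) || (w == i)]].

Definition admissible (lip : bool) (fixed : seq (nat * nat * nat))
    (e : seq nat) (v : nat) : bool :=
  let q := nth (0, 0) upper_pairs (size e) in
  [&& v != q.1, v != q.2, all (fun c => (c.1 != q) || (c.2 == v)) fixed
    & all (fun c => compatible lip c (q, v)) (zip upper_pairs e)].

Fixpoint search (lip : bool) fixed (leaf : seq nat -> bool) n (e : seq nat) : bool :=
  if n is n'.+1 then
    lazy_all (fun v => if admissible lip fixed e v
                       then search lip fixed leaf n' (rcons e v) else true) (iota 1 7)
  else leaf e.

Lemma searchS lip fixed leaf n e : search lip fixed leaf n.+1 e =
  all (fun v => if admissible lip fixed e v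
                then search lip fixed leaf n (rcons e v) else true) (iota 1 7).
Proof. by rewrite -lazy_allE. Qed.

Definition tassoc (t : seq (seq nat)) : bool :=
  lazy_all (fun i => lazy_all (fun j => lazy_all (fun k =>
    tmul t (tmul t i j) k == tmul t i (tmul t j k)) (iota 0 8)) (iota 0 8)) (iota 0 8).

Definition tauto (t : seq (seq nat)) : bool :=
  lazy_all (fun x => lazy_all (fun y =>
    let h := [seq index (tmul t x (tmul t y z)) (nth [::] t (tmul t x y)) | z <- iota 0 8] in
    lazy_all (fun a => lazy_all (fun b =>
      nth 0 h (tmul t a b) == tmul t (nth 0 h a) (nth 0 h b))
      (iota 0 8)) (iota 0 8)) (iota 0 8)) (iota 0 8).

(** In [table_loop] the translation by the element 4 permutes
    5, 3, 7, 2, 6, 1 cyclically, so 4 and 5 generate. *)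
Definition table_words (t : seq (seq nat)) (g h : nat) : seq nat :=
  let w3 := tmul t g h in let w7 := tmul t g w3 in let w2 := tmul t g w7 in
  let w6 := tmul t g w2 in let w1 := tmul t g w6 in
  [:: 0; w1; w2; w3; g; h; w6; w7].

Definition tiso (t : seq (seq nat)) (w : seq nat) : bool :=
  if uniq w then lazy_all (fun i => lazy_all (fun j =>
    tmul t (nth 0 w i) (nth 0 w j) == nth 0 w (tmul mult_table i j).-1)
    (iota 0 8)) (iota 0 8) else false.

Definition tisomorphic (t : seq (seq nat)) : bool :=
  has (fun g => has (fun h => tiso t (table_words t g h)) (iota 1 7)) (iota 1 7).

Definition tcentral (t : seq (seq nat)) : bool :=
  has (fun z => lazy_all (fun x => lazy_all (fun y =>
    tmul t (tmul t x y) z == tmul t x (tmul t y z)) (iota 0 8)) (iota 0 8)) (iota 1 7).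

Definition nonlip_leaf e :=
  let t := table_of e in
  if tauto t then if tcentral t then true else tisomorphic t else true.
Definition lip_leaf e := tassoc (table_of e).

(** Labels are chosen with 1 * 2 = 3 and, for a pair that violates the law
    i (i j) = j, also 1 * 3 = 4. *)
Lemma nonlip_search :
  search false [:: ((1, 2), 3); ((1, 3), 4)] nonlip_leaf 21 [::] = true.
Proof. by vm_compute. Qed.

Lemma lip_search : search true [:: ((1, 2), 3)] lip_leaf 21 [::] = true.
Proof. by vm_compute. Qed.

Lemma search_sound lip fixed leaf e :
  (forall k, k < size e -> nth 0 e k \in iota 1 7 /\
     admissible lip fixed (take k e) (nth 0 e k)) ->
  forall n k, k + n = size e -> search lip fixed leaf n (take k e) -> leaf e.
Proof.
move=> adm; elim=> [|n IHn] k kn; first by rewrite take_oversize // -kn addn0.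
have lt_k : k < size e by rewrite -kn -addSnnS leq_addr.
have [v7 vadm] := adm k lt_k.
rewrite searchS => /allP/(_ _ v7); rewrite vadm -take_nth //.
by apply: IHn; rewrite addSnnS.
Qed.

Lemma upper_pairsP q : q \in upper_pairs -> 0 < q.1 < q.2 /\ q.2 < 8.
Proof.
move=> qu; apply/andP.
exact: (allP (isT : all (fun q => (0 < q.1 < q.2) && (q.2 < 8)) upper_pairs)).
Qed.

Lemma mem_upper_pairs i j : 0 < i -> i < j -> j < 8 -> (i, j) \in upper_pairs.
Proof.
move=> i0 ij j8; apply/allpairsPdep; exists i, j; split=> //.
  by rewrite mem_iota i0 (ltn_trans ij j8).
by rewrite mem_iota ij addSn subnKC // -ltnS (ltn_trans ij j8).
Qed.

Section Order8.

Variable L : finLoopType.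
Hypotheses (mulC : commutative (@lmul L)) (law : auto_law L).
Hypotheses (L8 : #|{: L}| = 8) (sq : forall x : L, (x * x = 1)%L).

Section Labelling.

Variable s : seq L.
Hypotheses (uniq_s : uniq s) (size_s : size s = 8) (s0 : nth 1%L s 0 = 1%L).

Local Notation el := (nth 1%L s).

Definition lab (i j : nat) : nat := index (el i * el j)%L s.

Lemma mem_lab x : x \in s.
Proof.
have /subset_cardP/(_ (subset_predT _)) : #|s| = #|{: L}|; last by move->.
by rewrite L8 -size_s; apply/card_uniqP.
Qed.

Lemma lab_lt i j : lab i j < 8.
Proof. by rewrite -size_s index_mem mem_lab. Qed.

Lemma labE i j : el (lab i j) = (el i * el j)%L.
Proof. by rewrite nth_index ?mem_lab. Qed.

Lemma s_inj i j : i < 8 -> j < 8 -> el i = el j -> i = j.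
Proof. by move=> i8 j8 /eqP; rewrite nth_uniq ?size_s // => /eqP. Qed.

Lemma labP i j k : k < 8 -> el k = (el i * el j)%L -> lab i j = k.
Proof. by move=> k8 e; apply: s_inj; rewrite ?lab_lt ?labE. Qed.

Lemma labC i j : lab i j = lab j i.
Proof. by rewrite /lab mulC. Qed.

Definition entries := [seq lab q.1 q.2 | q <- upper_pairs].

Lemma entry_lab i j : i < 8 -> j < 8 -> entry entries i j = lab i j.
Proof.
move=> i8 j8; rewrite /entry.
have [-> | i0] := eqVneq i 0; first by apply/esym/labP; rewrite ?s0 ?lmul1l.
have [-> | j0] := eqVneq j 0; first by apply/esym/labP; rewrite ?s0 ?lmull1.
have [-> | ij] := eqVneq i j; first by apply/esym/labP; rewrite ?s0 ?sq.
wlog lt_ij : i j i8 j8 i0 j0 ij / i < j.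
  move=> W; have [lt_ij | ] := boolP (i < j); first exact: W.
  rewrite -leqNgt => le_ji; have ji : j != i by rewrite eq_sym.
  have lt_ji : j < i by rewrite ltn_neqAle ji.
  by rewrite minnC maxnC labC (W j i).
rewrite (minn_idPl (ltnW lt_ij)) (maxn_idPr (ltnW lt_ij)).
have mem : (i, j) \in upper_pairs by rewrite mem_upper_pairs ?lt0n.
by rewrite (nth_map (0, 0)) ?index_mem // nth_index.
Qed.

Lemma tmul_lab i j : i < 8 -> j < 8 -> tmul (table_of entries) i j = lab i j.
Proof.
move=> i8 j8; rewrite /tmul /table_of (nth_map 0) ?size_iota //.
by rewrite (nth_map 0) ?size_iota // !nth_iota // entry_lab.
Qed.

(** Translations are injective, so each partial table of the loop is one that the
    search visits. *)
Lemma entries_admissible (lip : bool) (fixed : seq (nat * nat * nat)) k :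
    (lip -> forall x y : L, (x * (x * y) = y)%L) ->
    (forall c, c \in fixed -> lab c.1.1 c.1.2 = c.2) ->
    k < size entries ->
  nth 0 entries k \in iota 1 7 /\
  admissible lip fixed (take k entries) (nth 0 entries k).
Proof.
move=> lipL fixL ltk; have ltk' : k < size upper_pairs by rewrite -(size_map (fun q => lab q.1 q.2)).
rewrite (nth_map (0, 0)) // /admissible size_takel; last exact: ltnW.
set q := nth _ _ _; have qu : q \in upper_pairs by exact: mem_nth.
have [] := upper_pairsP qu; case Dq: q qu => [i j] /= qu /andP[i0 ij] j8.
have i8 := ltn_trans ij j8; have j0 := ltn_trans i0 ij.
have ne0 m : 0 < m -> m < 8 -> el m <> 1%L.
  move=> m0 m8 e; suff E : m = 0 by rewrite E in m0.
  by apply: s_inj; rewrite ?e ?s0.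
have lab_ne1 : lab i j != i.
  by apply/eqP=> /(congr1 (nth 1%L s)); rewrite labE => /lmul_eq1l/ne0; apply.
have lab_ne2 : lab i j != j.
  apply/eqP=> /(congr1 (nth 1%L s)); rewrite labE mulC => /lmul_eq1l/ne0; exact.
have lab_ne0 : 0 < lab i j.
  rewrite lt0n; apply/eqP=> E; have := labE i j.
  rewrite E s0 -[LHS](sq (el i)) => /lmulI/s_inj e.
  by rewrite e // ltnn in ij.
have v7 : lab i j \in iota 1 7 by rewrite mem_iota lab_ne0 lab_lt.
split; first exact: v7.
rewrite lab_ne1 lab_ne2 /=; apply/andP; split.
  by apply/allP=> c /fixL; case: eqP => //= -> ->; rewrite eqxx.
have -> : zip upper_pairs (take k entries) =
    [seq (q, lab q.1 q.2) | q <- take k upper_pairs].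
  rewrite -map_take -{1}(cat_take_drop k upper_pairs).
  rewrite -[X in zip _ X]cats0 zip_cat ?size_map //.
  have -> : zip (drop k upper_pairs) [::] = [::] :> seq (nat * nat * nat) by case: drop.
  by rewrite cats0 -{1}[take k _]map_id zip_map.
apply/allP=> _ /mapP[[a b] abk ->] /=.
have abu : (a, b) \in upper_pairs := mem_take abk.
have [/= /andP[a0 ab] b8] := upper_pairsP abu; have a8 := ltn_trans ab b8.
have ab_ij : (a, b) != (i, j).
  apply: contraTneq abk => e; rewrite in_take // e -Dq index_uniq //.
  by rewrite ltnn.
apply/andP; split.
  have [e /= | //] := eqVneq (lab i j) (lab a b).
  have {}e : (el i * el j = el a * el b)%L by rewrite -!labE e.
  apply/or4P=> -[]/eqP E; move: ab_ij; rewrite xpair_eqE E ?eqxx ?andbT //=.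
  - by rewrite E in e; move/lmulI/s_inj: e => ->; rewrite ?eqxx.
  - rewrite E [(el i * _)%L]mulC in e; move/lmulI/s_inj: e => e; move: ab.
    by rewrite E -e // ltnNge (ltnW ij).
  - rewrite E [(el a * _)%L]mulC in e; move/lmulI/s_inj: e => e; move: ab.
    by rewrite E -e // ltnNge (ltnW ij).
  - by rewrite E ![(_ * el j)%L]mulC in e; move/lmulI/s_inj: e => ->; rewrite ?eqxx.
case: lip lipL => //= lipL; have {}lipL := lipL isT.
have minmax m n : (a, b) = (minn m n, maxn m n) -> lab a b = lab m n.
  by case=> -> ->; case: (leqP m n) => // _; exact: labC.
apply/andP; split; rewrite -implybE; apply/implyP=> /eqP/minmax->; apply/eqP/labP=> //.
  by rewrite labE lipL.
by rewrite labE [(el i * el j)%L]mulC lipL.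
Qed.

Lemma entries_leaf (lip : bool) (fixed : seq (nat * nat * nat)) leaf :
    (lip -> forall x y : L, (x * (x * y) = y)%L) ->
    (forall c, c \in fixed -> lab c.1.1 c.1.2 = c.2) ->
  search lip fixed leaf 21 [::] -> leaf entries.
Proof.
move=> lipL fixL; rewrite -(take0 entries); apply: search_sound (21) (0) _.
  by move=> k; apply: entries_admissible.
by rewrite size_map.
Qed.

End Labelling.

End Order8.

Section Order8Leaves.

Variable L : finLoopType.
Hypotheses (mulC : commutative (@lmul L)) (law : auto_law L).
Hypotheses (L8 : #|{: L}| = 8) (sq : forall x : L, (x * x = 1)%L).

Section Labelling.

Variable s : seq L.
Hypotheses (uniq_s : uniq s) (size_s : size s = 8) (s0 : nth 1%L s 0 = 1%L).

Local Notation el := (nth 1%L s).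
Local Notation t := (table_of (entries s)).

Let tE i j : i < 8 -> j < 8 -> tmul t i j = lab s i j.
Proof. exact: (tmul_lab mulC L8 sq uniq_s size_s s0). Qed.

Let lt8 i j : lab s i j < 8.
Proof. exact: (lab_lt L8 uniq_s size_s). Qed.

Let labE i j : el (lab s i j) = (el i * el j)%L.
Proof. exact: (labE L8 uniq_s size_s). Qed.

Let inj i j : i < 8 -> j < 8 -> el i = el j -> i = j.
Proof. exact: (s_inj uniq_s size_s). Qed.

Let el_onto x : exists2 i, i < 8 & el i = x.
Proof.
exists (index x s); last by rewrite nth_index // (mem_lab L8 uniq_s size_s).
by rewrite -size_s index_mem (mem_lab L8 uniq_s size_s).
Qed.

Lemma all8P (a : pred nat) : reflect (forall i, i < 8 -> a i) (lazy_all a (iota 0 8)).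
Proof.
rewrite lazy_allE; apply: (iffP allP) => [aP i i8 | aP i]; last first.
  by rewrite mem_iota => /aP.
by apply: aP; rewrite mem_iota.
Qed.

Lemma labelled_auto : tauto t.
Proof.
apply/all8P=> x x8; apply/all8P=> y y8.
set u := tmul t x y; have u8 : u < 8 by rewrite /u tE.
set h := [seq _ | z <- _]; pose hz z := nth 0 h z.
have hP z : z < 8 -> hz z < 8 /\ (el u * el (hz z) = el x * (el y * el z))%L.
  move=> z8; rewrite /hz /h (nth_map 0) ?size_iota // nth_iota // add0n.
  have rowE : nth [::] t u = [seq tmul t u j | j <- iota 0 8].
    by rewrite /tmul /table_of (nth_map 0) ?size_iota // nth_iota // map_nth_iota0 ?take_oversize ?size_map ?size_iota.
  have w8 : tmul t x (tmul t y z) < 8 by rewrite !tE.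
  have elw : el (tmul t x (tmul t y z)) = (el x * (el y * el z))%L.
    by rewrite !tE // !labE.
  move: (tmul t x _) w8 elw => w w8 elw.
  have [g _ gK] := lmul_bijl (el u); have [j j8 jE] := el_onto (g (el w)).
  have wmem : w \in nth [::] t u.
    rewrite rowE; apply/mapP; exists j; first by rewrite mem_iota.
    by apply: inj => //; rewrite ?tE // labE jE gK.
  have size_row : size (nth [::] t u) = 8 by rewrite rowE size_map size_iota.
  set k := index _ _; have k8 : k < 8 by rewrite -size_row index_mem.
  by split=> //; rewrite -labE -tE // /tmul nth_index.
apply/all8P=> a a8; apply/all8P=> b b8; rewrite -!/(hz _).
have [ha8 ha] := hP a a8; have [hb8 hb] := hP b b8.
have ab8 : tmul t a b < 8 by rewrite tE.
have [hab8 hab] := hP _ ab8; apply/eqP; apply: inj => //; first by rewrite tE.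
apply: (lmulI (x := el u)); rewrite hab !tE // !labE.
have elu : el u = (el x * el y)%L by rewrite /u tE // labE.
by rewrite elu in ha hb *; rewrite (law ha hb).
Qed.

Lemma labelled_central : tcentral t -> exists2 z : L, central z & z <> 1%L.
Proof.
case/hasP=> k; rewrite mem_iota => /andP[k0 k8] /all8P zP.
exists (el k); last first.
  move=> e; suff E : k = 0 by rewrite E in k0.
  by apply: inj; rewrite ?e ?s0.
apply/centralP=> u v; have [i i8 <-] := el_onto u; have [j j8 <-] := el_onto v.
have /all8P/(_ j j8)/eqP/(congr1 el) := zP i i8.
by rewrite !tE // !labE.
Qed.

Lemma labelled_assoc : tassoc t -> associative (@lmul L).
Proof.
move=> /all8P tA u v w.
have [[i i8 <-] [[j j8 <-] [k k8 <-]]] := (el_onto u, (el_onto v, el_onto w)).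
have /all8P/(_ j j8)/all8P/(_ k k8)/eqP/(congr1 el) := tA i i8.
by rewrite !tE // !labE.
Qed.

Lemma labelled_isomorphic : tisomorphic t -> isomorphic table_loop L.
Proof.
case/hasP=> g; rewrite mem_iota => /andP[_ g8] /hasP[h].
rewrite mem_iota => /andP[_ h8]; rewrite /tiso; case: ifP => // uw /all8P wP.
set w := table_words t g h in uw wP.
have t8 i j : i < 8 -> j < 8 -> tmul t i j < 8 by move=> i8 j8; rewrite tE.
have w8 i : nth 0 w i < 8.
  have /all_nthP wlt : all (fun k => k < 8) w by rewrite /w /= !(g8, h8, t8).
  by have [/wlt-> | ?] := ltnP i (size w); last rewrite nth_default.
pose f (i : table_loop) : L := el (nth 0 w i).
have f_inj : injective f.
  move=> i j /inj e; apply/val_inj/eqP; rewrite /= -(nth_uniq 0 _ _ uw).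
  - by rewrite e.
  - exact: ltn_ord.
  - exact: ltn_ord.
exists f; split; first by apply: inj_card_bij f_inj _; rewrite L8 card_ord.
move=> i j; have /all8P/(_ j (ltn_ord j))/eqP := wP i (ltn_ord i).
rewrite tE // => e; rewrite /f -labE e; congr (el (nth _ _ _)).
exact: val_mul_table.
Qed.

End Labelling.

Lemma exists_labelling (r : seq L) : uniq r ->
  exists s, [/\ uniq s, size s = 8 & take (size r) s = r].
Proof.
move=> uniq_r; exists (r ++ [seq x <- enum L | x \notin r]).
have uniq_s : uniq (r ++ [seq x <- enum L | x \notin r]).
  rewrite cat_uniq uniq_r filter_uniq ?enum_uniq // andbT.
  by apply/hasPn=> x; rewrite mem_filter => /andP[].
split=> //; last by rewrite take_size_cat.
rewrite -L8; apply/eqP/eqP; rewrite -(card_uniqP uniq_s); apply: eq_card => x.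
by rewrite mem_cat mem_filter mem_enum; case: (x \in r).
Qed.

(** If x (x y) = y holds identically, the search shows that the loop is a group.
    Otherwise it is labelled from a pair that violates this law, and each
    admissible table that satisfies the automorphic law has a nontrivial centre
    or is isomorphic to the given one. *)
Lemma exponent2_order8 :
  [\/ associative (@lmul L), exists2 z : L, central z & z <> 1%L
    | isomorphic table_loop L].
Proof.
have prod_ne1 (x y : L) : x != y -> (x * y)%L != 1%L.
  by apply: contra => /eqP; rewrite -(sq x) => /lmulI->.
have prod_nel (x y : L) : y != 1%L -> (x * y)%L != x.
  by apply: contra => /eqP/lmul_eq1l->.
have prod_ner (x y : L) : x != 1%L -> (x * y)%L != y by rewrite mulC; exact: prod_nel.
have fixedP s (x y : L) : uniq s -> size s = 8 -> take 4 s = [:: 1; x; y; x * y]%L ->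
    nth 1%L s 0 = 1%L /\ lab s 1 2 = 3.
  move=> us ss ts; have nthE k : k < 4 -> nth 1%L s k = nth 1%L [:: 1; x; y; x * y]%L k.
    by move=> k4; rewrite -ts nth_take.
  split; first by rewrite nthE.
  by apply: (labP L8 us ss); rewrite ?nthE.
have [/forallP lip | ] := boolP [forall x : L, forall y : L, (x * (x * y) == y)%L].
  have lipL (x y : L) : (x * (x * y) = y)%L by have /forallP/(_ y)/eqP := lip x.
  have [r [ur sr tr]] := exists_labelling (isT : uniq [:: 1%L : L]).
  pose x := nth 1%L r 1; pose y := nth 1%L r 2.
  have r0 : nth 1%L r 0 = 1%L by rewrite -(nth_take (n0 := 1)) // tr.
  have x1 : x != 1%L by rewrite -[X in _ != X]r0 nth_uniq ?sr.
  have y1 : y != 1%L by rewrite -[X in _ != X]r0 nth_uniq ?sr.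
  have xy : x != y by rewrite nth_uniq ?sr.
  have [|s [us ss ts]] := @exists_labelling [:: 1; x; y; x * y]%L.
    rewrite /= !inE !negb_or ![1%L == _]eq_sym x1 y1 xy prod_ne1 //=.
    by rewrite ![_ == (x * y)%L]eq_sym prod_nel ?prod_ner.
  have [s0 s12] := fixedP s x y us ss ts.
  apply: Or31; apply: (labelled_assoc us ss s0).
  apply: (entries_leaf mulC L8 sq us ss s0 (lip := true)) lip_search => // c.
  by rewrite inE => /eqP->.
rewrite negb_forall => /existsP[x]; rewrite negb_forall => /existsP[y nlip].
have x1 : x != 1%L by apply: contraNneq nlip => ->; rewrite !lmul1l.
have y1 : y != 1%L by apply: contraNneq nlip => ->; rewrite lmull1 sq.
have xy : x != y by apply: contraNneq nlip => ->; rewrite sq lmull1.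
have z1 : (x * y)%L != 1%L by exact: prod_ne1.
have xz : x != (x * y)%L by rewrite eq_sym prod_nel.
have [|s [us ss ts]] := @exists_labelling [:: 1; x; y; x * y; x * (x * y)]%L.
  rewrite /= !inE !negb_or ![1%L == _]eq_sym x1 y1 xy z1 xz !(prod_ne1 _ _ xz) /=.
  rewrite ![_ == (x * (x * y))%L]eq_sym (prod_nel _ _ z1) nlip (prod_ner _ _ x1).
  by rewrite eq_sym prod_ner.
have ts4 : take 4 s = [:: 1; x; y; x * y]%L.
  by have := congr1 (take 4) ts; rewrite take_takel.
have [s0 s12] := fixedP s x y us ss ts4.
have leaf : nonlip_leaf (entries s).
  apply: (entries_leaf mulC L8 sq us ss s0 (lip := false)) nonlip_search => // c.
  have nthE k : k < 5 -> nth 1%L s k = nth 1%L [:: 1; x; y; x * y; x * (x * y)]%L k.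
    by move=> k5; rewrite -ts nth_take.
  rewrite !inE => /orP[]/eqP-> //=.
  by apply: (labP L8 us ss); rewrite ?nthE.
move: leaf; rewrite /nonlip_leaf labelled_auto //; case: ifP => [tc _ | _ ti].
  by apply: Or32; exact: labelled_central us ss s0 tc.
by apply: Or33; exact: labelled_isomorphic us ss s0 ti.
Qed.

End Order8Leaves.

Section TableLoop.

Let t : seq (seq nat) := [seq [seq v.-1 | v <- r] | r <- mult_table].

Let tabE (i j : table_loop) : tmul t i j = val (i * j)%L.
Proof.
rewrite val_mul_table /tmul /t.
by case: i j => [[|[|[|[|[|[|[|[|i]]]]]]]] lti] //;
   case=> [[|[|[|[|[|[|[|[|j]]]]]]]] ltj].
Qed.

Lemma table_mulC : commutative (@lmul table_loop).
Proof. exact: mul_tableC. Qed.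

Lemma table_no_centre : ~ inv_central table_loop.
Proof.
case=> z [/eqP nz1 zc].
suff : tcentral t by rewrite (_ : tcentral t = false) //; vm_compute.
apply/hasP; exists (val z).
  rewrite mem_iota ltn_ord andbT lt0n; apply: contra nz1 => /eqP z0.
  by apply/eqP/val_inj; rewrite /= z0 /one_table inordK.
apply/all8P=> i i8; apply/all8P=> j j8; apply/eqP.
by have /(congr1 val) := zc (Ordinal i8) (Ordinal j8); rewrite -!tabE.
Qed.

Lemma table_nonassoc : ~ associative (@lmul table_loop).
Proof.
move=> mulA; apply: table_no_centre; exists (inord 1 : table_loop).
by split=> [/(congr1 val)|//]; rewrite /= /one_table !inordK.
Qed.

Lemma table_auto_law : auto_law table_loop.
Proof.
(* Only these three facts about the table are used from here on. *)
have [T [TE TA rowsT]] : exists T : seq (seq nat),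
    [/\ forall i j : table_loop, tmul T i j = val (i * j)%L, tauto T
      & forall i : table_loop, uniq (nth [::] T i) && (size (nth [::] T i) == 8)].
  exists t; split; [exact: tabE | by vm_compute |].
  by case=> [[|[|[|[|[|[|[|[|i]]]]]]]] lti].
move=> x y a b a' b' ea eb; set u := (x * y)%L in ea eb *.
have /andP[uniq_u /eqP size_u] := rowsT u.
have idx c c' : (u * c' = x * (y * c))%L ->
    index (tmul T x (tmul T y c)) (nth [::] T (tmul T x y)) = val c'.
  move=> e; rewrite !TE -/u -e -TE /tmul index_uniq //.
  by rewrite size_u ltn_ord.
have hE (c : table_loop) :
    nth 0 [seq index (tmul T x (tmul T y z)) (nth [::] T (tmul T x y)) | z <- iota 0 8] c =
    index (tmul T x (tmul T y c)) (nth [::] T (tmul T x y)).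
  by rewrite (nth_map 0) ?size_iota // nth_iota.
have /all8P/(_ (val x) (ltn_ord x))/all8P/(_ (val y) (ltn_ord y)) := TA.
move/all8P/(_ (val a) (ltn_ord a))/all8P/(_ (val b) (ltn_ord b)).
rewrite (TE a b) !hE (idx _ _ ea) (idx _ _ eb) (TE a' b') => /eqP e.
rewrite (TE x y) -/u in e.
apply/val_inj; rewrite /= -[LHS]TE {1}/tmul -e nth_index; first by rewrite !TE.
by rewrite -index_mem size_u e ltn_ord.
Qed.

Lemma table_comm_automorphic : nonassoc_comm_automorphic_of_order 8 table_loop.
Proof.
split; last exact: table_nonassoc.
by split; [exact: table_mulC | exact/(automorphicP table_mulC)/table_auto_law | rewrite card_ord].
Qed.

End TableLoop.

(** * Small orders and the central quotient *)

(** The group structure on the carrier is inferred from the two proofs. *)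
Definition loop_group (L : finLoopType)
  (_ : commutative (@lmul L)) (_ : associative (@lmul L)) : Type := L.

Section LoopGroup.

Variables (L : finLoopType).
Hypotheses (mulC : commutative (@lmul L)) (mulA : associative (@lmul L)).
Local Notation G := (loop_group mulC mulA).

Lemma loop_mulVg : left_inverse (1%L : L) (@linv L) (@lmul L).
Proof. by move=> x; rewrite mulC mulV. Qed.

HB.instance Definition _ := Finite.on G.
HB.instance Definition _ :=
  Finite_isGroup.Build G mulA (@lmul1l L) loop_mulVg.

Lemma loop_group_abelian : abelian [set: G].
Proof. by apply/centsP=> x _ y _; exact: mulC. Qed.

Lemma loop_group_expg (x : G) n : (x ^+ n)%g = iter n (lmul (x : L)) 1%L :> L.
Proof. by elim: n => // n IHn; rewrite expgS IHn. Qed.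

Lemma loop_group_gen : cyclic [set: G] ->
  exists x : L, forall y, exists n, y = iter n (lmul x) 1%L.
Proof.
case/cyclicP=> x defG; exists x => y; have : (y : G) \in [set: G] by rewrite inE.
by rewrite defG => /cycleP[n ->]; exists n; rewrite -loop_group_expg.
Qed.

End LoopGroup.

Section CentralQuotient.

Variable L : finLoopType.
Hypotheses (mulC : commutative (@lmul L)) (law : auto_law L).
Local Notation Z := (centre L).
Local Notation nZ := (centre_normal mulC law).
Local Notation Q := (quotient_loop nZ).

Lemma central_quotientC : commutative (@lmul Q).
Proof. exact: mulC_image (quotient_map_onto (nN := nZ)) (quotient_mapM nZ) mulC. Qed.

Lemma central_quotient_law : auto_law Q.
Proof. exact: auto_law_image (quotient_map_onto (nN := nZ)) (quotient_mapM nZ) law. Qed.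

Lemma assoc_of_cyclic_quotient :
  (exists C : Q, forall D, exists n, D = iter n (lmul C) 1%L) ->
  associative (@lmul L).
Proof.
case=> C genC; have [x def_C] := quotient_map_onto C.
apply: (cyclic_over_centre mulC law (x := x)) => W xW /subsetP sZW mW.
apply/setP=> y; rewrite inE; have [n] := genC (quotient_map nZ y).
have -> : iter n (lmul C) 1%L = quotient_map nZ (iter n (lmul x) 1%L).
  elim: n => [|n IHn] /=; first by rewrite (loop_morph1 (quotient_mapM nZ)).
  by rewrite IHn -def_C -quotient_mapM.
move/esym/eqP; rewrite quotient_map_eq => /imsetP[z zZ ->].
apply: (mW); last exact: sZW.
elim: n => [|n IHn] /=; last exact: mW.
by apply: sZW; case: nZ => -[].
Qed.

End CentralQuotient.

Lemma cyclic_loop_group p k (L : finLoopType) (mulC : commutative (@lmul L))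
    (mulA : associative (@lmul L)) :
  prime p -> (k <= 1)%N -> #|{: L}| = (p ^ k)%N -> cyclic [set: loop_group mulC mulA].
Proof.
move=> p_pr; case: k => [|[|//]] _ cardL.
  suff -> : [set: loop_group mulC mulA] = 1%g by exact: cyclic1.
  by apply/eqP; rewrite trivg_card1 cardsT cardL.
by apply: prime_cyclic; rewrite cardsT cardL expn1.
Qed.

Lemma card_centre_gt1 (L : finLoopType) (z : L) :
  commutative (@lmul L) -> auto_law L -> central z -> z <> 1%L -> (1 < #|centre L|)%N.
Proof.
move=> mulC law zc /eqP nz1; have [[Z1 _] _ _ _] := centre_normal mulC law.
by rewrite (cardD1 1%L) Z1 (cardD1 z) !inE nz1 zc.
Qed.

Lemma central_quotient_card p k (L : finLoopType) (mulC : commutative (@lmul L))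
    (law : auto_law L) (z : L) :
  prime p -> #|{: L}| = (p ^ k)%N -> central z -> z <> 1%L ->
  exists j, [/\ (j < k)%N, #|{: quotient_loop (centre_normal mulC law)}| = (p ^ j)%N
            & #|centre L| = (p ^ (k - j))%N].
Proof.
move=> p_pr cardL zc nz1; have gt1 := card_centre_gt1 mulC law zc nz1.
have := card_quotient_loop (centre_normal mulC law); rewrite cardL => e.
have /(dvdn_pfactor _ _ p_pr)[j le_jk cQ] :
    #|{: quotient_loop (centre_normal mulC law)}| %| p ^ k by rewrite -e dvdn_mulr.
have cZ : #|centre L| = (p ^ (k - j))%N.
  apply/eqP; rewrite -(eqn_pmul2l (m := p ^ j)) ?expn_gt0 ?prime_gt0 //.
  by rewrite -{1}cQ e -expnD subnKC.
exists j; split=> //; rewrite ltn_neqAle le_jk andbT.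
by apply: contraTneq gt1 => jk; rewrite cZ jk subnn.
Qed.

(** Once the centre is nontrivial, the quotient by it has order 1 or p; it is a
    group by induction, hence a cyclic one. *)
Lemma assoc_le_sqr p k (L : finLoopType) :
  prime p -> (k <= 2)%N -> #|{: L}| = (p ^ k)%N ->
  commutative (@lmul L) -> auto_law L -> associative (@lmul L).
Proof.
move=> p_pr; elim/ltn_ind: k L => k IHk L le2k cardL mulC law.
case: (posnP k) => [k0 | k_gt0].
  have /fintype_le1P eqL : #|{: L}| <= 1 by rewrite cardL k0.
  by move=> x y z; exact: eqL.
have [//|[z zc nz1]] : associative (@lmul L) \/ exists2 z : L, central z & z <> 1%L.
  have [p2 | oddp] := even_prime p_pr.
    apply: exists_central_le4 => //; rewrite cardL p2.
    by case: k k_gt0 le2k {IHk cardL} => [|[|[|]]].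
  right; have oddL : odd #|{: L}| by rewrite cardL oddX oddp orbT.
  have pL : p.-nat #|{: L}| by rewrite cardL pnatX pnat_id.
  apply: (exists_central mulC law oddL pL oddp).
  by rewrite cardL -[1%N](exp1n k) ltn_exp2r // prime_gt1.
have [j [lt_jk cQ _]] := central_quotient_card mulC law p_pr cardL zc nz1.
have mulCQ : commutative (@lmul _) := @central_quotientC _ mulC law.
have mulAQ := IHk j lt_jk _ (leq_trans (ltnW lt_jk) le2k) cQ mulCQ
                (@central_quotient_law _ mulC law).
apply: (assoc_of_cyclic_quotient (law := law)).
apply: (loop_group_gen (mulC := mulCQ) (mulA := mulAQ)).
apply: cyclic_loop_group p_pr _ cQ.
by rewrite -ltnS (leq_trans lt_jk).
Qed.

Lemma val_FpD p (k l : 'F_p) : prime p -> (k + l)%R = (k + l) %% p :> nat.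
Proof. by move=> p_pr; congr (_ %% _)%N; exact: Fp_cast. Qed.

Section PrimeCentre.

Variables (p : nat) (L : finLoopType).
Hypotheses (mulC : commutative (@lmul L)) (law : auto_law L).
Hypotheses (p_pr : prime p) (cardZ : #|centre L| = p).

Lemma Ltrans_centralM (a b : L) : central a ->
  Ltrans (a * b)%L = (Ltrans a * Ltrans b)%g.
Proof.
move=> /centralP ac; apply/permP=> y; rewrite permM !LtransE.
by rewrite mulC [(a * b)%L]mulC [(a * y)%L]mulC -!ac [(y * b)%L]mulC.
Qed.

(** The translations by central elements form a group of prime order; the powers
    of a generator of it, applied to 1, run through the centre. *)
Lemma prime_centre_param : exists zeta : 'F_p -> L,
  [/\ {morph zeta : k l / (k + l)%R >-> (k * l)%L}, injective zeta,
      forall k, central (zeta k) & forall z, central z -> exists k, z = zeta k].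
Proof.
have [[Z1 cZ] _ _ _] := centre_normal mulC law.
pose C := [set Ltrans c | c in centre L].
have gC : group_set C.
  apply/group_setP; split.
    by apply/imsetP; exists 1%L; rewrite ?Ltrans1.
  move=> _ _ /imsetP[a aZ ->] /imsetP[b bZ ->]; apply/imsetP; exists (a * b)%L.
    by rewrite (cZ _ _ aZ).1.
  by rewrite Ltrans_centralM //; move: aZ; rewrite inE.
have cardC : #|Group gC| = p by rewrite card_imset //; exact: Ltrans_inj.
have /cyclicP[t defC] : cyclic (Group gC) by apply: prime_cyclic; rewrite cardC.
have ot : #[t]%g = p by rewrite orderE -defC.
pose zeta (k : 'F_p) : L := (t ^+ (k : nat))%g 1%L.
have zetaE k : Ltrans (zeta k) = (t ^+ (k : nat))%g /\ central (zeta k).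
  have : (t ^+ (k : nat))%g \in (C : {set _}).
    by rewrite -[C]/(gval (Group gC)) defC mem_cycle.
  by case/imsetP=> c; rewrite inE => cc tE; rewrite /zeta tE Ltrans_at1.
have zetaI : injective zeta.
  move=> k l /(congr1 (@Ltrans L)); rewrite (zetaE k).1 (zetaE l).1 => /eqP.
  by rewrite eq_expg_mod_order ot !modn_small ?ltn_Fp // => /eqP/val_inj.
exists zeta; split=> //.
- move=> k l; apply: Ltrans_inj; rewrite Ltrans_centralM; last exact: (zetaE k).2.
  rewrite (zetaE k).1 (zetaE l).1 (zetaE _).1 -expgD; apply/eqP.
  by rewrite eq_expg_mod_order ot val_FpD // modn_mod.
- by move=> k; exact: (zetaE k).2.
- move=> z zc; have : z \in [set zeta k | k : 'F_p].
    suff -> : [set zeta k | k : 'F_p] = centre L by rewrite inE.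
    apply/eqP; rewrite eqEcard card_imset // card_Fp // cardZ leqnn andbT.
    by apply/subsetP=> _ /imsetP[k _ ->]; rewrite inE (zetaE k).2.
  by case/imsetP=> k _ ->; exists k.
Qed.

End PrimeCentre.

(** The quotient by the centre has order at most p ^ 2, so it is a group; it is
    not cyclic because the loop is not associative. So it is elementary abelian
    of order p ^ 2, which leaves order p for the centre. *)
Lemma central_structure p (L : finLoopType) (z : L) :
    prime p -> #|{: L}| = (p ^ 3)%N -> commutative (@lmul L) -> auto_law L ->
    ~ associative (@lmul L) -> central z -> z <> 1%L ->
  exists (pi : L -> 'F_p * 'F_p) (zeta : 'F_p -> L),
    [/\ {morph pi : x y / (x * y)%L >-> (x + y)%R},
        forall u, exists x, pi x = u,
        forall x y, pi x = pi y -> exists k, y = (x * zeta k)%L,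
        {morph zeta : k l / (k + l)%R >-> (k * l)%L}
      & injective zeta] /\ forall k, central (zeta k) /\ pi (zeta k) = 0%R.
Proof.
move=> p_pr cardL mulC law nA zc nz1; have p_gt1 := prime_gt1 p_pr.
have [j [lt_j3 cQ cZ]] := central_quotient_card mulC law p_pr cardL zc nz1.
have mulCQ : commutative (@lmul _) := @central_quotientC _ mulC law.
have mulAQ := assoc_le_sqr p_pr (ltnSE lt_j3) cQ mulCQ (@central_quotient_law _ mulC law).
pose Q : finGroupType := loop_group mulCQ mulAQ.
have ncQ : ~~ cyclic [set: Q].
  apply/negP=> cycQ; apply: nA; apply: (assoc_of_cyclic_quotient (law := law)).
  exact: (loop_group_gen (mulC := mulCQ) (mulA := mulAQ)).
have j2 : j = 2%N.
  apply/eqP; rewrite eqn_leq -ltnS lt_j3 ltnNge; apply: contra ncQ => le_j1.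
  exact: cyclic_loop_group p_pr le_j1 cQ.
rewrite {}j2 in cQ cZ.
have abQ : (p.-abelem [set: Q])%g.
  rewrite abelemE // loop_group_abelian; apply/exponentP=> x _.
  have : #[x]%g %| p ^ 2 by rewrite -cQ -cardsT order_dvdG ?inE.
  case/(dvdn_pfactor _ _ p_pr)=> -[|[|i]] le_i2 ox.
  - by apply/eqP; rewrite -order_dvdn ox dvd1n.
  - by apply/eqP; rewrite -order_dvdn ox expn1.
  case/negP: ncQ; apply/cyclicP; exists x; apply/esym/eqP.
  by rewrite eqEcard subsetT cardsT cQ -orderE ox leq_exp2l.
have abV : (p.-abelem [set: 'F_p * 'F_p])%g.
  have VX (x : 'F_p * 'F_p) n : (x ^+ n)%g = (x *+ n)%R.
    by elim: n => // n IHn; rewrite expgS IHn mulrS.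
  rewrite abelemE //; apply/andP; split.
    by apply/centsP=> x _ y _; exact: (@addrC ('F_p * 'F_p)%type x y).
  apply/exponentP=> x _; rewrite VX [(_ *+ _)%R]surjective_pairing !raddfMn /=.
  have Fp0 (a : 'F_p) : (a *+ p = 0)%R by rewrite -mulr_natr pchar_Fp_0 ?mulr0.
  by rewrite !Fp0.
have : [set: Q] \isog [set: 'F_p * 'F_p].
  by rewrite (isog_abelem_card _ abQ) abV !cardsT cQ card_prod card_Fp //= mulnn.
case/isogP=> f /injmP injf imf.
have [zeta [zetaM zetaI zetaC zetaS]] := prime_centre_param mulC law p_pr (etrans cZ (expn1 p)).
pose q := quotient_map (centre_normal mulC law).
exists (fun x => f (q x)), zeta; split; first split=> //.
- move=> x y; rewrite /q quotient_mapM.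
  by apply: (morphM f); rewrite inE.
- move=> u; have : u \in (f @* [set: Q])%g by rewrite imf inE.
  case/morphimP=> C _ _ ->.
  by have [x <-] := quotient_map_onto (C : quotient_loop (centre_normal mulC law)); exists x.
- move=> x y /(injf _ _ (in_setT _) (in_setT _))/eqP.
  rewrite quotient_map_eq => /imsetP[c]; rewrite inE => /zetaS[k ->] ->.
  by exists k.
move=> k; split=> //.
have -> : q (zeta k) = q 1%L.
  apply/esym/eqP; rewrite quotient_map_eq; apply/imsetP; exists (zeta k).
    by rewrite inE.
  by rewrite lmul1l.
exact: (morph1 f).
Qed.

(** * The abelian groups of order p ^ 3 *)

Lemma isog_group_loop (gT rT : finGroupType) :
  [set: gT] \isog [set: rT] <-> isomorphic (group_loop gT) (group_loop rT).
Proof.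
split=> [/isogP[f /injmP injf imf] | [f [fB fM]]].
  have fI : injective f by move=> x y; apply: injf; rewrite inE.
  exists f; split; last by move=> x y; apply: (morphM f); rewrite inE.
  apply: (inj_onto_bij fI) => y; have : y \in (f @* [set: gT])%g by rewrite imf inE.
  by case/morphimP=> x _ _ ->; exists x.
have fM' : {in [set: gT] &, {morph f : x y / (x * y)%g}} by move=> x y _ _; exact: fM.
apply/isogP; exists (Morphism fM').
  by apply/injmP=> x y _ _; exact: bij_inj fB _ _.
apply/setP=> y; rewrite inE; have [x <-] := bij_onto fB y.
by apply/morphimP; exists x; rewrite ?inE.
Qed.

Lemma abelian_group_loop (gT : finGroupType) n :
  abelian [set: gT] -> #|{: gT}| = n ->
  comm_automorphic_of_order n (group_loop gT) /\ associative (@lmul (group_loop gT)).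
Proof.
move=> abT cardT; have mulC : commutative (@lmul (group_loop gT)).
  by move=> x y; exact: (centsP abT x (in_setT _) y (in_setT _)).
have mulA : associative (@lmul (group_loop gT)) by exact: mulgA.
split=> //; split=> //; apply/(automorphicP mulC) => x y a b a' b'.
by rewrite !mulA => /lmulI-> /lmulI->.
Qed.

Section Exponents.

Lemma head_abelian_type (gT : finGroupType) (G : {group gT}) :
  abelian G -> head 1 (abelian_type G) = exponent G.
Proof.
move=> abG; rewrite /abelian_type genGidG; have := cardG_gt0 G.
case: #|G| => //= n _; case: ifP => //=; rewrite abG.
by case: eqP => //= -> _; rewrite exponent1.
Qed.

Lemma expg_pair (aT rT : finGroupType) (u : aT * rT) n :
  (u ^+ n = (u.1 ^+ n, u.2 ^+ n))%g.
Proof. by elim: n => // n IHn; rewrite !expgS IHn; case: u {IHn}. Qed.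

Lemma exponent_pair (aT rT : finGroupType) :
  exponent [set: aT * rT] = lcmn (exponent [set: aT]) (exponent [set: rT]).
Proof.
apply/eqP; rewrite eqn_dvd dvdn_lcm; apply/and3P; split.
- apply/exponentP=> u _; rewrite expg_pair; congr (_, _).
    by apply/eqP; rewrite -order_dvdn (dvdn_trans (dvdn_exponent (in_setT _))) ?dvdn_lcml.
  by apply/eqP; rewrite -order_dvdn (dvdn_trans (dvdn_exponent (in_setT _))) ?dvdn_lcmr.
- apply/exponentP=> x _; have := expg_exponent (in_setT (x, 1%g : rT)).
  by rewrite expg_pair => -[].
- apply/exponentP=> x _; have := expg_exponent (in_setT (1%g : aT, x)).
  by rewrite expg_pair => -[].
Qed.

Lemma card_Z n : 1 < n -> #|{: 'Z_n}| = n.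
Proof. by move=> n_gt1; rewrite card_ord Zp_cast. Qed.

Lemma exponent_Z n : 1 < n -> exponent [set: 'Z_n] = n.
Proof.
move=> n_gt1; rewrite exponent_cyclic ?cardsT ?card_Z //.
by apply/cyclicP; exists (Zp1 : 'Z_n); exact: Zp_cycle.
Qed.

End Exponents.

Section AbelianTypes.

Variables (p : nat) (p_pr : prime p).

(** The entries of the type are nontrivial powers of p, nonincreasing, with
    exponents of sum 3. *)
Lemma abelian_type_p3 (gT : finGroupType) (G : {group gT}) :
  abelian G -> #|G| = (p ^ 3)%N ->
  abelian_type G \in [:: [:: p ^ 3]; [:: p ^ 2; p]; [:: p; p; p]].
Proof.
move=> abG cardG; have [b defG tb] := abelian_structure abG.
have prodG : (\prod_(n <- abelian_type G) n = p ^ 3)%N.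
  by rewrite -cardG -(bigdprod_card defG) -tb big_map.
have [es def_t es0] : exists2 es, abelian_type G = [seq (p ^ e)%N | e <- es] & all (leq 1) es.
  have := abelian_type_gt1 G; have : all (fun n => n %| p ^ 3)%N (abelian_type G).
    by apply/allP=> n nG; rewrite -prodG (big_rem n nG) dvdn_mulr.
  elim: (abelian_type G) => [|n t IHt] /=; first by exists [::].
  case/andP=> /(dvdn_pfactor _ _ p_pr)[e _ ->] /IHt{}IHt /andP[e_gt1 /IHt[es -> es0]].
  exists (e :: es); rewrite //= es0 andbT; case: e e_gt1 => //.
have sum_es : sumn es = 3.
  have : (p ^ sumn es = p ^ 3)%N.
    rewrite -prodG def_t; elim: (es) => [|e t IHt]; first by rewrite big_nil.
    by rewrite /= big_cons expnD IHt.
  by move/eqP; rewrite eqn_exp2l ?prime_gt1 // => /eqP.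
have := abelian_type_sorted G; rewrite {}def_t.
case: es es0 sum_es => [|[|[|[|[|e1]]]] [|[|[|[|e2]]] [|[|[|e3]] [|[|e4] es]]]] //=.
all: rewrite ?andbF ?expn1 ?inE ?eqxx ?orbT //.
by move=> _ _; rewrite leqNgt -{1}(expn1 p) ltn_exp2l ?prime_gt1.
Qed.

(** The three types have distinct heads, and the head of the type is the
    exponent. *)
Lemma isog_exponent_p3 (gT rT : finGroupType) (G : {group gT}) (H : {group rT}) :
  abelian G -> abelian H -> #|G| = (p ^ 3)%N -> #|H| = (p ^ 3)%N ->
  exponent G = exponent H -> G \isog H.
Proof.
move=> abG abH cG cH; rewrite -!head_abelian_type // => eqh.
rewrite eq_abelian_type_isog //; apply/eqP.
have p_gt1 := prime_gt1 p_pr.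
have n32 : (p ^ 3)%N <> (p ^ 2)%N by apply/eqP; rewrite eqn_exp2l.
have n31 : (p ^ 3)%N <> p by apply/eqP; rewrite -[X in _ != X]expn1 eqn_exp2l.
have n21 : (p ^ 2)%N <> p by apply/eqP; rewrite -[X in _ != X]expn1 eqn_exp2l.
have := abelian_type_p3 abG cG; have := abelian_type_p3 abH cH; rewrite !inE.
move: (p ^ 3)%N (p ^ 2)%N n32 n31 n21 => a b nab nap nbp.
by move=> /or3P[] /eqP tH /or3P[] /eqP tG; move: eqh;
  rewrite tG tH /=; congruence.
Qed.

Definition elementary_group : finGroupType := ('Z_p * 'Z_p * 'Z_p)%type.
Definition mixed_group : finGroupType := ('Z_p * 'Z_(p ^ 2))%type.
Definition cyclic_group : finGroupType := 'Z_(p ^ 3).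

Let p_gt1 := prime_gt1 p_pr.
Let expn_gt1 k : (1 < p ^ k.+1)%N. Proof. by rewrite -(exp1n k.+1) ltn_exp2r. Qed.

Lemma card_elementary_group : #|{: elementary_group}| = (p ^ 3)%N.
Proof. by rewrite !card_prod card_Z // -mulnA. Qed.

Lemma card_mixed_group : #|{: mixed_group}| = (p ^ 3)%N.
Proof. by rewrite card_prod !card_Z. Qed.

Lemma card_cyclic_group : #|{: cyclic_group}| = (p ^ 3)%N.
Proof. by rewrite card_Z. Qed.

Lemma exponent_elementary : exponent [set: elementary_group] = p.
Proof. by rewrite !exponent_pair exponent_Z // !(lcmn_idPr (dvdnn p)). Qed.

Lemma exponent_mixed : exponent [set: mixed_group] = (p ^ 2)%N.
Proof.
by rewrite exponent_pair !exponent_Z // (lcmn_idPr _) ?dvdn_exp.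
Qed.

Lemma exponent_cyclic_group : exponent [set: cyclic_group] = (p ^ 3)%N.
Proof. by rewrite exponent_Z. Qed.

Lemma abelian_elementary : abelian [set: elementary_group].
Proof. by apply/centsP=> -[[a b] c] _ [[a' b'] c'] _; congr (_, _, _); exact: addrC. Qed.

Lemma abelian_mixed : abelian [set: mixed_group].
Proof. by apply/centsP=> -[a b] _ [a' b'] _; congr (_, _); exact: addrC. Qed.

Lemma abelian_cyclic : abelian [set: cyclic_group].
Proof. by apply/centsP=> a _ b _; exact: addrC. Qed.

Definition abelian_groups_p3 : seq finLoopType :=
  [:: group_loop elementary_group : finLoopType;
      group_loop mixed_group : finLoopType;
      group_loop cyclic_group : finLoopType].

Lemma abelian_groups_classify :
  classifies (fun L => comm_automorphic_of_order (p ^ 3) L /\ associative (@lmul L))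
    abelian_groups_p3.
Proof.
have n32 : (p ^ 3)%N <> (p ^ 2)%N by apply/eqP; rewrite eqn_exp2l.
have n31 : (p ^ 3)%N <> p by apply/eqP; rewrite -{2}(expn1 p) eqn_exp2l.
have n21 : (p ^ 2)%N <> p by apply/eqP; rewrite -{2}(expn1 p) eqn_exp2l.
have expE (gT rT : finGroupType) : isomorphic (group_loop gT) (group_loop rT) ->
    exponent [set: gT] = exponent [set: rT].
  by move/isog_group_loop/exponent_isog.
split.
- case=> [|[|[|[]]]] //= _ [<-]; apply: abelian_group_loop.
  + exact: abelian_elementary.
  + exact: card_elementary_group.
  + exact: abelian_mixed.
  + exact: card_mixed_group.
  + exact: abelian_cyclic.
  + exact: card_cyclic_group.
- by case=> [|[|[|[]]]] [|[|[|[]]]] //= _ _ [<-] [<-] /expE;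
    rewrite ?exponent_elementary ?exponent_mixed ?exponent_cyclic_group; congruence.
- move=> L [[mulC aut cardL] mulA]; pose gT := loop_group mulC mulA.
  have abG : abelian [set: gT] := loop_group_abelian mulC mulA.
  have cardG : #|[set: gT]| = (p ^ 3)%N by rewrite cardsT.
  suff iso (rT : finGroupType) : abelian [set: rT] -> #|{: rT}| = (p ^ 3)%N ->
      exponent [set: gT] = exponent [set: rT] -> isomorphic L (group_loop rT).
    have := abelian_type_p3 abG cardG; rewrite !inE => /or3P[] /eqP tG;
      have := head_abelian_type abG; rewrite tG /= => eG.
    + exists 2, (group_loop cyclic_group); split=> //; apply: iso.
      * exact: abelian_cyclic.
      * exact: card_cyclic_group.
      * by rewrite exponent_cyclic_group.
    + exists 1, (group_loop mixed_group); split=> //; apply: iso.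
      * exact: abelian_mixed.
      * exact: card_mixed_group.
      * by rewrite exponent_mixed.
    + exists 0, (group_loop elementary_group); split=> //; apply: iso.
      * exact: abelian_elementary.
      * exact: card_elementary_group.
      * by rewrite exponent_elementary.
  move=> abT cardT eT; have : isomorphic L (group_loop gT) by exists id; split=> //; exists id.
  move/isomorphic_trans; apply; apply/isog_group_loop/isog_exponent_p3 => //.
  by rewrite cardsT.
Qed.

End AbelianTypes.

Local Open Scope ring_scope.

(** * Central extensions of the plane over F_p *)

Section Carry.

Variables (p : nat) (p_pr : prime p).
Implicit Types a b c : 'F_p.

Lemma carryE a b : carry a b = ((a + b) %/ p)%:R.
Proof.
rewrite /carry; case: ltnP => [lt_p | le_p]; first by rewrite divn_small.
have lt2 : (a + b < 2 * p)%N.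
  by rewrite mul2n -addnn -addSn leq_add ?ltn_Fp // ltnW ?ltn_Fp.
suff -> : ((a + b) %/ p = 1)%N by [].
apply/eqP; rewrite eqn_leq divn_gt0 ?prime_gt0 // le_p andbT.
by rewrite -ltnS ltn_divLR ?prime_gt0.
Qed.

Lemma carry_cocycle a b c :
  carry a b + carry (a + b) c = carry b c + carry a (b + c).
Proof.
have dm m n : ((m %/ p) + ((m %% p + n) %/ p) = (m + n) %/ p)%N.
  by rewrite [in RHS](divn_eq m p) -addnA divnMDl ?prime_gt0.
rewrite !carryE -!natrD !val_FpD // dm [(a + (b + c) %% p)%N]addnC dm.
by rewrite -addnA [in LHS]addnC.
Qed.

Lemma val_Fp_mulrn a n : (a *+ n : 'F_p) = (n * a %% p)%N :> nat.
Proof.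
elim: n => [|n IHn]; first by rewrite mod0n.
by rewrite mulrSr val_FpD // IHn modnDml mulSnr.
Qed.

(** Adding a to itself n times crosses a multiple of p exactly n a / p times. *)
Lemma sum_carry a n : \sum_(i < n) carry (a *+ i) a = ((n * a) %/ p)%:R.
Proof.
elim: n => [|n IHn]; first by rewrite big_ord0 div0n.
rewrite big_ord_recr /= IHn carryE val_Fp_mulrn -natrD mulSnr.
by rewrite [in RHS](divn_eq (n * a) p) -addnA divnMDl ?prime_gt0.
Qed.

Lemma sum_carry_p a : \sum_(i < p) carry (a *+ i) a = a.
Proof. by rewrite sum_carry mulKn ?prime_gt0 // natr_Zp. Qed.

End Carry.

Section Model.

Variables (p : nat) (p_pr : prime p).
Local Notation V := ('F_p * 'F_p)%type.
Implicit Types (c : 'F_p) (u v w : V).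

(** The associator of an extension whose middle nucleus is the kernel of the
    functional (s, t): the functional in the middle argument times the
    determinant of the outer two. *)
Definition asc (s t : 'F_p) u v w : 'F_p :=
  (s * v.1 + t * v.2) * (u.1 * w.2 - u.2 * w.1).

(** A symmetric cochain whose coboundary is the associator [asc]: the last two
    coordinates of the multiplication of F, with coefficients s and t. *)
Definition theta (s t : 'F_p) u v : 'F_p :=
  t * u.2 * v.2 * (u.1 + v.1) - s * u.1 * v.1 * (u.2 + v.2).

Lemma theta_asc s t u v w :
  theta s t u v + theta s t (u + v) w =
  theta s t v w + theta s t u (v + w) + asc s t u v w.
Proof. by case: u v w => [u1 u2] [v1 v2] [w1 w2]; rewrite /theta /asc /=; ring. Qed.

Lemma thetaC s t u v : theta s t u v = theta s t v u.
Proof. by rewrite /theta; ring. Qed.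

Lemma theta0 s t u : theta s t 0 u = 0.
Proof. by rewrite /theta /=; ring. Qed.

Definition cocycle (c1 c2 s t : 'F_p) u v : 'F_p :=
  c1 * carry u.1 v.1 + c2 * carry u.2 v.2 + theta s t u v.

Arguments asc : simpl never.
Arguments theta : simpl never.
Arguments cocycle : simpl never.

Lemma cocycle_asc c1 c2 s t u v w :
  cocycle c1 c2 s t u v + cocycle c1 c2 s t (u + v) w =
  cocycle c1 c2 s t v w + cocycle c1 c2 s t u (v + w) + asc s t u v w.
Proof.
transitivity (c1 * (carry u.1 v.1 + carry (u.1 + v.1) w.1) +
  c2 * (carry u.2 v.2 + carry (u.2 + v.2) w.2) +
  (theta s t u v + theta s t (u + v) w)); first by rewrite /cocycle /=; ring.
by rewrite !carry_cocycle // theta_asc /cocycle /=; ring.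
Qed.

Lemma cocycleC c1 c2 s t u v : cocycle c1 c2 s t u v = cocycle c1 c2 s t v u.
Proof. by rewrite /cocycle thetaC [carry u.1 _]carryC [carry u.2 _]carryC. Qed.

Lemma cocycle0 c1 c2 s t u : cocycle c1 c2 s t 0 u = 0.
Proof. by rewrite /cocycle theta0 !carry0 // !mulr0 !addr0. Qed.

(** The central extension of the plane by F_p with this cocycle. The carries
    give the basis vectors of the plane the p-th powers c1 and c2. *)
Definition model (_ : prime p) (c1 c2 s t : 'F_p) : Type := (V * 'F_p)%type.

Variables c1 c2 s t : 'F_p.
Local Notation M := (model p_pr c1 c2 s t).
Local Notation om := (cocycle c1 c2 s t).

Definition mul_model (a b : M) : M := (a.1 + b.1, a.2 + b.2 + om a.1 b.1).
Definition one_model : M := (0, 0).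

Lemma mul_modelC : commutative mul_model.
Proof. by move=> a b; rewrite /mul_model addrC (addrC a.2) cocycleC. Qed.

Lemma mul1_model : left_id one_model mul_model.
Proof. by move=> [u k]; rewrite /mul_model /= cocycle0 !add0r addr0. Qed.

Lemma mul_model1 : right_id one_model mul_model.
Proof. by move=> a; rewrite mul_modelC mul1_model. Qed.

Lemma mul_model_bijl a : bijective (mul_model a).
Proof.
exists (fun b => (b.1 - a.1, b.2 - a.2 - om a.1 (b.1 - a.1))) => -[u k].
  by rewrite /mul_model /= (addrC a.1) addrK; congr (_, _); ring.
by rewrite /mul_model /= addrC subrK; congr (_, _); ring.
Qed.

Lemma mul_model_bijr a : bijective (mul_model^~ a).
Proof. by apply: eq_bij (mul_model_bijl a) _ _ => b; rewrite mul_modelC. Qed.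

HB.instance Definition _ := Finite.on M.
HB.instance Definition _ :=
  isLoop.Build M mul1_model mul_model1 mul_model_bijl mul_model_bijr.

Lemma modelE (a b : M) : (a * b)%L = (a.1 + b.1, a.2 + b.2 + om a.1 b.1).
Proof. by []. Qed.

Lemma modelC : commutative (@lmul M). Proof. exact: mul_modelC. Qed.

Definition zmodel (k : 'F_p) : M := (0, k).

Lemma mul_zmodel (a : M) k : (a * zmodel k)%L = (a.1, a.2 + k).
Proof. by rewrite modelE /= cocycleC cocycle0 !addr0. Qed.

Lemma zmodelM : {morph zmodel : k l / k + l >-> (k * l)%L}.
Proof. by move=> k l; rewrite mul_zmodel. Qed.

Lemma zmodel_central (a b : M) k : (a * (b * zmodel k) = a * b * zmodel k)%L.
Proof. by rewrite !mul_zmodel !modelE /=; move: (om _ _) => m; congr (_, _); ring. Qed.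

Lemma model_asc (a b c : M) :
  (a * b * c = a * (b * c) * zmodel (asc s t a.1 b.1 c.1))%L.
Proof.
rewrite mul_zmodel !modelE /=; congr (_, _); first by rewrite addrA.
transitivity (a.2 + b.2 + c.2 + (om a.1 b.1 + om (a.1 + b.1) c.1)); first by ring.
by rewrite cocycle_asc; ring.
Qed.

(** An inner mapping multiplies its argument by a central element that is
    additive in the argument, as [asc] is additive in its last variable. *)
Lemma model_law : auto_law M.
Proof.
have shift (x y a a' : M) : (x * y * a' = x * (y * a))%L ->
    a = (a' * zmodel (asc s t x.1 y.1 a.1))%L.
  move=> e; apply: (lmulI (x := (x * y)%L)).
  by rewrite zmodel_central e -model_asc.
move=> x y a b a' b' /shift ea /shift eb.
set k := asc _ _ _ _ _ in ea; set l := asc _ _ _ _ _ in eb.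
have kl : asc s t x.1 y.1 (a * b)%L.1 = k + l by rewrite /k /l /asc /=; ring.
have zC m (c : M) : (c * zmodel m = zmodel m * c)%L by exact: modelC.
apply: (lmulI (x := zmodel (k + l))).
rewrite -[RHS]zC -kl -model_asc kl -zC -!zmodel_central; congr (_ * _)%L.
have -> : (a * b = (a' * zmodel k) * (b' * zmodel l))%L by rewrite -ea -eb.
rewrite [RHS]zmodel_central [(a' * zmodel k * b')%L]modelC !zmodel_central.
by rewrite zmodelM !zmodel_central [(b' * a')%L]modelC.
Qed.

Lemma card_model : #|{: M}| = (p ^ 3)%N.
Proof. by rewrite !card_prod card_Fp // expnSr expnS expn1. Qed.

End Model.

(** * Loops that are central extensions of the plane *)

Section Extension.

Variables (p : nat) (p_pr : prime p) (L : finLoopType).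
Local Notation V := ('F_p * 'F_p)%type.
Variables (pi : L -> V) (zeta : 'F_p -> L).
Hypothesis mulC : commutative (@lmul L).
Hypothesis piM : {morph pi : x y / (x * y)%L >-> x + y}.
Hypothesis pi_fiber : forall x y, pi x = pi y -> exists k, y = (x * zeta k)%L.
Hypothesis zetaM : {morph zeta : k l / k + l >-> (k * l)%L}.
Hypothesis zeta_inj : injective zeta.
Hypothesis zetaA : forall k x y, (x * y * zeta k = x * (y * zeta k))%L.

Implicit Types (a b c d x y : L) (k l : 'F_p).

Lemma zeta0 : zeta 0 = 1%L.
Proof. by apply: (lmul_eq1l (x := zeta 0)); rewrite -zetaM addr0. Qed.

Lemma pi1 : pi 1%L = 0.
Proof. by apply: (addrI (pi 1%L)); rewrite -piM lmul1l addr0. Qed.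

Lemma pi_iter b n : pi (iter n (lmul b) 1%L) = pi b *+ n.
Proof. by elim: n => [|n IHn]; rewrite ?pi1 //= piM IHn mulrS. Qed.

Lemma Fp_pair_mulrn (u : V) : u *+ p = 0.
Proof.
have Fp0 (a : 'F_p) : a *+ p = 0 by rewrite -mulr_natr pchar_Fp_0 ?mulr0.
by rewrite [_ *+ _]surjective_pairing !raddfMn /= !Fp0.
Qed.

Lemma zetaK x k l : (x * zeta k)%L = (x * zeta l)%L -> k = l.
Proof. by move/lmulI/zeta_inj. Qed.

Lemma mul_zeta x k l : (x * zeta k * zeta l)%L = (x * zeta (k + l))%L.
Proof. by rewrite zetaA zetaM. Qed.

Lemma zetaAC x y k : (x * zeta k * y)%L = (x * y * zeta k)%L.
Proof. by rewrite mulC -zetaA [(y * x)%L]mulC. Qed.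

Section Associator.

Hypothesis law : auto_law L.

Lemma assoc_ex a b c : exists k, (a * b * c == a * (b * c) * zeta k)%L.
Proof.
have [|k ->] := @pi_fiber (a * (b * c))%L (a * b * c)%L; last by exists k.
by rewrite !piM addrA.
Qed.

Definition delta a b c := xchoose (assoc_ex a b c).

Lemma deltaE a b c : (a * b * c = a * (b * c) * zeta (delta a b c))%L.
Proof. exact/eqP/(xchooseP (assoc_ex a b c)). Qed.

Lemma delta_uniq a b c k :
  (a * b * c = a * (b * c) * zeta k)%L -> delta a b c = k.
Proof. by rewrite deltaE => /zetaK. Qed.

(** The inner mapping of a and b is c |-> c * zeta (- delta a b c), so its
    multiplicativity is additivity of the associator in the last argument. *)
Lemma deltaM a b c d : delta a b (c * d)%L = delta a b c + delta a b d.
Proof.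
have E e : (a * b * (e * zeta (- delta a b e)) = a * (b * e))%L.
  by rewrite -zetaA (deltaE a b e) mul_zeta subrr zeta0 lmull1.
have := law (E c) (E d).
rewrite zetaAC -[(c * (d * _))%L]zetaA mul_zeta -zetaA => e.
apply: delta_uniq; rewrite -e mul_zeta -[LHS]lmull1 -zeta0.
by congr (_ * zeta _)%L; ring.
Qed.

Lemma delta_sym a b c : delta c b a = - delta a b c.
Proof.
apply: delta_uniq; rewrite [(c * (b * a))%L]mulC [(b * a)%L]mulC (deltaE a b c).
by rewrite mul_zeta subrr zeta0 lmull1 mulC [(c * b)%L]mulC.
Qed.

Lemma delta_diag a b : delta a b a = 0.
Proof. by apply: delta_uniq; rewrite zeta0 lmull1 mulC [(b * a)%L]mulC. Qed.

Lemma delta_cyclic a b c : delta a b c + delta b c a + delta c a b = 0.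
Proof.
have := deltaE a b c; rewrite [(a * (b * c))%L]mulC (deltaE b c a).
rewrite [(b * (c * a))%L]mulC (deltaE c a b) [(c * (a * b))%L]mulC !mul_zeta.
rewrite -{1}[(a * b * c)%L]lmull1 -zeta0 => /zetaK/esym e.
by rewrite -{}[RHS]e; ring.
Qed.

Lemma delta_zeta a b k : delta a b (zeta k) = 0.
Proof. by apply: delta_uniq; rewrite zeta0 lmull1 zetaA. Qed.

(** Such a g factors through pi. *)
Lemma additive_on_basis (g : L -> 'F_p) x y :
  (forall a b, g (a * b)%L = g a + g b) -> (forall k, g (zeta k) = 0) ->
  pi x = (1, 0) -> pi y = (0, 1) ->
  forall a, g a = (pi a).1 * g x + (pi a).2 * g y.
Proof.
move=> gM gz px py a; set u := pi a.
have g1 : g 1%L = 0 by rewrite -zeta0 gz.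
have g_iter b n : g (iter n (lmul b) 1%L) = g b *+ n.
  by elim: n => [|n IHn]; rewrite ?g1 //= gM IHn mulrS.
have [k ->] : exists k, a = (iter u.1 (lmul x) 1 * iter u.2 (lmul y) 1 * zeta k)%L.
  apply: pi_fiber; rewrite piM !pi_iter px py.
  apply: injective_projections; rewrite /= !raddfMn /=.
    by rewrite mul0rn addr0 natr_Zp.
  by rewrite mul0rn add0r natr_Zp.
by rewrite !gM gz addr0 !g_iter -!(mulr_natl (g _)) !natr_Zp.
Qed.

(** [deltaM] and the symmetries above make delta additive in every argument and
    blind to the centre, so it is determined by its values on x and y; all of
    these vanish or are, up to sign, delta x x y and delta x y y. *)
Lemma associator_form x y : pi x = (1, 0) -> pi y = (0, 1) ->
  forall a b c, delta a b c =
    asc (delta x x y) (delta x y y) (pi a) (pi b) (pi c).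
Proof.
move=> px py a b c.
have z1 d e k : delta (zeta k) d e = 0 by rewrite -[LHS]opprK -delta_sym delta_zeta oppr0.
have m1 d e a1 a2 : delta (a1 * a2)%L d e = delta a1 d e + delta a2 d e.
  by rewrite delta_sym deltaM opprD -!delta_sym.
have cyc d e f : delta d e f = - delta e f d - delta f d e.
  by apply/eqP; rewrite -opprD -addr_eq0 addrA delta_cyclic.
have z2 d e k : delta d (zeta k) e = 0 by rewrite cyc z1 delta_zeta !oppr0 addr0.
have m2 d e a1 a2 : delta d (a1 * a2)%L e = delta d a1 e + delta d a2 e.
  by rewrite cyc m1 deltaM [delta d a1 e]cyc [delta d a2 e]cyc; ring.
rewrite (additive_on_basis (m1 b c) (z1 b c) px py a).
rewrite (additive_on_basis (deltaM x b) (delta_zeta x b) px py c).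
rewrite (additive_on_basis (deltaM y b) (delta_zeta y b) px py c).
rewrite !delta_diag (delta_sym x b y).
rewrite (additive_on_basis (m2 x y) (z2 x y) px py b).
by rewrite /asc; ring.
Qed.

End Associator.

(** Dividing the product by the standard cocycle theta of its associator makes
    the loop an abelian group, in which the normal form of an element over the
    basis x, y is computed with carries. *)
Lemma extension_model (c1 c2 s t : 'F_p) x y :
    (forall a b c, a * b * c =
       a * (b * c) * zeta (asc s t (pi a) (pi b) (pi c)))%L ->
    (forall k, pi (zeta k) = 0) -> pi x = (1, 0) -> pi y = (0, 1) ->
    iter p (lmul x) 1%L = zeta c1 -> iter p (lmul y) 1%L = zeta c2 ->
  isomorphic (model p_pr c1 c2 s t) L.
Proof.
move=> assoc piz px py xp yp.
pose th a b := theta s t (pi a) (pi b).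
pose tw a b := (a * b * zeta (- th a b))%L.
have pi_tw a b : pi (tw a b) = pi a + pi b by rewrite !piM piz addr0.
have pi_mz a k : pi (a * zeta k)%L = pi a by rewrite piM piz addr0.
have twC : commutative tw by move=> a b; rewrite /tw /th [(a * b)%L]mulC thetaC.
have twA : associative tw.
  move=> a b c; rewrite /tw -zetaA (zetaAC (a * b)%L c) !mul_zeta (assoc a b c) mul_zeta.
  rewrite /th !pi_mz !piM; congr (_ * zeta _)%L.
  set A := asc _ _ _ _ _; have -> : A = theta s t (pi a) (pi b) +
      theta s t (pi a + pi b) (pi c) -
      (theta s t (pi b) (pi c) + theta s t (pi a) (pi b + pi c)).
    by rewrite theta_asc addrC addKr.
  by move: (theta _ _ _ _) (theta _ _ _ _) (theta _ _ _ _) (theta _ _ _ _) => *; ring.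
have tw1 : left_id 1%L tw.
  by move=> a; rewrite /tw /th pi1 theta0 oppr0 zeta0 lmull1 lmul1l.
pose W : nmodType := HB.pack_for nmodType (FinLoop.sort L)
  (GRing.isNmodule.Build (FinLoop.sort L) twA twC tw1).
have WE (a b : W) : a + b = tw a b by [].
have mulE (a b : W) : (a * b)%L = a + b + zeta (th a b) :> W.
  rewrite [RHS]WE {1}/tw {2}/th piz [theta _ _ _ 0]thetaC theta0 oppr0 zeta0 lmull1.
  by rewrite WE /tw mul_zeta addNr zeta0 lmull1.
have zetaD k l : (zeta k : W) + zeta l = zeta (k + l).
  by rewrite WE /tw /th !piz theta0 oppr0 zeta0 lmull1 zetaM.
have pi_nat (a : W) n : pi (a *+ n) = pi a *+ n.
  elim: n => [|n IHn]; first by rewrite mulr0n; exact: pi1.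
  by rewrite mulrS WE pi_tw IHn mulrS.
have zeta_nat k n : (zeta k : W) *+ n = zeta (k *+ n).
  elim: n => [|n IHn]; first by rewrite !mulr0n zeta0.
  by rewrite !mulrS IHn zetaD.
have line (a : W) n : (forall i j, theta s t (pi a *+ i) (pi a *+ j) = 0) ->
    a *+ n = iter n (lmul (a : L)) 1%L.
  move=> tha; elim: n => // n IHn; rewrite mulrS WE /tw iterS -IHn /th pi_nat.
  by rewrite -{1}[pi a]mulr1n tha oppr0 zeta0 lmull1.
have xW : (x : W) *+ p = zeta c1.
  by rewrite line ?xp // => i j; rewrite px /theta !raddfMn /= !mul0rn; ring.
have yW : (y : W) *+ p = zeta c2.
  by rewrite line ?yp // => i j; rewrite py /theta !raddfMn /= !mul0rn; ring.
have carryD (b : W) (k i j : 'F_p) : b *+ p = zeta k ->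
    b *+ i + b *+ j = b *+ (i + j)%R + (zeta (k * carry i j) : W).
  move=> bp; rewrite -mulrnDr (divn_eq (i + j)%N p) mulrnDr addrC val_FpD //.
  by rewrite mulnC mulrnA bp zeta_nat carryE // mulr_natr.
pose nf (m : model p_pr c1 c2 s t) : W :=
  (x : W) *+ m.1.1 + (y : W) *+ m.1.2 + (zeta m.2 : W).
have pi_nf m : pi (nf m) = m.1.
  rewrite /nf !WE !pi_tw !pi_nat px py piz addr0.
  by apply: injective_projections; rewrite /= !raddfMn /= mul0rn ?addr0 ?add0r natr_Zp.
have nfE m : nf m = (nf (m.1, 0) * zeta m.2)%L.
  rewrite mulE /th piz [theta _ _ _ 0]thetaC theta0.
  by rewrite /nf /= -!addrA !zetaD addr0 add0r.
exists nf; split.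
  have nf_inj : injective nf.
    move=> m n e; have e1 : m.1 = n.1 by rewrite -!pi_nf e.
    apply: injective_projections => //; move: e.
    by rewrite nfE [RHS]nfE e1 => /zetaK.
  apply: inj_onto_bij nf_inj _ => a.
  have [k ->] : exists k, a = (nf (pi a, 0) * zeta k)%L.
    by apply: pi_fiber; rewrite pi_nf.
  by exists (pi a, k); rewrite nfE.
move=> m n; rewrite mulE /th !pi_nf {2 3}/nf addrACA zetaD addrACA.
rewrite (carryD _ _ _ _ xW) (carryD _ _ _ _ yW) addrACA zetaD -!addrA !zetaD addrA.
rewrite /nf modelE /=.
suff -> : m.2 + n.2 + cocycle c1 c2 s t m.1 n.1 =
  c1 * carry m.1.1 n.1.1 + c2 * carry m.1.2 n.1.2 +
  (m.2 + n.2 + theta s t m.1 n.1) by [].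
by rewrite /cocycle; ring.
Qed.

End Extension.

Section ModelPowers.

Variables (p : nat) (p_pr : prime p) (c1 c2 s t : 'F_p).
Local Notation V := ('F_p * 'F_p)%type.
Local Notation M := (model p_pr c1 c2 s t).
Local Notation om := (cocycle c1 c2 s t).
Local Notation zm := (zmodel p_pr c1 c2 s t).

Lemma sum_oblong n : (3 * \sum_(i < n) i * i.+1 = n.-1 * n * n.+1)%N.
Proof.
elim: n => [|n IHn]; first by rewrite big_ord0.
rewrite big_ord_recr mulnDr IHn /=; case: n {IHn} => //= n.
by rewrite -mulnA -mulnDl addn3 mulnC.
Qed.

(** The sum is (p - 1) p (p + 1) / 3, which p divides unless p = 3. *)
Lemma sum_oblong_Fp :
  \sum_(i < p) (i%:R + i%:R ^+ 2) = - (p == 3)%:R :> 'F_p.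
Proof.
have -> : \sum_(i < p) (i%:R + i%:R ^+ 2) = (\sum_(i < p) i * i.+1)%N%:R :> 'F_p.
  by rewrite natr_sum; apply: eq_bigr => i _; rewrite mulnS natrD natrM expr2.
set S := (\sum_(i < p) _)%N; have e : (3 * S = p.-1 * p * p.+1)%N := sum_oblong p.
have [p3 | np3] := eqVneq p 3%N.
  have -> : S = 8%N by apply/eqP; rewrite -(eqn_pmul2l (m := 3)) // e p3.
  rewrite /= -[RHS]add0r -(pchar_Fp_0 p_pr); apply/eqP.
  by rewrite p3 -subr_eq0.
rewrite oppr0; apply/eqP; rewrite -(dvdn_pcharf (pchar_Fp p_pr)).
have cop : coprime p 3 by rewrite prime_coprime // dvdn_prime2.
by rewrite -(Gauss_dvdr _ cop) e dvdn_mulr // dvdn_mull.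
Qed.

(** The p-th power map of the extension, as a function on the plane; for p = 3
    the sum of the i (i + 1) does not vanish and the associator contributes a
    cubic form. *)
Definition psi (u : V) : 'F_p :=
  c1 * u.1 + c2 * u.2
  + (p == 3)%:R * (s * u.1 ^+ 2 * u.2 - t * u.1 * u.2 ^+ 2).

Lemma model_iter (a : M) n :
  iter n (lmul a) 1%L = (a.1 *+ n, a.2 *+ n + \sum_(i < n) om a.1 (a.1 *+ i)) :> M.
Proof.
elim: n => [|n IHn]; first by rewrite big_ord0 addr0.
by rewrite iterS IHn modelE big_ord_recr /= !mulrS !addrA.
Qed.

Lemma model_powp (a : M) : iter p (lmul a) 1%L = zm (psi a.1).
Proof.
rewrite model_iter Fp_pair_mulrn //.
have Fp0 (b : 'F_p) : b *+ p = 0 by rewrite -mulr_natr pchar_Fp_0 ?mulr0.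
rewrite Fp0 add0r; congr (_, _); case: a => -[u1 u2] k /=.
transitivity (c1 * (\sum_(i < p) carry (u1 *+ i) u1) +
  c2 * (\sum_(i < p) carry (u2 *+ i) u2) +
  (t * u1 * u2 ^+ 2 - s * u1 ^+ 2 * u2) * \sum_(i < p) (i%:R + i%:R ^+ 2)).
  rewrite !big_distrr /= -!big_split /=; apply: eq_bigr => i _.
  rewrite /cocycle /theta !raddfMn /= [carry u1 _]carryC [carry u2 _]carryC.
  by rewrite -[u1 *+ i in X in _ + X = _]mulr_natr; ring.
by rewrite !sum_carry_p // sum_oblong_Fp /psi /=; ring.
Qed.

End ModelPowers.

Section Rebase.

Variables (p : nat) (p_pr : prime p) (c1 c2 s t : 'F_p).
Local Notation V := ('F_p * 'F_p)%type.
Local Notation M := (model p_pr c1 c2 s t).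
Local Notation psi := (psi c1 c2 s t).

(** Reading the extension in the basis (a1, a2), (b1, b2) of the plane and in
    the coordinate of the centre divided by k. *)
Lemma model_rebase (a1 a2 b1 b2 k : 'F_p) :
    a1 * b2 - a2 * b1 != 0 -> k != 0 ->
  isomorphic
    (model p_pr (k^-1 * psi (a1, a2)) (k^-1 * psi (b1, b2))
       (k^-1 * (a1 * b2 - a2 * b1) * (s * a1 + t * a2))
       (k^-1 * (a1 * b2 - a2 * b1) * (s * b1 + t * b2))) M.
Proof.
set D := _ - _ => D0 k0.
pose pi (m : M) : V :=
  ((m.1.1 * b2 - m.1.2 * b1) / D, (m.1.2 * a1 - m.1.1 * a2) / D).
pose zeta (l : 'F_p) : M := zmodel p_pr c1 c2 s t (k * l).
have zC l (m : M) : (m * zeta l = zeta l * m)%L by exact: modelC.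
apply: (@extension_model p p_pr M pi zeta (@modelC _ _ _ _ _ _) _ _ _ _ _
  _ _ _ _ ((a1, a2), 0) ((b1, b2), 0)).
- by move=> m n; apply: injective_projections; rewrite /= -mulrDl; congr (_ / _); ring.
- move=> m n e; exists (k^-1 * (n.2 - m.2)).
  have e1 : m.1.1 * b2 - m.1.2 * b1 = n.1.1 * b2 - n.1.2 * b1.
    exact: mulIf (invr_neq0 D0) _ _ (congr1 fst e).
  have e2 : m.1.2 * a1 - m.1.1 * a2 = n.1.2 * a1 - n.1.1 * a2.
    exact: mulIf (invr_neq0 D0) _ _ (congr1 snd e).
  rewrite mul_zmodel mulVKf // addrC subrK; apply: injective_projections => //=.
  apply: injective_projections; apply: (mulfI D0).
    transitivity (a1 * (m.1.1 * b2 - m.1.2 * b1) + b1 * (m.1.2 * a1 - m.1.1 * a2)).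
      by rewrite e1 e2 /D; ring.
    by rewrite /D; ring.
  transitivity (a2 * (m.1.1 * b2 - m.1.2 * b1) + b2 * (m.1.2 * a1 - m.1.1 * a2)).
    by rewrite e1 e2 /D; ring.
  by rewrite /D; ring.
- by move=> i j; rewrite /zeta mulrDr zmodelM.
- by move=> i j /(congr1 snd)/(mulfI k0).
- by move=> i m n; rewrite zmodel_central.
- move=> x y z; rewrite model_asc; congr (_ * zmodel _ _ _ _ _ _)%L.
  rewrite /pi /asc /=; move: x.1 y.1 z.1 => [x1 x2] [y1 y2] [z1 z2] /=.
  transitivity (k * k^-1 * (D * D^-1) * D^-1 ^+ 2
     * ((s * a1 + t * a2) * (y1 * b2 - y2 * b1) + (s * b1 + t * b2) * (y2 * a1 - y1 * a2))
     * ((x1 * b2 - x2 * b1) * (z2 * a1 - z1 * a2)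
        - (x2 * a1 - x1 * a2) * (z1 * b2 - z2 * b1))); last by ring.
  rewrite [in RHS](_ : _ * _ + _ * _ = D * (s * y1 + t * y2)); last by rewrite /D; ring.
  rewrite [X in _ = _ * X](_ : _ = D * (x1 * z2 - x2 * z1)); last by rewrite /D; ring.
  rewrite !mulfV // !mul1r.
  transitivity ((D^-1 * D) ^+ 2 * ((s * y1 + t * y2) * (x1 * z2 - x2 * z1))).
    by rewrite mulVf // expr1n mul1r.
  by ring.
- by move=> i; rewrite /pi /= !mul0r subrr mul0r.
- by rewrite /pi /= divff // [a2 * a1]mulrC subrr mul0r.
- by rewrite /pi /= [b1 * b2]mulrC subrr mul0r; congr (_, _); rewrite [b2 * a1]mulrC [b1 * a2]mulrC divff.
- by rewrite model_powp /zeta mulVKf.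
- by rewrite model_powp /zeta mulVKf.
Qed.

End Rebase.

Section CentralExtension.

Variables (p : nat) (p_pr : prime p).

Lemma central_isomorphic_model (L : finLoopType) (z : L) :
    #|{: L}| = (p ^ 3)%N -> commutative (@lmul L) -> auto_law L ->
    ~ associative (@lmul L) -> central z -> z <> 1%L ->
  exists c1 c2 s t, (s, t) != 0 :> 'F_p * 'F_p /\
    isomorphic (model p_pr c1 c2 s t) L.
Proof.
move=> cardL mulC law nA zc nz1.
have [pi [zeta [[piM piS pi_fib zetaM zetaI] zetac]]] :=
  central_structure p_pr cardL mulC law nA zc nz1.
have zetaA k x y : (x * y * zeta k = x * (y * zeta k))%L.
  by move: (zetac k).1 => /centralP->.
have [[x px] [y py]] := (piS (1, 0), piS (0, 1)).
have xp u : pi u *+ p = 0 -> exists c, iter p (lmul u) 1%L = zeta c.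
  move=> u0; have [|c ->] := pi_fib 1%L (iter p (lmul u) 1%L).
    by rewrite (pi_iter piM) u0 (pi1 piM).
  by exists c; rewrite lmul1l.
have [[c1 xc] [c2 yc]] := (xp x (Fp_pair_mulrn p_pr _), xp y (Fp_pair_mulrn p_pr _)).
pose d := delta piM pi_fib.
have assoc a b c : (a * b * c =
    a * (b * c) * zeta (asc (d x x y) (d x y y) (pi a) (pi b) (pi c)))%L.
  by rewrite (deltaE piM pi_fib a b c) (associator_form mulC piM pi_fib zetaM zetaI zetaA law px py).
exists c1, c2, (d x x y), (d x y y); split; last first.
  apply: (extension_model p_pr mulC piM pi_fib zetaM zetaI zetaA assoc _ px py xc yc).
  by move=> k; exact: (zetac k).2.
apply/eqP=> -[d1 d2]; apply: nA => a b c.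
by rewrite assoc d1 d2 /asc !mul0r addr0 mul0r (zeta0 zetaM) lmull1.
Qed.

End CentralExtension.

(** * Quotients of the loop F *)

Section QuotientsOfF.

Variables (p : nat) (p_pr : prime p).
Implicit Types (N : {vspace 'rV['F_p]_4}).

Definition functional (c1 c2 s t : 'F_p) (v : 'rV['F_p]_4) : 'F_p :=
  c1 * v 0 0 + c2 * v 0 1 + s * v 0 2 + t * v 0 3.

(** The functional, applied to the last four coordinates of F, gives a
    homomorphism onto the extension whose fibres are the cosets of N. *)
Lemma quotientF_model N c1 c2 s t :
    (s, t) != 0 :> 'F_p * 'F_p -> (forall v, (v \in N) = (functional c1 c2 s t v == 0)) ->
  isomorphic (quotientF p_pr N) (model p_pr c1 c2 s t).
Proof.
move=> st0 memN.
pose f (a : loopF p_pr) : model p_pr c1 c2 s t :=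
  ((a`_0, a`_1), c1 * a`_2 + c2 * a`_3 + s * a`_4 + t * a`_5).
have f_center a v : f (a * centerF p_pr v)%L = (f a * zmodel p_pr c1 c2 s t (functional c1 c2 s t v))%L.
  by rewrite mulF_center mul_zmodel /f /functional /=; congr (_, _); ring.
apply: (@first_isomorphism _ _ (Defs.center_normal p_pr N) _ f) => [[[u1 u2] k]|a b|a b].
- have [s0 | s0] := eqVneq s 0.
    have t0 : t != 0 by apply: contraNneq st0 => t0; rewrite s0 t0.
    exists [tuple u1; u2; 0; 0; 0; k / t]; congr (_, _) => /=.
    by rewrite !mulr0 !add0r mulrCA divff // mulr1.
  exists [tuple u1; u2; 0; 0; k / s; 0]; congr (_, _) => /=.
  by rewrite !mulr0 !add0r addr0 mulrCA divff // mulr1.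
- by rewrite modelE /f /cocycle /theta /=; congr (_, _); ring.
split=> [e | /imsetP[_ /imsetP[v vN ->] ->]]; last first.
  by rewrite f_center; move: vN; rewrite memN => /eqP->; rewrite mul_zmodel addr0; case: (f a).
pose v : 'rV['F_p]_4 := \row_i nth 0 [:: b`_2 - a`_2; b`_3 - a`_3; b`_4 - a`_4; b`_5 - a`_5] i.
have e0 : a`_0 = b`_0 := congr1 (fun m => m.1.1) e.
have e1 : a`_1 = b`_1 := congr1 (fun m => m.1.2) e.
have bE : b = (a * centerF p_pr v)%L.
  rewrite mulF_center !mxE /= e0 e1 [LHS]loopF_eta; apply/val_inj => /=.
  by congr [:: _; _; _; _; _; _]; rewrite addrC subrK.
rewrite bE; apply/imset_f/imset_f; rewrite memN; apply/eqP.
apply: (congr1 snd (_ : zmodel p_pr c1 c2 s t _ = zmodel p_pr c1 c2 s t _)).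
by apply: (lmulI (x := f a)); rewrite -f_center -bE -e mul_zmodel addr0; case: (f a).
Qed.

Lemma orbit_quotientF N N' :
  orbitG p_pr N N' -> isomorphic (quotientF p_pr N) (quotientF p_pr N').
Proof.
case=> rho [f [[[fB fM] _ _] NN']].
apply: (@first_isomorphism _ _ (Defs.center_normal p_pr N) _
          (fun a => quotient_map (Defs.center_normal p_pr N') (f a))) => [C|a b|a b].
- have [b <-] := quotient_map_onto C; have [a <-] := bij_onto fB b.
  by exists a.
- by rewrite fM quotient_mapM.
have fI := bij_inj fB.
have mem c : (f c \in center_set p_pr N') = (c \in center_set p_pr N).
  by rewrite NN' mem_imset.
split=> [/eqP | /imsetP[c cN ->]].
  rewrite quotient_map_eq => /imsetP[d]; rewrite NN' => /imsetP[c cN ->].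
  by rewrite -fM => /fI->; apply: imset_f.
by apply/eqP; rewrite quotient_map_eq fM; apply: imset_f; rewrite mem.
Qed.

Lemma span_functional c1 c2 s t (X : seq 'rV['F_p]_4) :
    (forall x, x \in X -> functional c1 c2 s t x = 0) ->
    (forall v, functional c1 c2 s t v = 0 -> v \in <<X>>%VS) ->
  forall v, (v \in <<X>>%VS) = (functional c1 c2 s t v == 0).
Proof.
move=> X0 gen v; apply/idP/eqP => [vX|]; last exact: gen.
rewrite (coord_span (X := in_tuple X) vX).
elim/big_ind: _ => [|u w u0 w0|i _]; first by rewrite /functional !mxE !mulr0 !addr0.
  by rewrite -[RHS]addr0 -{1}u0 -w0 /functional !mxE; ring.
rewrite -[RHS](mulr0 (coord (in_tuple X) i v)) -(X0 (in_tuple X)`_i) ?mem_nth //.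
by rewrite /functional !mxE; ring.
Qed.

Lemma row4_eq (u v : 'rV['F_p]_4) :
  u 0 0 = v 0 0 -> u 0 1 = v 0 1 -> u 0 2 = v 0 2 -> u 0 3 = v 0 3 -> u = v.
Proof.
move=> e0 e1 e2 e3; apply/rowP=> -[[|[|[|[|i]]]] lti] //.
- by rewrite (_ : Ordinal lti = 0) //; apply/val_inj.
- by rewrite (_ : Ordinal lti = 1) //; apply/val_inj.
- by rewrite (_ : Ordinal lti = 2) //; apply/val_inj.
- by rewrite (_ : Ordinal lti = 3) //; apply/val_inj.
Qed.

Local Notation xp := (xp p). Local Notation yp := (yp p).
Local Notation xxy := (xxy p). Local Notation xyy := (xyy p).

Lemma functional_kernel3 c1 c2 s t (x y z : 'rV['F_p]_4) (f g h : 'rV['F_p]_4 -> 'F_p) :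
    functional c1 c2 s t x = 0 -> functional c1 c2 s t y = 0 ->
    functional c1 c2 s t z = 0 ->
    (forall v, functional c1 c2 s t v = 0 -> v = f v *: x + g v *: y + h v *: z) ->
  forall v, (v \in <<[:: x; y; z]>>%VS) = (functional c1 c2 s t v == 0).
Proof.
move=> x0 y0 z0 gen; apply: span_functional => [w|v /gen->].
  by rewrite !inE => /or3P[] /eqP->.
by rewrite !memvD // memvZ // memv_span // !inE eqxx ?orbT.
Qed.

Lemma memN2 v : (v \in ((<[xp]> + <[yp]>) + <[xxy]>)%VS) = (functional 0 0 0 1 v == 0).
Proof.
have -> : ((<[xp]> + <[yp]>) + <[xxy]>)%VS = <<[:: xp; yp; xxy]>>%VS.
  by rewrite !span_cons span_nil addv0 addvA.
apply: (@functional_kernel3 _ _ _ _ _ _ _ (fun v => v 0 0) (fun v => v 0 1) (fun v => v 0 2)).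
- by rewrite /functional !mxE /=; ring.
- by rewrite /functional !mxE /=; ring.
- by rewrite /functional !mxE /=; ring.
move=> {}v; rewrite /functional !mul0r !add0r mul1r => v3.
by apply: row4_eq; rewrite !mxE /= ?v3; ring.
Qed.

Lemma memN3 v :
  (v \in <<[:: xp; (yp + xyy)%R; xxy]>>%VS) = (functional 0 1 0 (-1) v == 0).
Proof.
apply: (@functional_kernel3 _ _ _ _ _ _ _ (fun v => v 0 0) (fun v => v 0 1) (fun v => v 0 2)).
- by rewrite /functional !mxE /=; ring.
- by rewrite /functional !mxE /=; ring.
- by rewrite /functional !mxE /=; ring.
move=> {}v; rewrite /functional => e.
have {}e : v 0 3 = v 0 1 by rewrite -[RHS]subr0 -[X in _ - X]e; ring.
by apply: row4_eq; rewrite !mxE /= ?e; ring.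
Qed.

Lemma memN45 lam v :
  (v \in <<[:: yp; (lam *: xp + xyy)%R; xxy]>>%VS) = (functional 1 0 0 (- lam) v == 0).
Proof.
apply: (@functional_kernel3 _ _ _ _ _ _ _ (fun v => v 0 1) (fun v => v 0 3) (fun v => v 0 2)).
- by rewrite /functional !mxE /=; ring.
- by rewrite /functional !mxE /=; ring.
- by rewrite /functional !mxE /=; ring.
move=> {}v; rewrite /functional => e.
have {}e : v 0 0 = lam * v 0 3 by rewrite -[RHS]addr0 -[X in _ + X]e; ring.
by apply: row4_eq; rewrite !mxE /= ?e; ring.
Qed.

Lemma memN34_3 e v :
  (v \in <<[:: (xp + e *: xyy)%R; yp; xxy]>>%VS) = (functional (- e) 0 0 1 v == 0).
Proof.
apply: (@functional_kernel3 _ _ _ _ _ _ _ (fun v => v 0 0) (fun v => v 0 1) (fun v => v 0 2)).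
- by rewrite /functional !mxE /=; ring.
- by rewrite /functional !mxE /=; ring.
- by rewrite /functional !mxE /=; ring.
move=> {}v; rewrite /functional => e0.
have {}e0 : v 0 3 = e * v 0 0 by rewrite -[RHS]addr0 -[X in _ + X]e0; ring.
by apply: row4_eq; rewrite !mxE /= ?e0; ring.
Qed.

Lemma memN5_3 v :
  (v \in <<[:: (xp - xyy)%R; (yp + xyy)%R; xxy]>>%VS) = (functional 1 (-1) 0 1 v == 0).
Proof.
apply: (@functional_kernel3 _ _ _ _ _ _ _ (fun v => v 0 0) (fun v => v 0 1) (fun v => v 0 2)).
- by rewrite /functional !mxE /=; ring.
- by rewrite /functional !mxE /=; ring.
- by rewrite /functional !mxE /=; ring.
move=> {}v; rewrite /functional => e.
have {}e : v 0 3 = v 0 1 - v 0 0 by rewrite -[RHS]addr0 -[X in _ + X]e; ring.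
by apply: row4_eq; rewrite !mxE /= ?e; ring.
Qed.

End QuotientsOfF.

(** * Normal forms of the extensions *)

Section Squares.

Variables (p : nat) (p_pr : prime p).
Implicit Types a b : 'F_p.

Definition is_square a := exists m, m ^+ 2 = a.

Lemma expFp_card a n : p = n -> a ^+ n = a.
Proof. by move=> <-; have := expf_card a; rewrite card_Fp. Qed.

(** Over a generator of the multiplicative group nonsquares are the odd
    powers. *)
Lemma nonsquareM a b : ~ is_square a -> ~ is_square b -> is_square (a * b).
Proof.
move=> na nb.
have a0 : a != 0 by apply/eqP=> a0; case: na; exists 0; rewrite a0 expr0n.
have b0 : b != 0 by apply/eqP=> b0; case: nb; exists 0; rewrite b0 expr0n.
have /cyclicP[g gP] := field_unit_group_cyclic [set: {unit 'F_p}].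
have odd_pow c : c != 0 -> ~ is_square c -> exists2 i, odd i & c = val g ^+ i.
  rewrite -unitfE => cU nc.
  have : FinRing.unit 'F_p cU \in <[g]>%g by rewrite -gP inE.
  case/cycleP=> i /(congr1 val); rewrite FinRing.val_unitX /= => def_c.
  exists i => //; apply: contraT => evi; case: nc; exists (val g ^+ i./2).
  by rewrite -exprM muln2 even_halfK.
have [i oddi ->] := odd_pow a a0 na; have [j oddj ->] := odd_pow b b0 nb.
exists (val g ^+ (i + j)./2).
by rewrite -exprM muln2 even_halfK ?exprD // oddD oddi oddj.
Qed.

(** Otherwise squaring would be a permutation, although 1 and -1 have the same
    square. *)
Lemma exists_nonsquare : odd p -> exists a, ~ is_square a.
Proof.
move=> oddp; have [|all_sq] := altP (@existsP _ (fun a => [forall m, m ^+ 2 != a])).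
  by case=> a /forallP na; exists a => -[m ma]; have := na m; rewrite ma eqxx.
have onto a : exists m, m ^+ 2 == a.
  by move: all_sq; rewrite negb_exists => /forallP/(_ a)/forallPn[m]; rewrite negbK; exists m.
pose r a := xchoose (onto a); have rK : cancel r (fun m => m ^+ 2).
  by move=> a; exact/eqP/(xchooseP (onto a)).
have /bij_inj sq_inj : bijective (fun m : 'F_p => m ^+ 2).
  have r_inj := can_inj rK; have [q qK Kq] := injF_bij r_inj.
  exists r => // m; rewrite -{1}[m]Kq rK; exact: Kq.
have : (1 : 'F_p) = - 1 by apply: sq_inj; rewrite sqrrN.
move/eqP; rewrite -subr_eq0 opprK -[1 + 1]/(2%:R) -(dvdn_pcharf (pchar_Fp p_pr)).
by rewrite dvdn_prime2 // => /eqP p2; rewrite p2 in oddp.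
Qed.

End Squares.

Section NormalForms.

Variables (p : nat) (p_pr : prime p).
Local Notation model := (model p_pr).

Lemma model_rebase_eq (a1 a2 b1 b2 k c1 c2 s t d1 d2 s' t' : 'F_p) :
    a1 * b2 - a2 * b1 != 0 -> k != 0 ->
    k * d1 = psi c1 c2 s t (a1, a2) -> k * d2 = psi c1 c2 s t (b1, b2) ->
    k * s' = (a1 * b2 - a2 * b1) * (s * a1 + t * a2) ->
    k * t' = (a1 * b2 - a2 * b1) * (s * b1 + t * b2) ->
  isomorphic (model d1 d2 s' t') (model c1 c2 s t).
Proof.
move=> D0 k0 e1 e2 e3 e4; have := model_rebase p_pr c1 c2 s t D0 k0.
by rewrite -e1 -e2 -!(mulrA k^-1) -e3 -e4 !mulKf.
Qed.

(** A basis whose first vector spans the middle nucleus modulo the centre. *)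
Lemma model_nuclear_basis c1 c2 s t : (s, t) != 0 :> 'F_p * 'F_p ->
  exists d1 d2 t', t' != 0 /\ isomorphic (model d1 d2 0 t') (model c1 c2 s t).
Proof.
move=> st0; have [t0 | t0] := eqVneq t 0.
  have s0 : s != 0 by apply: contraNneq st0 => s0; rewrite s0 t0.
  exists (psi c1 c2 s t (0, - s)), (psi c1 c2 s t (1, 0)), (s * s).
  split; first by rewrite mulf_neq0.
  apply: (model_rebase_eq (a1 := 0) (a2 := - s) (b1 := 1) (b2 := 0) (k := 1));
    rewrite ?oner_eq0 ?t0 //; try by ring.
  by rewrite mulr1 mul0r sub0r opprK.
exists (psi c1 c2 s t (t, - s)), (psi c1 c2 s t (0, 1)), (t * t).
split; first by rewrite mulf_neq0.
apply: (model_rebase_eq (a1 := t) (a2 := - s) (b1 := 0) (b2 := 1) (k := 1));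
  rewrite ?oner_eq0 //; try by ring.
by rewrite mulr1 mulr0 subr0.
Qed.

(** Changes of basis that keep the middle nucleus on the first axis. *)
Lemma model_rebase0 (a b g k c1 c2 t d1 d2 t' : 'F_p) :
    a != 0 -> b != 0 -> k != 0 -> k * d1 = a * c1 ->
    k * d2 = c1 * g + c2 * b - (p == 3)%:R * (t * g * b ^+ 2) ->
    k * t' = a * b ^+ 2 * t ->
  isomorphic (model d1 d2 0 t') (model c1 c2 0 t).
Proof.
move=> a0 b0 k0 e1 e2 e3.
apply: (model_rebase_eq (a1 := a) (a2 := 0) (b1 := g) (b2 := b) (k := k)) => //.
- by rewrite mul0r subr0 mulf_neq0.
- by rewrite e1 /psi /=; ring.
- by rewrite e2 /psi /=; ring.
- by ring.
- by rewrite e3; ring.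
Qed.

(** For p <> 3 the p-th power map and the associator functional (s, t) are linear
    forms on the plane. The former vanishes, is a multiple of the latter, or is
    independent of it; in the last case a ratio of scales remains, which a change
    of basis multiplies by squares. *)
Lemma model_normal_form c1 c2 s t (lam : 'F_p) :
    p != 3%N -> (s, t) != 0 :> 'F_p * 'F_p -> (odd p -> ~ is_square lam) ->
  [\/ isomorphic (model 0 0 0 1) (model c1 c2 s t),
      isomorphic (model 0 1 0 (-1)) (model c1 c2 s t),
      isomorphic (model 1 0 0 (-1)) (model c1 c2 s t)
    | odd p /\ isomorphic (model 1 0 0 (- lam)) (model c1 c2 s t)].
Proof.
move=> p3 st0 nsq; have [d1 [d2 [t' [t0 iso]]]] := model_nuclear_basis c1 c2 st0.
have [d10 | d10] := eqVneq d1 0.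
  have [d20 | d20] := eqVneq d2 0.
    apply: Or41; apply: isomorphic_trans iso; rewrite d10 d20.
    by apply: (model_rebase0 (a := 1) (b := 1) (g := 0) (k := t'));
      rewrite ?oner_eq0 // ?(negPf p3); ring.
  apply: Or42; apply: isomorphic_trans iso; rewrite d10.
  apply: (model_rebase0 (a := - d2 / t') (b := 1) (g := 0) (k := d2)) => //.
  - by rewrite mulf_neq0 ?oppr_eq0 ?invr_eq0.
  - by rewrite !mulr0.
  - by rewrite (negPf p3); ring.
  - by field.
have r0 : - d1 / t' != 0 by rewrite mulf_neq0 ?oppr_eq0 ?invr_eq0.
have form b e : b ^+ 2 = - d1 / t' * e -> b != 0 ->
    isomorphic (model 1 0 0 (- e)) (model c1 c2 s t).
  move=> be b0; apply: isomorphic_trans iso.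
  apply: (model_rebase0 (a := 1) (b := b) (g := - d2 * b / d1) (k := d1)) => //.
  - by ring.
  - by rewrite (negPf p3) mul0r subr0; field.
  - by rewrite be; field.
have sq0 b e : b ^+ 2 = - d1 / t' * e -> e != 0 -> b != 0.
  move=> be e0; apply: contraNneq (mulf_neq0 r0 e0) => b0.
  by rewrite -be b0 expr0n.
case: (boolP [exists b, b ^+ 2 == - d1 / t']) => [/existsP[b /eqP be] | /existsPn nr].
  by apply: Or43; apply: (form b); rewrite ?mulr1 ?(sq0 b 1) ?mulr1 ?oner_eq0.
have nsr : ~ is_square (- d1 / t') by case=> b be; have := nr b; rewrite be eqxx.
have oddp : odd p.
  have [p2 | //] := even_prime p_pr; case: nsr; exists (- d1 / t').
  exact: expFp_card p2.
apply: Or44; split=> //; have [b be] := nonsquareM nsr (nsq oddp).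
apply: (form b) => //; apply: sq0 be _.
by apply/eqP=> l0; case: (nsq oddp); exists 0; rewrite l0 expr0n.
Qed.

(** For p = 3 the cubing map is c1 u1 + c2 u2 - t u1 u2 ^ 2 in such a basis, so
    c2 can be removed by a shear exactly when c1 <> t. *)
Lemma model_normal_form3 c1 c2 s t :
    p = 3%N -> (s, t) != 0 :> 'F_p * 'F_p ->
  [\/ isomorphic (model 0 0 0 1) (model c1 c2 s t),
      isomorphic (model (-1) 0 0 1) (model c1 c2 s t),
      isomorphic (model 1 0 0 1) (model c1 c2 s t)
    | isomorphic (model 1 (-1) 0 1) (model c1 c2 s t)].
Proof.
move=> p3 st0; have [d1 [d2 [t' [t0 iso]]]] := model_nuclear_basis c1 c2 st0.
have p33 : p == 3%N by rewrite p3.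
have sqr1 (x : 'F_p) : x != 0 -> x ^+ 2 = 1.
  move=> x0; apply: (mulfI x0); have := expFp_card p_pr x p3.
  by rewrite exprS mulr1.
have [dt | dt] := eqVneq d1 t'.
  have [d20 | d20] := eqVneq d2 0.
    apply: Or43; apply: isomorphic_trans iso; rewrite dt d20.
    by apply: (model_rebase0 (a := 1) (b := 1) (g := 0) (k := t'));
      rewrite ?oner_eq0 //; ring.
  apply: Or44; apply: isomorphic_trans iso; rewrite dt.
  have b0 : - t' / d2 != 0 by rewrite mulf_neq0 ?oppr_eq0 ?invr_eq0.
  apply: (model_rebase0 (a := 1) (b := - t' / d2) (g := 0) (k := t')) => //.
  - by ring.
  - by field.
  - by rewrite sqr1 //; ring.
have shear : isomorphic (model d1 0 0 t') (model c1 c2 s t).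
  apply: isomorphic_trans iso.
  apply: (model_rebase0 (a := 1) (b := 1) (g := - d2 / (d1 - t')) (k := 1));
    rewrite ?oner_eq0 ?p33 ?mul1r //; try by ring.
  by field; rewrite subr_eq0.
have [d10 | d10] := eqVneq d1 0.
  apply: Or41; apply: isomorphic_trans shear; rewrite d10.
  by apply: (model_rebase0 (a := 1) (b := 1) (g := 0) (k := t'));
    rewrite ?oner_eq0 //; ring.
have dNt : d1 = - t'.
  apply/eqP; rewrite -addr_eq0; have : (d1 - t') * (d1 + t') == 0.
    by rewrite -subr_sqr !sqr1 // subrr.
  by rewrite mulf_eq0 subr_eq0 (negPf dt).
apply: Or42; apply: isomorphic_trans shear; rewrite dNt.
by apply: (model_rebase0 (a := 1) (b := 1) (g := 0) (k := t'));
  rewrite ?oner_eq0 //; ring.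
Qed.

End NormalForms.

Section ModelInvariants.

Variables (p : nat) (p_pr : prime p).
Local Notation model := (model p_pr).

(** For s = 0 the middle nucleus lies above the first axis, and p-th powers are
    given by [psi]; this turns the invariants into conditions on [psi]. *)
Lemma model_mid (c1 c2 t : 'F_p) (x : model c1 c2 0 t) : t != 0 ->
  mid_nuclear x <-> x.1.2 = 0.
Proof.
move=> t0; split=> [mx | x2 u w]; last first.
  rewrite model_asc /asc x2 !mul0r mulr0 addr0 mul0r.
  by rewrite mul_zmodel addr0; case: (_ * _)%L.
have := model_asc (((1, 0), 0) : model c1 c2 0 t) x ((0, 1), 0).
rewrite mx => /esym/lmul_eq1l/(congr1 snd)/eqP.
by rewrite /asc /= mul0r add0r mulr1 mulr0 subr0 mulr1 mulf_eq0 (negPf t0) => /eqP.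
Qed.

Lemma model_lpow (c1 c2 s t : 'F_p) (x : model c1 c2 s t) :
  lpow p x = zmodel p_pr c1 c2 s t (psi c1 c2 s t x.1).
Proof. exact: model_powp. Qed.

Lemma model_lpow1 (c1 c2 s t : 'F_p) (x : model c1 c2 s t) :
  lpow p x = 1%L <-> psi c1 c2 s t x.1 = 0.
Proof. by rewrite model_lpow; split=> [/(congr1 snd) | ->]. Qed.

Lemma psi_not3 (c1 c2 s t : 'F_p) u :
  p != 3%N -> psi c1 c2 s t u = c1 * u.1 + c2 * u.2.
Proof. by move=> p3; rewrite /psi (negPf p3) mul0r addr0. Qed.

Lemma psi_3 (c1 c2 t : 'F_p) u : p = 3%N ->
  psi c1 c2 0 t u = c1 * u.1 + c2 * u.2 - t * u.1 * (u.2 != 0)%:R.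
Proof.
move=> p3; rewrite /psi (introT eqP p3) mul1r !mul0r sub0r; congr (_ - _ * _).
have [-> | u0] := eqVneq u.2 0; first by rewrite expr0n.
by apply: (mulfI u0); rewrite -exprS (expFp_card p_pr _ p3) mulr1.
Qed.

Lemma model_inv_nuclear (c1 c2 t : 'F_p) : t != 0 ->
  inv_nuclear p (model c1 c2 0 t) <-> c1 <> 0.
Proof.
have psi1 u1 : psi c1 c2 0 t (u1, 0) = c1 * u1 by rewrite /psi /=; ring.
move=> t0; split=> [[x [/(model_mid x t0) x2]] | c10].
  rewrite model_lpow1 => px c10; apply: px.
  by case: x x2 => -[u1 u2] k /= ->; rewrite psi1 c10 mul0r.
exists ((1, 0), 0); rewrite model_mid //; split=> //.
by rewrite model_lpow1 psi1 mulr1.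
Qed.

Lemma model_inv_outer (c1 c2 t : 'F_p) : t != 0 ->
  inv_outer p (model c1 c2 0 t) <->
  exists u : 'F_p * 'F_p, u.2 <> 0 /\ psi c1 c2 0 t u <> 0.
Proof.
move=> t0; split=> [[x []] | [u [u2 pu]]].
  by rewrite model_mid // model_lpow1; exists x.1.
by exists (u, 0); rewrite model_mid // model_lpow1.
Qed.

Lemma model_inv_outer1 (c1 c2 t : 'F_p) : t != 0 ->
  inv_outer1 p (model c1 c2 0 t) <->
  exists u : 'F_p * 'F_p, u.2 <> 0 /\ psi c1 c2 0 t u = 0.
Proof.
move=> t0; split=> [[x []] | [u [u2 pu]]].
  by rewrite model_mid // model_lpow1; exists x.1.
by exists (u, 0); rewrite model_mid // model_lpow1.
Qed.

Lemma model_inv_square (e : 'F_p) : p != 3%N -> e != 0 ->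
  inv_square p (model 1 0 0 (- e)) <-> is_square e.
Proof.
move=> p3 e0; have ne0 : - e != 0 by rewrite oppr_eq0.
have key (x y : model 1 0 0 (- e)) :
    (x * y * y * lpow p x = x * (y * y) * zmodel p_pr 1%R 0 0 (- e)
       (x.1.1 + (- e * y.1.2) * (x.1.1 * y.1.2 - x.1.2 * y.1.1))%R)%L.
  rewrite (model_asc x y y) model_lpow -[LHS]zmodel_central -zmodelM psi_not3 // /asc.
  by congr (_ * zmodel _ _ _ _ _ _)%L; ring.
split=> [[x [y [/(model_mid x ne0) x2]]] | [m me]].
  rewrite !model_lpow1 !psi_not3 // !mul1r !mul0r !addr0 => x1 y1.
  rewrite key x2 y1 => /lmul_eq1l/(congr1 snd)/= xy.
  have {}xy : x.1.1 * (1 - e * y.1.2 ^+ 2) = 0 by rewrite -[RHS]xy; ring.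
  move/eqP: xy; rewrite mulf_eq0 => /orP[/eqP // | ]; rewrite subr_eq0 => /eqP ey.
  have y0 : y.1.2 != 0.
    by apply/eqP=> y0; move/eqP: ey; rewrite y0 expr0n mulr0 oner_eq0.
  by exists (y.1.2^-1); apply: (mulIf (expf_neq0 2 y0)); rewrite -ey; field.
have m0 : m != 0 by apply: contraNneq e0 => m0; rewrite -me m0 expr0n.
exists ((1, 0), 0), ((0, m^-1), 0).
split.
- by rewrite model_mid.
- rewrite model_lpow1 psi_not3 //= mul1r mul0r addr0. 
- by rewrite model_lpow1 psi_not3 //= mulr0 mul0r addr0.
rewrite key /= -me (_ : _ + _ = 0); last by field.
by rewrite mul_zmodel addr0; case: (_ * _)%L.
Qed.

Lemma model_central (c1 c2 s t : 'F_p) : inv_central (model c1 c2 s t).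
Proof.
exists (zmodel p_pr c1 c2 s t 1); split; last by move=> x y; rewrite zmodel_central.
by move/(congr1 snd)/eqP; rewrite /= oner_eq0.
Qed.

Lemma model_nonassoc (c1 c2 t : 'F_p) : t != 0 -> ~ associative (@lmul (model c1 c2 0 t)).
Proof.
move=> t0 mulA; have : mid_nuclear (((0, 1), 0) : model c1 c2 0 t) by move=> u w; rewrite mulA.
by move/model_mid => /(_ t0) /= /eqP; rewrite oner_eq0.
Qed.

Lemma model_comm_automorphic (c1 c2 s t : 'F_p) :
  comm_automorphic_of_order (p ^ 3) (model c1 c2 s t).
Proof.
split; [exact: modelC | exact/(automorphicP (@modelC _ _ _ _ _ _))/model_law | exact: card_model].
Qed.

End ModelInvariants.

(** * The classification *)

Lemma classifies_pairwise (P : finLoopType -> Prop) (s : seq finLoopType) :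
    (forall i L, onth s i = Some L -> P L) ->
    (forall i j L M, (i < j)%N -> onth s i = Some L -> onth s j = Some M ->
       ~ isomorphic L M) ->
    (forall L, P L -> exists i M, onth s i = Some M /\ isomorphic L M) ->
  classifies P s.
Proof.
move=> sP sN sC; split=> // i j L M sL sM LM.
case: (ltngtP i j) => // ltij; first by case: (sN _ _ _ _ ltij sL sM).
by case: (sN _ _ _ _ ltij sM sL); exact: isomorphic_sym.
Qed.

Section Classification.

Variables (p : nat) (p_pr : prime p).

Let P := nonassoc_comm_automorphic_of_order (p ^ 3).
Local Notation model := (model p_pr).

Lemma nonassoc_with_centre (L : finLoopType) (z : L) :
  P L -> central z -> z <> 1%L ->
  exists c1 c2 s t, (s, t) != 0 :> 'F_p * 'F_p /\ isomorphic (model c1 c2 s t) L.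
Proof.
move=> [[mulC /(automorphicP mulC) law cardL] nA] zc nz1.
exact: central_isomorphic_model zc nz1.
Qed.

Lemma nonassoc_odd (L : finLoopType) : odd p -> P L ->
  exists c1 c2 s t, (s, t) != 0 :> 'F_p * 'F_p /\ isomorphic (model c1 c2 s t) L.
Proof.
move=> oddp PL; have [[mulC /(automorphicP mulC) law cardL] nA] := PL.
have [|||z zc nz1] := exists_central mulC law _ _ oddp.
- by rewrite cardL oddX oddp orbT.
- by rewrite cardL pnatX pnat_id.
- by rewrite cardL -(exp1n 3) ltn_exp2r ?prime_gt1.
- exact: nonassoc_with_centre zc nz1.
Qed.

Lemma model_nonassoc_comm_automorphic c1 c2 t : t != 0 -> P (model c1 c2 0 t).
Proof.
by move=> t0; split; [exact: model_comm_automorphic | exact: model_nonassoc].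
Qed.

Definition models_not3 (lam : 'F_p) : seq finLoopType :=
  [:: model 0 0 0 1 : finLoopType; model 0 1 0 (-1) : finLoopType;
      model 1 0 0 (-1) : finLoopType; model 1 0 0 (- lam) : finLoopType].

Definition models_3 : seq finLoopType :=
  [:: model 0 0 0 1 : finLoopType; model (-1) 0 0 1 : finLoopType;
      model 1 0 0 1 : finLoopType; model 1 (-1) 0 1 : finLoopType].

Definition models_2 : seq finLoopType :=
  [:: model 0 0 0 1 : finLoopType; model 0 1 0 (-1) : finLoopType;
      model 1 0 0 (-1) : finLoopType; table_loop : finLoopType].

Let F1 : (1 : 'F_p) != 0. Proof. exact: oner_neq0. Qed.
Let FN1 : (-1 : 'F_p) != 0. Proof. by rewrite oppr_eq0 oner_neq0. Qed.

Section Not3.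

Hypothesis p3 : p != 3%N.

Lemma noniso_nuclear c2 t c1' c2' t' : t != 0 -> t' != 0 -> c1' != 0 ->
  ~ isomorphic (model 0 c2 0 t) (model c1' c2' 0 t').
Proof.
move=> t0 t0' c0; apply: (noniso' (@inv_nuclearP p)).
  by rewrite model_inv_nuclear //; case.
by rewrite model_inv_nuclear //; apply/eqP.
Qed.

Lemma noniso_Q23 : ~ isomorphic (model 0 0 0 1) (model 0 1 0 (-1)).
Proof.
apply: (noniso' (@inv_outerP p)); rewrite model_inv_outer //.
  by case=> u [_]; rewrite psi_not3 // !mul0r addr0; case.
by exists (0, 1); rewrite psi_not3 //= mul0r add0r mul1r.
Qed.

Lemma noniso_Q45 lam : ~ is_square lam ->
  ~ isomorphic (model 1 0 0 (-1)) (model 1 0 0 (- lam)).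
Proof.
move=> nsq; apply: (noniso (@inv_squareP p)); rewrite model_inv_square //.
  by exists 1; rewrite expr1n.
by apply/eqP=> lam0; apply: nsq; exists 0; rewrite lam0 expr0n.
Qed.

Lemma classify_not3 lam : odd p -> ~ is_square lam -> classifies P (models_not3 lam).
Proof.
move=> oddp nsq; have lam0 : - lam != 0.
  by rewrite oppr_eq0; apply/eqP=> lam0; apply: nsq; exists 0; rewrite lam0 expr0n.
apply: classifies_pairwise.
- by case=> [|[|[|[|[]]]]] //= _ [<-]; exact: model_nonassoc_comm_automorphic.
- case=> [|[|[|[|[]]]]] [|[|[|[|[]]]]] //= L M _ [<-] [<-].
  1-6: by [exact: noniso_Q23 | exact: noniso_Q45 | apply: noniso_nuclear].
- move=> L PL; have [c1 [c2 [s [t [st0 /isomorphic_sym isoL]]]]] := nonassoc_odd oddp PL.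
  have [|||[_]] := model_normal_form p_pr c1 c2 p3 st0 (fun=> nsq);
    move/isomorphic_sym/(isomorphic_trans isoL) => isoLM.
  + by exists 0%N, (model 0 0 0 1).
  + by exists 1%N, (model 0 1 0 (-1)).
  + by exists 2%N, (model 1 0 0 (-1)).
  + by exists 3%N, (model 1 0 0 (- lam)).
Qed.

End Not3.

Section Equal3.

Hypothesis p3 : p = 3%N.

Let psiE c1 c2 (u : 'F_p * 'F_p) : u.2 <> 0 ->
  psi c1 c2 0 1 u = (c1 - 1) * u.1 + c2 * u.2.
Proof. by move=> /eqP u2; rewrite psi_3 // u2 /=; ring. Qed.

Lemma inv_outer_Q4 : ~ inv_outer p (model 1 0 0 1).
Proof.
rewrite model_inv_outer // => -[u [u2]]; rewrite psiE //.
by rewrite subrr !mul0r addr0.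
Qed.

Lemma inv_outer_Q3 : inv_outer p (model (-1) 0 0 1).
Proof.
rewrite model_inv_outer //; exists (1, 1); split; first exact/eqP.
rewrite psiE /=; last exact/eqP.
rewrite mulr1 mul0r addr0 -opprD; apply/eqP; rewrite oppr_eq0.
by rewrite -(natrD _ 1 1) -(dvdn_pcharf (pchar_Fp p_pr)) p3.
Qed.

Lemma inv_outer_Q5 : inv_outer p (model 1 (-1) 0 1).
Proof.
rewrite model_inv_outer //; exists (0, 1); split; first exact/eqP.
rewrite psiE /=; last exact/eqP.
by rewrite mulr0 add0r mulr1; apply/eqP.
Qed.

Lemma inv_outer1_Q3 : inv_outer1 p (model (-1) 0 0 1).
Proof.
rewrite model_inv_outer1 //; exists (0, 1); split; first exact/eqP.
by rewrite psiE /=; [rewrite mulr0 mul0r addr0 | exact/eqP].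
Qed.

Lemma inv_outer1_Q5 : ~ inv_outer1 p (model 1 (-1) 0 1).
Proof.
rewrite model_inv_outer1 // => -[u [u2]]; rewrite psiE //.
by rewrite subrr mul0r add0r mulN1r => /eqP; rewrite oppr_eq0 => /eqP.
Qed.

Lemma classify_3 : classifies P models_3.
Proof.
apply: classifies_pairwise.
- by case=> [|[|[|[|[]]]]] //= _ [<-]; exact: model_nonassoc_comm_automorphic.
- case=> [|[|[|[|[]]]]] [|[|[|[|[]]]]] //= L M _ [<-] [<-].
  1-3: by apply: noniso_nuclear.
  + exact: noniso (@inv_outerP p) inv_outer_Q3 inv_outer_Q4.
  + exact: noniso (@inv_outer1P p) inv_outer1_Q3 inv_outer1_Q5.
  + exact: noniso' (@inv_outerP p) inv_outer_Q4 inv_outer_Q5.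
- move=> L PL; have oddp : odd p by rewrite p3.
  have [c1 [c2 [s [t [st0 /isomorphic_sym isoL]]]]] := nonassoc_odd oddp PL.
  have [] := model_normal_form3 p_pr c1 c2 p3 st0;
    move/isomorphic_sym/(isomorphic_trans isoL) => isoLM.
  + by exists 0%N, (model 0 0 0 1).
  + by exists 1%N, (model (-1) 0 0 1).
  + by exists 2%N, (model 1 0 0 1).
  + by exists 3%N, (model 1 (-1) 0 1).
Qed.

End Equal3.

Section Equal2.

Hypothesis p2 : p = 2%N.

Lemma noniso_table c1 c2 s t : ~ isomorphic (model c1 c2 s t) table_loop.
Proof. exact: noniso inv_centralP (model_central _ _ _ _ _) table_no_centre. Qed.

Lemma nonassoc_even (L : finLoopType) : P L ->
  isomorphic table_loop L \/
  exists c1 c2 s t, (s, t) != 0 :> 'F_p * 'F_p /\ isomorphic (model c1 c2 s t) L.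
Proof.
move=> PL; have [[mulC /(automorphicP mulC) law cardL] nA] := PL.
have L8 : #|{: L}| = 8%N by rewrite cardL p2.
have [|sq|[z zc nz1]] := exponent2_or_central mulC law; first by rewrite L8.
  have [mulA|[z zc nz1]|isoT] := exponent2_order8 mulC law L8 sq; last by left.
    by case: nA.
  by right; exact: nonassoc_with_centre zc nz1.
by right; exact: nonassoc_with_centre zc nz1.
Qed.

Lemma classify_2 : classifies P models_2.
Proof.
have p3 : p != 3%N by rewrite p2.
apply: classifies_pairwise.
- case=> [|[|[|[|[]]]]] //= _ [<-]; try exact: model_nonassoc_comm_automorphic.
  by rewrite /P p2; exact: table_comm_automorphic.
- case=> [|[|[|[|[]]]]] [|[|[|[|[]]]]] //= L M _ [<-] [<-].
  1-6: by [exact: noniso_table | exact: noniso_Q23 | apply: noniso_nuclear].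
- move=> L /nonassoc_even[isoT|].
    by exists 3%N, table_loop; split=> //; exact: isomorphic_sym.
  move=> [c1 [c2 [s [t [st0 /isomorphic_sym isoL]]]]].
  have evp : ~~ odd p by rewrite p2.
  have nsq : odd p -> ~ is_square (0 : 'F_p) by rewrite (negPf evp).
  have [|||[]] := model_normal_form p_pr c1 c2 p3 st0 nsq; last by rewrite (negPf evp).
  all: move/isomorphic_sym/(isomorphic_trans isoL) => isoLM.
  + by exists 0%N, (model 0 0 0 1).
  + by exists 1%N, (model 0 1 0 (-1)).
  + by exists 2%N, (model 1 0 0 (-1)).
Qed.

End Equal2.

Lemma orbit_isom_model (N N' : {vspace 'rV['F_p]_4}) c1 c2 s t :
    (forall v, (v \in N) = (functional c1 c2 s t v == 0)) ->
    (s, t) != 0 :> 'F_p * 'F_p -> orbitG p_pr N N' ->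
  isomorphic (model c1 c2 s t) (quotientF p_pr N').
Proof.
move=> memN st0 /orbit_quotientF; apply: isomorphic_trans.
exact/isomorphic_sym/quotientF_model.
Qed.

Lemma pair0_neq0 (t : 'F_p) : t != 0 -> (0, t) != 0 :> 'F_p * 'F_p.
Proof. by apply: contra => /eqP[->]. Qed.

Lemma O2_isom N : O2 p_pr N -> isomorphic (model 0 0 0 1) (quotientF p_pr N).
Proof. by apply: orbit_isom_model; [exact: memN2 | exact: pair0_neq0]. Qed.

Lemma O3_isom N : p != 3%N -> O3 p_pr N ->
  isomorphic (model 0 1 0 (-1)) (quotientF p_pr N).
Proof.
rewrite /O3 => /negPf->.
by apply: orbit_isom_model; [exact: memN3 | exact: pair0_neq0].
Qed.

Lemma O4_isom N : p != 3%N -> O4 p_pr N ->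
  isomorphic (model 1 0 0 (-1)) (quotientF p_pr N).
Proof.
rewrite /O4 => /negPf->; apply: orbit_isom_model; last exact: pair0_neq0.
by move=> v; rewrite -memN45 scale1r.
Qed.

Lemma O5_isom lam N : p != 3%N -> lam != 0 -> O5 p_pr lam N ->
  isomorphic (model 1 0 0 (- lam)) (quotientF p_pr N).
Proof.
rewrite /O5 => /negPf-> lam0; apply: orbit_isom_model; first exact: memN45.
by rewrite pair0_neq0 // oppr_eq0.
Qed.

Lemma O3_isom3 N : p = 3%N -> O3 p_pr N ->
  isomorphic (model (-1) 0 0 1) (quotientF p_pr N).
Proof.
rewrite /O3 => /eqP->; apply: orbit_isom_model; last exact: pair0_neq0.
by move=> v; rewrite -memN34_3 scale1r.
Qed.

Lemma O4_isom3 N : p = 3%N -> O4 p_pr N ->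
  isomorphic (model 1 0 0 1) (quotientF p_pr N).
Proof.
rewrite /O4 => /eqP->; apply: orbit_isom_model; last exact: pair0_neq0.
by move=> v; have := memN34_3 (-1) v; rewrite scaleN1r opprK.
Qed.

Lemma O5_isom3 lam N : p = 3%N -> O5 p_pr lam N ->
  isomorphic (model 1 (-1) 0 1) (quotientF p_pr N).
Proof.
rewrite /O5 => /eqP->; apply: orbit_isom_model; last exact: pair0_neq0.
exact: memN5_3.
Qed.

Lemma quotients_classify_odd lam N2 N3 N4 N5 :
    odd p -> ((3 < p)%N -> ~ is_square lam) ->
    O2 p_pr N2 -> O3 p_pr N3 -> O4 p_pr N4 -> O5 p_pr lam N5 ->
  classifies P [:: quotientF p_pr N2; quotientF p_pr N3;
                   quotientF p_pr N4; quotientF p_pr N5].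
Proof.
move=> oddp nsq o2 o3 o4 o5; have [p3 | p3] := eqVneq p 3%N.
  apply: (classifies_isom _ _ _ (classify_3 p3)) => //; first exact: nonassoc_isom.
  case=> [|[|[|[|[]]]]] //= _ [<-].
  - by exists (model 0 0 0 1); last exact: O2_isom.
  - by exists (model (-1) 0 0 1); last exact: O3_isom3.
  - by exists (model 1 0 0 1); last exact: O4_isom3.
  - by exists (model 1 (-1) 0 1); last exact: O5_isom3 o5.
have {}nsq : ~ is_square lam.
  apply: nsq; rewrite ltn_neqAle eq_sym p3 /=.
  by case: (p) oddp p_pr p3 => [|[|[|]]].
have lam0 : lam != 0 by apply/eqP=> lam0; apply: nsq; exists 0; rewrite lam0 expr0n.
apply: (classifies_isom _ _ _ (classify_not3 p3 oddp nsq)) => //; first exact: nonassoc_isom.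
case=> [|[|[|[|[]]]]] //= _ [<-].
- by exists (model 0 0 0 1); last exact: O2_isom.
- by exists (model 0 1 0 (-1)); last exact: O3_isom.
- by exists (model 1 0 0 (-1)); last exact: O4_isom.
- by exists (model 1 0 0 (- lam)); last exact: O5_isom.
Qed.

Lemma quotients_classify_even N2 N3 N4 :
    p = 2%N -> O2 p_pr N2 -> O3 p_pr N3 -> O4 p_pr N4 ->
  classifies P [:: quotientF p_pr N2; quotientF p_pr N3; quotientF p_pr N4;
                   table_loop : finLoopType].
Proof.
move=> p2 o2 o3 o4; have p3 : p != 3%N by rewrite p2.
apply: (classifies_isom _ _ _ (classify_2 p2)) => //; first exact: nonassoc_isom.
case=> [|[|[|[|[]]]]] //= _ [<-].
- by exists (model 0 0 0 1); last exact: O2_isom.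
- by exists (model 0 1 0 (-1)); last exact: O3_isom.
- by exists (model 1 0 0 (-1)); last exact: O4_isom.
- by exists table_loop; last exact: isomorphic_refl.
Qed.

Lemma exists_nonassoc_classification :
  exists s : seq finLoopType, size s = 4%N /\ classifies P s.
Proof.
have [p2 | oddp] := even_prime p_pr; first by exists models_2; split; last exact: classify_2.
have [p3 | p3] := eqVneq p 3%N; first by exists models_3; split; last exact: classify_3.
have [lam nsq] := exists_nonsquare p_pr oddp.
by exists (models_not3 lam); split; last exact: classify_not3.
Qed.

Lemma associative_isom (L M : finLoopType) :
  isomorphic L M -> associative (@lmul L) -> associative (@lmul M).
Proof. by case=> f [fB fM]; exact: mulA_image (bij_onto fB) fM. Qed.

Lemma forall3_dec (T : finType) (Q : T -> T -> T -> bool) :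
  (forall x y z, Q x y z) \/ ~ (forall x y z, Q x y z).
Proof.
have [/forallP q|nq] := boolP [forall x, [forall y, [forall z, Q x y z]]].
  by left=> x y z; have /forallP/(_ y)/forallP/(_ z) := q x.
right=> q; case/negP: nq; apply/forallP=> x; apply/forallP=> y.
by apply/forallP=> z; exact: q.
Qed.

(** Associativity being decidable and invariant, an associative and a
    nonassociative classification may be concatenated. *)
Lemma classify_all s : classifies P s ->
  classifies (comm_automorphic_of_order (p ^ 3)) (abelian_groups_p3 p ++ s).
Proof.
have [gP gU gC] := abelian_groups_classify p_pr; case=> sP sU sC.
have sz : size (abelian_groups_p3 p) = 3%N by [].
have split_onth i L : onth (abelian_groups_p3 p ++ s) i = Some L ->
    [/\ (i < 3)%N, onth (abelian_groups_p3 p) i = Some L & associative (@lmul L)] \/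
    [/\ (3 <= i)%N, onth s (i - 3) = Some L & ~ associative (@lmul L)].
  rewrite onth_cat sz; case: ltnP => ilt oL; [left | right]; split=> //.
    by case: (gP i L oL).
  by case: (sP _ _ oL).
split.
- move=> i L /split_onth[[_ oL _] | [_ oL _]].
    by case: (gP i L oL).
  by case: (sP _ _ oL).
- move=> i j L M /split_onth[[i3 oL aL] | [i3 oL aL]]
    /split_onth[[j3 oM aM] | [j3 oM aM]] LM.
  + exact: gU oL oM LM.
  + by case: aM; exact: associative_isom aL.
  + by case: aL; exact: associative_isom (isomorphic_sym LM) aM.
  + by rewrite -(subnK i3) -(subnK j3) (sU _ _ _ _ oL oM LM).
- move=> L caL.
  have [aL | aL] := forall3_dec (fun x y z : L => x * (y * z) == x * y * z)%L.
    have [|i [M [oM LM]]] := gC L; first by split=> // x y z; exact/eqP.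
    exists i, M; split=> //; rewrite onth_cat sz.
    by have /[!sz] -> : (i < size (abelian_groups_p3 p))%N by rewrite -onthTE oM.
  have [|i [M [oM LM]]] := sC L.
    by split=> // mulA; apply: aL => x y z; apply/eqP.
  exists (3 + i)%N, M; split=> //; rewrite onth_cat sz.
Qed.

End Classification.

Theorem theorem6p3 (p : nat) (p_pr : prime p) :
  [/\ exists s : seq finLoopType,
        size s = 4%N /\
        classifies (comm_automorphic_of_order (p ^ 3))
          [:: group_loop ('Z_p * 'Z_p * 'Z_p)%type : finLoopType,
              group_loop ('Z_p * 'Z_(p ^ 2))%type : finLoopType,
              group_loop 'Z_(p ^ 3) : finLoopType
            & s],
      odd p ->
        forall lam : 'F_p,
        ((3 < p)%N -> ~ exists mu : 'F_p, mu ^+ 2 = lam) ->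
        forall N2 N3 N4 N5 : {vspace 'rV['F_p]_4},
        O2 p_pr N2 -> O3 p_pr N3 -> O4 p_pr N4 -> O5 p_pr lam N5 ->
        classifies (nonassoc_comm_automorphic_of_order (p ^ 3))
          [:: quotientF p_pr N2; quotientF p_pr N3;
              quotientF p_pr N4; quotientF p_pr N5]
    & p = 2%N ->
        forall N2 N3 N4 : {vspace 'rV['F_p]_4},
        O2 p_pr N2 -> O3 p_pr N3 -> O4 p_pr N4 ->
        classifies (nonassoc_comm_automorphic_of_order (p ^ 3))
          [:: quotientF p_pr N2; quotientF p_pr N3; quotientF p_pr N4;
              table_loop : finLoopType]].
Proof.
split.
- have [s [size_s class_s]] := exists_nonassoc_classification p_pr.
  by exists s; split; last exact: classify_all class_s.
- by move=> oddp lam nsq N2 N3 N4 N5; exact: quotients_classify_odd.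
- by move=> p2 N2 N3 N4; exact: quotients_classify_even.
Qed.
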